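(* Let $\mathcal{G}$ be a minimal groupoid of germs over a Cantor space $X$, and let $\mathcal{H}$ be a groupoid of germs over any compact space $Y$. Let $\rho\colon \mathsf{A}(\mathcal{G})\to \mathsf{F}(\mathcal{H})$ be a non-trivial group homomorphism, and let $Z\subset Y$ be the support of $\rho(\mathsf{A}(\mathcal{G}))$. Then one of the following mutually exclusive cases holds. (i) There exists $y\in Z$ such that the germ map $\mathsf{A}(\mathcal{G})\to \mathcal{H}$, $g\mapsto [\rho(g)]_y$, is injective. (ii) The set $Z$ is clopen, and there exists $r\ge 1$ such that $\rho$ uniquely extends to a continuous morphism of pseudogroups $$\widetilde{\rho}\colon \widetilde{\mathcal{G}^{[r]}}\to \widetilde{\mathcal{H}|Z}.$$
   Context: All spaces are Hausdorff; a Cantor space is a space homeomorphic to the Cantor set. Pseudogroups and germs. A pseudogroup over a compact space $X$ is a collection of homeomorphisms $F\colon U\to V$ between open subsets of $X$ which contains the identity of every open subset of $X$ (in particular the empty homeomorphism, called zero) and is closed under composition (defined on the largest possible domain), inverses, and unions of arbitrary compatible families; a family $\{F_i\colon U_i\to V_i\}$ is compatible if $F_i,F_j$ agree on $U_i\cap U_j$ and $F_i^{-1},F_j^{-1}$ agree on $V_i\cap V_j$ for all $i,j$. The germ $[F]_x$ of $F\colon U\to V$ at $x\in U$ is the equivalence class of $(F,x)$, where $(F_1,x_1)\sim(F_2,x_2)$ if $x_1=x_2$ and $F_1,F_2$ coincide near $x_1$. A groupoid of germs over $X$ is the set $\mathcal{G}$ of all germs of elements of some pseudogroup; it determines the pseudogroup,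 which is denoted $\widetilde{\mathcal{G}}$. The source and range of $[F]_x$ are $x$ and $F(x)$. The orbit of $x$ is $\{F(x)\colon F\in\widetilde{\mathcal{G}},\ x\in \mathrm{dom}(F)\}$; $\mathcal{G}$ is minimal if all orbits are dense. Full groups. $\mathsf{F}(\mathcal{G})$ is the group of elements of $\widetilde{\mathcal{G}}$ with domain and range equal to $X$. $\mathsf{A}(\mathcal{G})\le \mathsf{F}(\mathcal{G})$ (the alternating full group, for $X$ a Cantor space) is the subgroup generated by all 3-cycles, i.e. elements $g\in\mathsf{F}(\mathcal{G})$ of order 3 for which there are disjoint clopen sets $U_1,U_2,U_3$ with $g(U_1)=U_2$, $g(U_2)=U_3$, $g(U_3)=U_1$ and $g$ the identity outside $U_1\cup U_2\cup U_3$. The support of a group of homeomorphisms of $Y$ is the closure of the set of points moved by at least one of its elements. Restriction. $\mathcal{H}|Z$ is the set of germs in $\mathcal{H}$ with source and range in $Z$; for $Z$ clopen, $\mathsf{F}(\mathcal{H}|Z)$ is identified with the subgroup of $\mathsf{F}(\mathcal{H})$ of elements supported in $Z$. Continuous morphisms. For groupoids of germs $\mathcal{G},\mathcal{H}$ over $X,Y$, a continuous morphism $\varphi\colon\widetilde{\mathcal{G}}\to\widetilde{\mathcal{H}}$ is a map that preserves compositions, inverses and unions of compatible families, sends $\mathrm{id}_X$ to $\mathrm{id}_Y$ and the empty homeomorphism to the empty homeomorphism. Symmetric powers. $X^{[r]}$ is the compact space of non-empty subsets of $X$ of cardinality at most $r$, with the quotient topology from $X^r\to X^{[r]}$, $(x_1,\dots,x_r)\mapsto\{x_1,\dots,x_r\}$.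 Every $F\in\widetilde{\mathcal{G}}$ with domain $U$ acts as a partial homeomorphism of $X^{[r]}$ with domain the set of $\{x_1,\dots,x_r\}\subset U$. The symmetric power $\mathcal{G}^{[r]}$ is the groupoid of germs over $X^{[r]}$ consisting of all germs of these partial homeomorphisms. The action of $\mathsf{F}(\mathcal{G})$ on $X^{[r]}$ identifies $\mathsf{F}(\mathcal{G})$, hence $\mathsf{A}(\mathcal{G})$, with a subgroup of $\mathsf{F}(\mathcal{G}^{[r]})\subset\widetilde{\mathcal{G}^{[r]}}$. That $\widetilde\rho$ extends $\rho$ means that $\widetilde{\rho}(g)=\rho(g)$ (with $\rho(g)$ seen in $\mathsf{F}(\mathcal{H}|Z)$) for all $g\in\mathsf{A}(\mathcal{G})$. *)

(* Defs.v *)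
From HB Require Import structures.
From mathcomp Require Import all_boot all_order all_algebra.
From mathcomp Require Import all_classical all_reals all_analysis.

Set Implicit Arguments.
Unset Strict Implicit.
Unset Printing Implicit Defensive.

Local Open Scope classical_set_scope.

(* Partial maps of X are represented by their graphs, subsets of X * X.  Thus  *)
(* F.`1 is the domain and F.`2 the range of F, (F \; K)%relation is the        *)
(* composite "F after K" on its largest possible domain, (F^-1)%relation is    *)
(* the inverse, \bigcup_(F in FF) F is the union of a family FF, and set0 is   *)
(* the empty homeomorphism.                                                    *)
Definition partial_map (X : Type) := set (X * X).

Definition pid {X : Type} (U : set X) : partial_map X :=
  [set p | U p.1 /\ p.2 = p.1].

Definition pimage {X : Type} (F : partial_map X) (A : set X) : set X :=
  [set y | exists2 x, A x & F (x, y)].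

Definition partial_homeo {X : topologicalType} (F : partial_map X) : Prop :=
  exists (U V : set X) (f g : X -> X),
    [/\ open U /\ open V,
        set_fun U V f /\ set_fun V U g,
        (forall x, U x -> g (f x) = x) /\ (forall y, V y -> f (g y) = y),
        {within U, continuous f} /\ {within V, continuous g}
      & F = [set p | U p.1 /\ p.2 = f p.1]].

Definition compatible_family {X : Type} (FF : set (partial_map X)) : Prop :=
  forall F K, FF F -> FF K ->
    (forall x y y', F (x, y) -> K (x, y') -> y = y') /\
    (forall x x' y, F (x, y) -> K (x', y) -> x = x').

Definition pseudogroup {X : topologicalType} (P : set (partial_map X)) : Prop :=
  [/\ P `<=` partial_homeo,
      forall U, open U -> P (pid U),
      forall F K, P F -> P K -> P (F \; K)%relation,
      forall F, P F -> P (F^-1)%relation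
    & forall FF, FF `<=` P -> compatible_family FF -> P (\bigcup_(F in FF) F)].

(* A germ is literally an equivalence class of pairs (F, x).                   *)
Definition germ_type (X : Type) := set (partial_map X * X).

Definition germ {X : topologicalType} (F : partial_map X) (x : X) :
    germ_type X :=
  [set p | [/\ partial_homeo p.1, p.1.`1 p.2, p.2 = x
             & \forall y \near x, forall z, p.1 (y, z) <-> F (y, z)]].

Definition germs_of {X : topologicalType} (P : set (partial_map X)) :
    set (germ_type X) :=
  [set c | exists F x, [/\ P F, F.`1 x & c = germ F x]].

Definition groupoid_of_germs {X : topologicalType} (G : set (germ_type X)) :
    Prop :=
  exists2 P, pseudogroup P & G = germs_of P.

(* The pseudogroup determined by a groupoid of germs; see germs_ofK below.     *)
Definition pseudogroup_of {X : topologicalType} (G : set (germ_type X)) :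
    set (partial_map X) :=
  [set F | partial_homeo F /\ forall x, F.`1 x -> G (germ F x)].

Lemma partial_homeo_fun (X : topologicalType) (F : partial_map X) x y y' :
  partial_homeo F -> F (x, y) -> F (x, y') -> y = y'.
Proof. by move=> [U [V [f [g [_ _ _ _ ->]]]]] [_ /= ->] [_ /= ->]. Qed.

Lemma partial_homeo_inj (X : topologicalType) (F : partial_map X) x x' y :
  partial_homeo F -> F (x, y) -> F (x', y) -> x = x'.
Proof.
move=> [U [V [f [g [_ _ [fK _] _ ->]]]]] [/= Ux ->] [/= Ux' fxx'].
by rewrite -(fK _ Ux) fxx' fK.
Qed.

Lemma germs_ofK (X : topologicalType) (P : set (partial_map X)) :
  pseudogroup P -> pseudogroup_of (germs_of P) = P.
Proof.
move=> [Ph Pid Pcomp _ Pbig]; apply/seteqP; split => [F [hF gF]|F PF];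
  last first.
  by split => [|x Fx]; [exact: Ph|exists F, x].
have -> : F = \bigcup_(K in [set K | P K /\ K `<=` F]) K.
  apply/seteqP; split => [[x y] Fxy|p [K [_ KF] Kp]]; last exact: KF.
  have Fx : F.`1 x by exists y.
  have [K [x' [PK Kx' eFK]]] := gF x Fx.
  have : germ F x (F, x) by split => //=; near=> z.
  rewrite eFK => -[/= _ _ <-]; rewrite /prop_near1 nbhsE => -[W [oW Wx] WFK].
  exists (K \; pid W)%relation.
    split => [|[a b] [z /= [Wa /= ->]]]; first by apply: Pcomp => //; exact: Pid.
    by move=> /(WFK _ Wa).
  by exists x => //=; apply/(WFK _ Wx).
apply: Pbig => [K []//|K L [_ KF] [_ LF]]; split.
  by move=> x y y' /KF xy /LF xy'; exact: partial_homeo_fun xy xy'.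
by move=> x x' y /KF xy /LF x'y; exact: partial_homeo_inj xy x'y.
Unshelve. all: by end_near. Qed.

Definition germ_orbit {X : topologicalType} (G : set (germ_type X)) (x : X) :
    set X :=
  [set y | exists2 F, pseudogroup_of G F & F (x, y)].

Definition minimal_groupoid {X : topologicalType} (G : set (germ_type X)) :
    Prop :=
  forall x, dense (germ_orbit G x).

Definition homeomorphic (X Y : topologicalType) : Prop :=
  exists (f : X -> Y) (g : Y -> X),
    [/\ cancel f g, cancel g f, continuous f & continuous g].

Definition full_group {X : topologicalType} (G : set (germ_type X)) :
    set (partial_map X) :=
  [set F | [/\ pseudogroup_of G F, F.`1 = setT & F.`2 = setT]].

Definition three_cycle {X : topologicalType} (G : set (germ_type X))
    (g : partial_map X) : Prop :=
  [/\ full_group G g,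
      g <> pid setT,
      (g \; (g \; g))%relation = pid setT
    & exists U1 U2 U3 : set X,
      [/\ [/\ clopen U1, clopen U2 & clopen U3],
          [/\ U1 `&` U2 = set0, U2 `&` U3 = set0 & U1 `&` U3 = set0],
          [/\ pimage g U1 = U2, pimage g U2 = U3 & pimage g U3 = U1]
        & forall x, ~ (U1 `|` U2 `|` U3) x -> g (x, x)]].

Definition full_subgroup {X : topologicalType} (G : set (germ_type X))
    (S : set (partial_map X)) : Prop :=
  [/\ S `<=` full_group G,
      S (pid setT),
      forall g h, S g -> S h -> S (g \; h)%relation
    & forall g, S g -> S (g^-1)%relation].

Definition alternating_full_group {X : topologicalType}
    (G : set (germ_type X)) :
    set (partial_map X) :=
  smallest (full_subgroup G) (three_cycle G).

Definition group_support {X : topologicalType} (S : set (partial_map X)) :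
    set X :=
  closure [set x | exists F y, [/\ S F, F (x, y) & y <> x]].

Definition restrict_groupoid {X : topologicalType} (G : set (germ_type X))
    (Z : set X) : set (germ_type X) :=
  [set c | G c /\ exists F x y,
     [/\ partial_homeo F, F (x, y), c = germ F x, Z x & Z y]].

(* Morphisms between pseudogroups whose unit spaces are the open subsets U of  *)
(* X and V of Y, the open subsets of U being the open subsets of X contained   *)
(* in U; U = setT is a pseudogroup over X itself, and U = Z clopen is used for *)
(* a restriction to Z.  Only the values of phi on pseudogroup_of G matter.     *)
Definition continuous_morphism {X Y : topologicalType}
    (U : set X) (G : set (germ_type X)) (V : set Y) (H : set (germ_type Y))
    (phi : partial_map X -> partial_map Y) : Prop :=
  [/\ forall F, pseudogroup_of G F -> pseudogroup_of H (phi F),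
      forall F K, pseudogroup_of G F -> pseudogroup_of G K ->
        phi (F \; K)%relation = (phi F \; phi K)%relation,
      forall F, pseudogroup_of G F ->
        phi (F^-1)%relation = ((phi F)^-1)%relation,
      forall FF, FF `<=` pseudogroup_of G -> compatible_family FF ->
        phi (\bigcup_(F in FF) F) = \bigcup_(F in FF) phi F
    & phi (pid U) = pid V /\ phi set0 = set0].

Definition symmetric_power (X : topologicalType) (r : nat) : Type :=
  [set A : set X | A !=set0 /\ (A #<= `I_r)%card].

Section symmetric_power_topology.
Variables (X : topologicalType) (r : nat).
Local Notation symX := (symmetric_power X r).

HB.instance Definition _ := Choice.on symX.

(* O is open iff its preimage under the map t |-> range t from X^r is open.    *)
Definition symmetric_power_open (O : set symX) : Prop :=
  open [set t : {ptws 'I_r -> X} | exists2 A : symX, O A & \val A = range t].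

Let symmetric_power_openT : symmetric_power_open setT.
Proof.
rewrite /symmetric_power_open; have [r0|r_gt0] := posnP r.
  rewrite (_ : [set t | _] = set0); first exact: open0.
  rewrite -subset0 => t [A _ /= At].
  have /set_mem[[x]] := valP A; rewrite /= At => -[i _ _] _.
  by case: i => i; rewrite r0.
rewrite (_ : [set t | _] = setT); first exact: openT.
rewrite -subTset => t _ /=.
suff rt : range t \in [set A : set X | A !=set0 /\ (A #<= `I_r)%card].
  by exists (exist _ (range t) rt).
apply/mem_set; split; first by exists (t (Ordinal r_gt0)), (Ordinal r_gt0).
apply: card_le_trans (card_image_le _ _) _.
by have := @card_II r; rewrite card_eq_le => /andP[].
Qed.

Let symmetric_power_openI : setI_closed symmetric_power_open.
Proof.
move=> O O' oO oO'; rewrite /symmetric_power_open.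
rewrite (_ : [set t | _] =
  [set t : {ptws 'I_r -> X} | exists2 A : symX, O A & \val A = range t] `&`
  [set t | exists2 A : symX, O' A & \val A = range t]); first exact: openI.
apply/seteqP; split => [t [A [OA O'A] At]|t [[A OA At] [B O'B Bt]]].
  by split; exists A.
by exists A => //; split => //; rewrite (_ : A = B)//; apply/val_inj; rewrite At.
Qed.

Let symmetric_power_open_bigU (I : Type) (f : I -> set symX) :
  (forall i, symmetric_power_open (f i)) ->
  symmetric_power_open (\bigcup_i f i).
Proof.
move=> of_; rewrite /symmetric_power_open.
rewrite (_ : [set t | _] = \bigcup_i
  [set t : {ptws 'I_r -> X} | exists2 A : symX, f i A & \val A = range t]).
  by apply: bigcup_open => i _; exact: of_.
apply/seteqP; split => [t [A [i _ fA] At]|t [i _ [A fA At]]].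
  by exists i => //; exists A.
by exists A => //; exists i.
Qed.

HB.instance Definition _ := isOpenTopological.Build symX
  symmetric_power_openT symmetric_power_openI symmetric_power_open_bigU.

End symmetric_power_topology.

Definition symmetric_action {X : topologicalType} (r : nat)
    (F : partial_map X) :
    partial_map (symmetric_power X r) :=
  [set p | \val p.1 `<=` F.`1 /\ \val p.2 = pimage F (\val p.1)].

Arguments symmetric_action {X} r F.

Definition symmetric_groupoid {X : topologicalType} (r : nat)
    (G : set (germ_type X)) : set (germ_type (symmetric_power X r)) :=
  germs_of (symmetric_action r @` pseudogroup_of G).

Arguments symmetric_groupoid {X} r G.

(* Main.v *)
From HB Require Import structures.
Require Import Defs.
From mathcomp Require Import all_boot all_order all_algebra all_fingroup.
From mathcomp Require Import all_classical all_reals all_analysis.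

Set Implicit Arguments.
Unset Strict Implicit.
Unset Printing Implicit Defensive.

Local Open Scope classical_set_scope.

(** The proof rests on a description of the germ stabilizers
    K(y) = { g | rho(g) is the identity near y }, for y in Z, as subgroups of
    the alternating full group A.

    If no germ map is injective, every K(y) is non-trivial.  An element of K(y)
    also lies in K(y') for y' near y, so by compactness of Z finitely many
    non-trivial elements p suffice to meet all the K(y) (finite_witnesses).
    Since g K(y) g^-1 = K(rho(g) y), every conjugate of K(y) meets this finite
    set: K(y) is confined.  The core of the proof is confined_subgroups: for a
    confined subgroup K there is a finite set Q of X, of size bounded in terms
    of the p alone, such that K contains every element of A that is trivial
    near Q, and Q is determined by K.  This goes in four steps.

    - disjoint_confinement makes the confining elements disjointly supported.
      Over a small clopen set displaced by p lives a Heisenberg group modulo a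
      large prime, whose commutators are central.  Colour the elements c of
      the product of these groups by a p with c^-1 p c in K.  For some p there
      is a monochromatic rectangle in the grid of the a^i b^j of its Heisenberg
      group, and this puts a non-trivial power of the central element z in K,
      hence z itself, whatever the rectangle was.
    - absorbed_pair: as the confining elements now commute with each other's
      conjugators, a product argument (full_fiber) turns `for each conjugator
      some p' into `some p for all conjugators', and then a commutator
      computation (conj_fiber_absorbed) gives a clopen set C such that K
      contains the alternating group A(C) over C.  Moreover C may be required
      to contain both members of one among any m given disjoint pairs.
    - Two such sets C which intersect can be glued (alt_on_glue), and by the
      choice of pairs any two of them can be linked.  Hence at most 2m points
      lie in no such set, and K contains A(C) for all clopen C off these points.
    - An element of A which is trivial near a finite set Q is a product of
      3-cycles whose supports avoid Q (alt_off_of_agree).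

    The set Q(y) attached to K(y) is equivariant and varies continuously
    (exceptional_usc and exceptional_lsc): the points of Q(y) can be read off
    from which elements of A fix y' for y' near y.  It is non-empty on Z, which
    also shows that Z is open.  So Q is a continuous equivariant map from Z to
    a symmetric power of X, and rho extends by letting F act near y as rho(g),
    for any g in A with the same germ as F at Q(y): such g exist because A
    realizes all germs at finite sets (realize), and the result depends only on
    F because K(y) contains the elements trivial near Q(y).

    Conversely, for any extension psi, the sets psi(id_W), for W open in the
    symmetric power, say where a point y of Z is located, and comparing
    stabilizers shows that this is Q(y) (localized_point_eq).  This gives
    uniqueness; and since a non-trivial element of A can be trivial near any
    finite set, it also shows that no K(y) is trivial, so that the two cases
    exclude each other. *)

(** * Groups of bijections *)

(** Elements of a full group are handled as total bijections bundled with their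
    inverse, so that they form a group and identities between them can be
    proved by group theory; [graph] below converts them to partial maps.  The
    product (g * h) is g after h. *)
Record selfbij (X : Type) := Selfbij {
  fwd :> X -> X;
  bwd : X -> X;
  fwdK : cancel fwd bwd;
  bwdK : cancel bwd fwd }.

Lemma selfbijP (X : Type) (g h : selfbij X) : (forall x, g x = h x) -> g = h.
Proof.
move=> gh; case: g h gh => [f1 b1 fK1 bK1] [f2 b2 fK2 bK2] /= /funext gh.
subst f2.
have eb : b1 = b2.
  by apply/funext => x; rewrite -[in RHS](bK1 x) fK2.
subst b2.
by congr Selfbij; exact: Prop_irrelevance.
Qed.

HB.instance Definition _ (X : Type) := gen_eqMixin (selfbij X).
HB.instance Definition _ (X : Type) := gen_choiceMixin (selfbij X).

Section selfbij_group.
Variable X : Type.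

Definition selfbij1 : selfbij X := @Selfbij X id id (fun=> erefl) (fun=> erefl).

Definition selfbijM (g h : selfbij X) : selfbij X :=
  @Selfbij X (g \o h) (bwd h \o bwd g)
    (can_comp (@fwdK _ g) (@fwdK _ h)) (can_comp (@bwdK _ h) (@bwdK _ g)).

Definition selfbijV (g : selfbij X) : selfbij X :=
  @Selfbij X (bwd g) g (@bwdK _ g) (@fwdK _ g).

Let mulA : associative selfbijM. Proof. by move=> g h k; exact: selfbijP. Qed.
Let mul1g : left_id selfbij1 selfbijM. Proof. by move=> g; exact: selfbijP. Qed.
Let mulg1 : right_id selfbij1 selfbijM. Proof. by move=> g; exact: selfbijP. Qed.
Let mulVg : left_inverse selfbij1 selfbijV selfbijM.
Proof. by move=> g; apply: selfbijP => x /=; rewrite fwdK. Qed.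
Let mulgV : right_inverse selfbij1 selfbijV selfbijM.
Proof. by move=> g; apply: selfbijP => x /=; rewrite bwdK. Qed.

HB.instance Definition _ :=
  isGroup.Build (selfbij X) mulA mul1g mulg1 mulVg mulgV.

End selfbij_group.

Lemma selfbijME (X : Type) (g h : selfbij X) x : (g * h)%g x = g (h x).
Proof. by []. Qed.

Lemma selfbijK (X : Type) (g : selfbij X) x : g^-1%g (g x) = x.
Proof. exact: fwdK. Qed.

Lemma selfbijVK (X : Type) (g : selfbij X) x : g (g^-1%g x) = x.
Proof. exact: bwdK. Qed.

Lemma selfbij_inj (X : Type) (g : selfbij X) : injective g.
Proof. exact: can_inj (@fwdK _ g). Qed.

(** * Compactness and clopen sets *)

(** If p failed for A, the sets B for which A minus B satisfies p would form a
    proper filter on A without cluster point. *)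
Lemma compact_ind (T : topologicalType) (A : set T) (p : set T -> Prop) :
  compact A -> p set0 -> (forall B C, p B -> p C -> p (B `|` C)) ->
  (forall B C, B `<=` C -> p C -> p B) ->
  (forall x, A x -> exists2 N, nbhs x N & p N) -> p A.
Proof.
move=> cA p0 pU pS pA; apply: contrapT => npA.
pose F : set_system T := [set B | p (A `\` B)].
have FF : ProperFilter F.
  apply: Build_ProperFilter_ex.
    move=> B FB; apply/set0P/negP => /eqP B0.
    by apply: npA; move: FB; rewrite /F /= B0 setD0.
  split.
  - by rewrite /F /= setDT.
  - by move=> B C; rewrite /F /= setDIr; exact: pU.
  - by move=> B C BC; apply: pS => x [Ax Cx]; split => // /BC.
have FA : F A by rewrite /F /= setDv.
have [x [Ax clx]] := cA F FF FA.
have [N Nx pN] := pA x Ax.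
have FN : F (~` N) by apply: pS pN => y [_ /contrapT].
by have [y [/= nNy Ny]] := clx _ _ FN Nx.
Qed.

Lemma clopen_setD (T : topologicalType) (A B : set T) :
  clopen A -> clopen B -> clopen (A `\` B).
Proof. by move=> cA cB; rewrite setDE; apply: clopenI => //; exact: clopenC. Qed.

Lemma open_nbhs_in (T : topologicalType) (A : set T) x : open A -> A x -> nbhs x A.
Proof. by move=> oA Ax; exact: open_nbhs_nbhs. Qed.

Lemma moved_points_open (T : topologicalType) (g : T -> T) :
  hausdorff_space T -> continuous g -> open [set x | g x <> x].
Proof.
move=> hT cg; rewrite openE => y /= /eqP gy.
move: hT; rewrite open_hausdorff => /(_ _ _ gy)[[A B] /= [yA yB] [oA oB AB]].
rewrite !inE in yA yB.
apply: filterS2 (open_nbhs_in oB yB) (cg y _ (open_nbhs_in oA yA)) => w Bw /= Aw gw.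
have : (A `&` B) w by split => //; rewrite -gw.
by rewrite (eqP AB).
Qed.

Section cantor_like_space.
Variable X : topologicalType.
Hypothesis XC : cantor_like X.

Let Xcompact : compact [set: X]. Proof. by case: XC. Qed.

Lemma clopen_basis (x : X) (A : set X) : nbhs x A ->
  exists C, [/\ clopen C, C x & C `<=` A].
Proof.
case: XC => _ c h z /(zero_dimensional_cvg h z c)[C [Cx cC] CA].
by exists C.
Qed.

Lemma compact_clopen (A : set X) : clopen A -> compact A.
Proof. by move=> [_ cA]; apply: subclosed_compact Xcompact _. Qed.

Lemma finite_closed (A : set X) : finite_set A -> closed A.
Proof.
move: A; apply/accessible_finite_set_closed.
by case: XC => _ _ hX _; exact: hausdorff_accessible.
Qed.

Lemma open_setD_finite (A B : set X) : open A -> finite_set B -> open (A `\` B).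
Proof.
move=> oA fB; rewrite setDE; apply: openI => //.
by apply: closed_openC; exact: finite_closed.
Qed.

Lemma open_infinite (A : set X) : open A -> A !=set0 -> infinite_set A.
Proof.
move=> oA [x Ax] fA; case: XC => /perfectTP pX _ _ _; apply: (pX x).
rewrite (_ : [set x] = A `\` (A `\ x)).
  by apply: open_setD_finite => //; exact: finite_setD.
apply/seteqP; split => [y -> /=|y [Ay /= h]].
  by split => //; case.
by apply: contrapT => yx; apply: h; split.
Qed.

Lemma open_setD_finite_neq0 (A B : set X) : open A -> A !=set0 -> finite_set B ->
  A `\` B !=set0.
Proof.
move=> oA A0 fB; apply/set0P/negP => /eqP AB.
apply: (open_infinite oA A0); apply: sub_finite_set fB.
by rewrite -setD_eq0.
Qed.

Lemma finite_separation (I : eqType) (s : seq I) (x : I -> X) : uniq s ->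
  {in s &, injective x} ->
  exists N : I -> set X, {in s, forall i, nbhs (x i) (N i)} /\
    {in s &, forall i j, i != j -> N i `&` N j = set0}.
Proof.
elim: s => [_ _|i l IH /= /andP[il ul] xi]; first by exists (fun=> setT).
have l_in j : j \in l -> j \in i :: l by rewrite inE orbC => ->.
have ii : i \in i :: l by rewrite inE eqxx.
have [|N [Nx dN]] := IH ul; first by move=> j k jl kl; apply: xi; exact: l_in.
have : nbhs (x i) (setT `\` [set` map x l]).
  apply: open_nbhs_in; first by apply: (open_setD_finite openT); exact: finite_seq.
  split => //= /mapP[j jl /xi]; rewrite ii l_in // => /(_ isT isT) ij.
  by rewrite ij jl in il.
move=> /(@clopen_basis _ _)[C [cC Cx Cl]].
exists (fun j => if j == i then C else N j `\` C); split.
  move=> j; rewrite inE => /predU1P[->|jl].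
    by rewrite eqxx; apply: open_nbhs_in => //; case: cC.
  have /negbTE -> : j != i by apply: contraTneq jl => ->.
  apply: filterI; first exact: Nx.
  apply: open_nbhs_in; first by case: (clopenC set0 cC).
  by move=> /Cl[_]; apply; rewrite /= map_f.
move=> j k; rewrite !inE; have [->|ji] := eqVneq j i; have [->|ki] := eqVneq k i => //=.
- by rewrite setDE setIC -setIA (setIC _ C) setICr setI0.
- by rewrite setDE -setIA (setIC _ C) setICr setI0.
- move=> jl kl jk; apply/seteqP; split => // y [[Nj _] [Nk _]].
  by rewrite -(dN j k jl kl jk).
Qed.

(** A finite cover of U by clopen sets can be refined to a finite partition,
    which is why additivity on disjoint unions is enough. *)
Lemma clopen_ind (U : set X) (p : set X -> Prop) : clopen U -> p set0 ->
  (forall B C, clopen B -> clopen C -> B `<=` U -> C `<=` U ->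
     B `&` C = set0 -> p B -> p C -> p (B `|` C)) ->
  (forall x, U x -> exists N, [/\ nbhs x N &
     forall C, clopen C -> C `<=` U -> C `<=` N -> p C]) -> p U.
Proof.
move=> cU p0 pU ploc.
pose q (B : set X) := exists C, [/\ clopen C, B `<=` C &
  forall D, clopen D -> D `<=` U -> D `<=` C -> p D].
suff [C [cC UC]] : q U by apply.
apply: (@compact_ind _ _ q (compact_clopen cU)).
- exists set0; split => //; first exact: clopen0.
  by move=> D _ _; rewrite subset0 => ->.
- move=> A B [C [cC AC pC]] [C' [cC' BC' pC']].
  exists (C `|` C'); split; [exact: clopenU|exact: setUSS|].
  move=> D cD DU DC.
  rewrite -(setUIDK D C); apply: pU.
  + exact: clopenI.
  + exact: clopen_setD.
  + by move=> x [/DU].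
  + by move=> x [/DU].
  + by rewrite setDE setIACA setICr setI0.
  + by apply: pC => [|x [/DU]|x []//]; first exact: clopenI.
  + apply: pC' => [|x [/DU]//|x [/DC[]//]]; exact: clopen_setD.
- by move=> B C BC [D [cD CD pD]]; exists D; split => //; exact: subset_trans CD.
- move=> x Ux; have [N [Nx pN]] := ploc x Ux.
  have [C [cC Cx CN]] := clopen_basis Nx.
  exists C; first by apply: open_nbhs_in Cx; case: cC.
  by exists C; split => // D cD DU DC; apply: pN => //; exact: subset_trans CN.
Qed.

End cantor_like_space.

(** * Charts of a pseudogroup and its full group *)

Definition graph (X : Type) (g : selfbij X) : partial_map X :=
  [set p | p.2 = g p.1].

Lemma graph_inj (X : Type) : injective (@graph X).
Proof.
move=> g h gh; apply: selfbijP => x.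
have : graph g (x, g x) by [].
by rewrite gh.
Qed.

Lemma graphM (X : Type) (g h : selfbij X) :
  graph (g * h)%g = (graph g \; graph h)%relation.
Proof.
apply/seteqP; split => -[x y] /=; first by exists (h x).
by rewrite /graph /= => -[z ->].
Qed.

Lemma graph1 (X : Type) : graph (1%g : selfbij X) = pid setT.
Proof. by apply/seteqP; rewrite /graph /pid; split => -[x y] /= => [->|[_ ->]]. Qed.

Lemma graphV (X : Type) (g : selfbij X) : graph g^-1%g = ((graph g)^-1)%relation.
Proof.
apply/seteqP; split => -[x y]; rewrite /graph /= => ->.
  by rewrite [RHS]bwdK.
by rewrite [RHS]fwdK.
Qed.

(** A partial homeomorphism as a pair of a domain and a total function, of which
    only the values on the domain matter. *)
Definition chart (X : topologicalType) (P : set (partial_map X)) (W : set X)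
  (f : X -> X) : Prop := P [set p | W p.1 /\ p.2 = f p.1].

(** Minimality, in terms of the pseudogroup. *)
Definition dense_orbits (X : topologicalType) (P : set (partial_map X)) : Prop :=
  forall x (V : set X), open V -> V !=set0 ->
    exists y F, [/\ V y, P F & F (x, y)].

Section charts.
Variables (X : topologicalType) (P : set (partial_map X)).
Hypothesis PP : pseudogroup P.

Lemma pseudo_id U : open U -> P (pid U).
Proof. by case: PP => _ + _ _ _; apply. Qed.

Lemma pseudo_comp F K : P F -> P K -> P (F \; K)%relation.
Proof. by case: PP => _ _ + _ _; apply. Qed.

Lemma pseudo_inv F : P F -> P (F^-1)%relation.
Proof. by case: PP => _ _ _ + _; apply. Qed.

Lemma pseudo_homeo F : P F -> partial_homeo F.
Proof. by case: PP => + _ _ _ _; apply. Qed.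

Lemma pseudo_fun F x y y' : P F -> F (x, y) -> F (x, y') -> y = y'.
Proof. by move=> /pseudo_homeo; exact: partial_homeo_fun. Qed.

Lemma pseudo_inj F x x' y : P F -> F (x, y) -> F (x', y) -> x = x'.
Proof. by move=> /pseudo_homeo; exact: partial_homeo_inj. Qed.

Lemma chartP F : P F -> exists W f, [/\ chart P W f, open W &
  F = [set p | W p.1 /\ p.2 = f p.1]].
Proof.
move=> PF; have [U [V [f [g [[oU _] _ _ _ FE]]]]] := pseudo_homeo PF.
by exists U, f; split => //; rewrite /chart -FE.
Qed.

Lemma chart_inj W f x y : chart P W f -> W x -> W y -> f x = f y -> x = y.
Proof. by move=> cW Wx Wy fxy; apply: (pseudo_inj (y := f x) cW). Qed.

Lemma chart_homeo W f : chart P W f ->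
  [/\ open W, open (f @` W) & forall x, W x -> {for x, continuous f}].
Proof.
move=> cW; have [U [V [f' [g [[oU oV] [fUV gVU] [fK gK] [cf _] FE]]]]] := pseudo_homeo cW.
have WE x : W x <-> U x.
  split => [Wx|Ux].
    by have : [set p | W p.1 /\ p.2 = f p.1] (x, f x) by []; rewrite FE => -[].
  by have : [set p | U p.1 /\ p.2 = f' p.1] (x, f' x) by []; rewrite -FE => -[].
have {WE} WU : W = U by apply/seteqP; split => x /WE.
have ff' x : W x -> f x = f' x.
  move=> Wx; have : [set p | W p.1 /\ p.2 = f p.1] (x, f x) by [].
  by rewrite FE => -[].
have VE : f @` W = V.
  apply/seteqP; split => [_ [x Wx <-]|y Vy].
    by rewrite ff' //; apply: fUV; rewrite -WU.
  exists (g y); first by rewrite WU; exact: gVU.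
  by rewrite ff' ?gK // WU; exact: gVU.
split; [by rewrite WU|by rewrite VE|].
move=> x Wx; have : {for x, continuous f'}.
  by move: cf; rewrite (continuous_open_subspace _ oU); apply; rewrite inE -WU.
move=> cfx N; rewrite ff' // => /cfx fN.
have Wn : nbhs x W by apply: open_nbhs_in => //; rewrite WU.
apply: (filterS2 _ _ Wn fN). by move=> z Wz; rewrite /= ff'.
Qed.

Lemma chart_open W f : chart P W f -> open W.
Proof. by move=> /chart_homeo[]. Qed.

Lemma chart_cont W f x : chart P W f -> W x -> {for x, continuous f}.
Proof. by move=> /chart_homeo[_ _]; apply. Qed.

Lemma chart_res W W' f : chart P W f -> open W' -> W' `<=` W -> chart P W' f.
Proof.
move=> cW oW' W'W; rewrite /chart.
rewrite (_ : [set p | _] = ([set p | W p.1 /\ p.2 = f p.1] \; pid W')%relation).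
  by apply: pseudo_comp => //; exact: pseudo_id.
apply/seteqP; split => -[x y] /=.
  by move=> [W'x ->]; exists x => //; split => //; exact: W'W.
by move=> [z [/= W'x ->] [Wx ->]].
Qed.

Lemma chart_image_open W f : chart P W f -> open (f @` W).
Proof. by move=> /chart_homeo[]. Qed.

Lemma chart_id W : open W -> chart P W id.
Proof. exact: pseudo_id. Qed.

Lemma chart_clopen_image W f : hausdorff_space X -> compact [set: X] ->
  chart P W f -> clopen W -> clopen (f @` W).
Proof.
move=> hX cX cW [_ clW]; split; first exact: chart_image_open cW.
apply: compact_closed => //.
apply: continuous_compact; last exact: subclosed_compact cX _.
apply: continuous_in_subspaceT => x /set_mem Wx; exact: chart_cont cW Wx.
Qed.

Definition fullperm : set (selfbij X) := [set g | P (graph g)].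

Lemma fullperm_chart g : fullperm g <-> chart P setT g.
Proof.
rewrite /fullperm /chart /= (_ : graph g = [set p | setT p.1 /\ p.2 = g p.1])//.
by apply/seteqP; split => p //= [].
Qed.

Lemma fullperm1 : fullperm 1%g.
Proof. by rewrite /fullperm /= graph1; apply: pseudo_id; exact: openT. Qed.

Lemma fullpermM g h : fullperm g -> fullperm h -> fullperm (g * h)%g.
Proof. by rewrite /fullperm /= graphM; exact: pseudo_comp. Qed.

Lemma fullpermV g : fullperm g -> fullperm g^-1%g.
Proof. by rewrite /fullperm /= graphV; exact: pseudo_inv. Qed.

Lemma fullperm_cont g : fullperm g -> continuous g.
Proof. by move=> /fullperm_chart cg x; exact: chart_cont cg _. Qed.

Lemma fullperm_local g :
  (forall x, exists2 F, P F & F `<=` graph g /\ F.`1 x) -> fullperm g.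
Proof.
move=> gloc; rewrite /fullperm /=.
rewrite (_ : graph g = \bigcup_(F in [set K | P K /\ K `<=` graph g]) F).
  case: PP => _ _ _ _; apply; first by move=> K [].
  move=> F K [_ Fg] [_ Kg]; split.
    by move=> x y y' /Fg + /Kg; rewrite /graph /= => -> ->.
  move=> x x' y /Fg + /Kg; rewrite /graph /= => ->.
  exact: (can_inj (@fwdK _ g)).
apply/seteqP; split => [[x y]|p [K [_ Kg]]]; last exact: Kg.
rewrite /graph /= => ->.
have [F PF [Fg [z Fxz]]] := gloc x.
exists F => //=; by rewrite -(Fg _ Fxz).
Qed.

Lemma fullperm_chart_local (g : selfbij X) :
  (forall x, exists W f, [/\ chart P W f, W x & forall z, W z -> g z = f z]) ->
  fullperm g.
Proof.
move=> gloc; apply: fullperm_local => x; have [W [f [cW Wx gf]]] := gloc x.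
exists [set p | W p.1 /\ p.2 = f p.1] => //; split.
  by move=> [z w] /= [Wz ->]; rewrite /graph /= gf.
by exists (f x).
Qed.

End charts.

(** * Three-cycles and the alternating groups over clopen sets *)

(** Inserting (b c) twice splits the product of two transpositions (a b) and
    (c d) into two products of transpositions sharing a point. *)
Lemma even_perm_ind (D : finType) (Q : {perm D} -> Prop) :
  Q 1%g -> (forall s t, Q s -> Q t -> Q (s * t)%g) ->
  (forall x y z, x != y -> y != z -> x != z -> Q (tperm x y * tperm y z)%g) ->
  forall s : {perm D}, ~~ s -> Q s.
Proof.
move=> Q1 QM Q3 s; have [ts -> dts] := prod_tpermP s.
rewrite odd_perm_prod //.
have Q2 x y z : x != y -> y != z -> Q (tperm x y * tperm y z)%g.
  move=> xy yz; have [xz|] := eqVneq x z; last exact: Q3.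
  by rewrite -xz (tpermC y x) tperm2.
move: dts; have [n sn] := ubnP (size ts).
elim: n ts sn => [//|n IH] [|[a b] [|[c d] ts]] //=; first by rewrite big_nil.
rewrite !ltnS negbK => sn /and3P[/= ab cd dts] ev.
rewrite !big_cons /= mulgA; apply: (QM); last by apply: IH => //; exact: ltnW.
have [bc|bc] := eqVneq b c; first by rewrite -bc /= in cd *; exact: Q2.
rewrite (_ : _ * _ = (tperm a b * tperm b c) * (tperm b c * tperm c d))%g.
by apply: QM; exact: Q2.
by rewrite mulgA -(mulgA (tperm a b)) tperm2 mulg1.
Qed.

Section cycles.
Variables (X : topologicalType) (P : set (partial_map X)).

(** The support of a 3-cycle s with first piece U.  The other pieces s(U) and
    s(s(U)) are written as preimages, which are clopen by continuity alone. *)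
Definition orb3 (U : set X) (s : X -> X) : set X :=
  [set x | [\/ U x, U (s x) | U (s (s x))]].

Definition cyc3 (U : set X) (s : selfbij X) : Prop :=
  [/\ fullperm P s, clopen U, (forall x, U x -> ~ U (s x) /\ ~ U (s (s x))),
      (forall x, s (s (s x)) = x)
    & forall x, ~ orb3 U s x -> s x = x].

(** The alternating full group of the restriction to C; for C = setT, the
    alternating full group itself.  The identity counts as a 3-cycle with empty
    pieces, which is harmless in a generating set and spares case
    distinctions. *)
Inductive alt_on (C : set X) : selfbij X -> Prop :=
| alt_on_one : alt_on C 1%g
| alt_on_mul g h : alt_on C g -> alt_on C h -> alt_on C (g * h)%g
| alt_on_cyc U s : cyc3 U s -> orb3 U s `<=` C -> alt_on C s.

(** The 3-cycle obtained from s by shrinking its first piece to W. *)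
Definition piece_of (s : X -> X) (W : set X) (s' : X -> X) : Prop :=
  forall x, (orb3 W s x -> s' x = s x) /\ (~ orb3 W s x -> s' x = x).

Hypothesis XC : cantor_like X.
Hypothesis PP : pseudogroup P.

Lemma fullperm_clopen g U : fullperm P g -> clopen U -> clopen (g @^-1` U).
Proof. by move=> gF cU; apply: preimage_clopen => //; exact: fullperm_cont gF. Qed.

Lemma orb3_clopen U s : fullperm P s -> clopen U -> clopen (orb3 U s).
Proof.
move=> sF cU; have c1 := fullperm_clopen sF cU; have c2 := fullperm_clopen sF c1.
rewrite (_ : orb3 U s = U `|` (s @^-1` U `|` s @^-1` (s @^-1` U))).
  by apply: clopenU => //; exact: clopenU.
apply/seteqP; split => x; first by case; [left|right; left|right; right].
by move=> [|[]]; [constructor 1|constructor 2|constructor 3].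
Qed.

Lemma cyc3_orb_clopen U s : cyc3 U s -> clopen (orb3 U s).
Proof. by case=> sF cU _ _ _; exact: orb3_clopen. Qed.

Lemma cyc3_inv U s : cyc3 U s -> s^-1%g = (s * s)%g.
Proof.
move=> [_ _ _ s3 _]; apply/eqP; rewrite eq_sym -mulg_eq1; apply/eqP.
by apply: selfbijP => x /=; exact: s3.
Qed.

Lemma alt_on_inv C g : alt_on C g -> alt_on C g^-1%g.
Proof.
elim=> [|g' h _ Hg _ Hh|U s cs sC].
- by rewrite invg1; exact: alt_on_one.
- by rewrite invgM; exact: alt_on_mul.
- by rewrite (cyc3_inv cs); apply: alt_on_mul; exact: alt_on_cyc cs sC.
Qed.

Lemma alt_on_mono C C' g : C `<=` C' -> alt_on C g -> alt_on C' g.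
Proof.
move=> CC'; elim=> [|g' h _ Hg _ Hh|U s cs sC].
- exact: alt_on_one.
- exact: alt_on_mul.
- by apply: alt_on_cyc cs _; exact: subset_trans CC'.
Qed.

Lemma alt_on_supp C g x : alt_on C g -> ~ C x -> g x = x.
Proof.
move=> gg Cx; elim: gg => [//|g' h _ Hg _ Hh|U s [_ _ _ _ cs] sC].
  by rewrite /= Hh Hg.
by apply: cs => /sC.
Qed.

Lemma alt_on_fullperm C g : alt_on C g -> fullperm P g.
Proof.
elim=> [|g' h _ Hg _ Hh|U s [cs _ _ _ _] _] //; [exact: fullperm1|exact: fullpermM].
Qed.

Lemma cyc3_conj U s h : fullperm P h -> cyc3 U s ->
  cyc3 (h^-1%g @^-1` U) (h * s * h^-1)%g /\
  orb3 (h^-1%g @^-1` U) (h * s * h^-1)%g = h^-1%g @^-1` orb3 U s.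
Proof.
move=> hF [sF cU dU s3 s1].
have E : orb3 (h^-1%g @^-1` U) (h * s * h^-1)%g = h^-1%g @^-1` orb3 U s.
  by apply/seteqP; rewrite /orb3 /= /selfbijM /=; split => x /=; rewrite !fwdK.
split => //; split.
- by apply: fullpermM => //; [exact: fullpermM|exact: fullpermV].
- by apply: fullperm_clopen => //; exact: fullpermV.
- by move=> x /=; rewrite !fwdK; exact: dU.
- by move=> x /=; rewrite !fwdK s3 bwdK.
- by move=> x; rewrite E /= => /s1 ->; rewrite bwdK.
Qed.

Lemma alt_on_conj C g h : fullperm P h -> alt_on C g ->
  alt_on (h^-1%g @^-1` C) (h * g * h^-1)%g.
Proof.
move=> hF; elim=> [|g' g'' _ Hg _ Hh|U s cs sC].
- by rewrite mulg1 mulgV; exact: alt_on_one.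
- rewrite (_ : (_ * _)%g = (h * g' * h^-1) * (h * g'' * h^-1))%g; last first.
    by rewrite !mulgA mulgVK.
  exact: alt_on_mul.
- have [cs' E] := cyc3_conj hF cs.
  by apply: alt_on_cyc cs' _; rewrite E => x /= /sC.
Qed.

Lemma orb3_stable U W s x : cyc3 U s -> orb3 W s (s x) <-> orb3 W s x.
Proof.
move=> [_ _ _ s3 _]; rewrite /orb3 /= s3.
by split=> -[]; try (by constructor); move=> ?; constructor 3 || constructor 1.
Qed.

Lemma cyc3_piece U W s : cyc3 U s -> clopen W -> W `<=` U ->
  exists s' : selfbij X, [/\ cyc3 W s', piece_of s W s' & orb3 W s' = orb3 W s].
Proof.
move=> cs cW WU; have [sF cU dU s3 s1] := cs.
have st x := orb3_stable W x cs.
pose f x := if `[< orb3 W s x >] then s x else x.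
pose b x := if `[< orb3 W s x >] then s (s x) else x.
have fb : cancel f b.
  move=> x; rewrite /f /b; have [Wx|Wx] := boolP `[< orb3 W s x >]; last by rewrite (negbTE Wx).
  have -> : `[< orb3 W s (s x) >] by apply/asboolP/st/asboolP.
  exact: s3.
have bf : cancel b f.
  move=> x; rewrite /f /b; have [Wx|Wx] := boolP `[< orb3 W s x >]; last by rewrite (negbTE Wx).
  have -> : `[< orb3 W s (s (s x)) >] by apply/asboolP/st/st/asboolP.
  exact: s3.
have pc : piece_of s W f.
  by move=> x; rewrite /f; split => Wx; [rewrite asboolT|rewrite asboolF].
have oE : orb3 W f = orb3 W s.
  apply/seteqP; split => x.
    apply: contraPP => nWx; have [_ /(_ nWx) fx] := pc x.
    by rewrite /orb3 /= !fx => -[] Wx; apply: nWx; constructor 1.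
  move=> Wx; have [/(_ Wx) fx _] := pc x.
  have [/(_ (iffRL (st x) Wx)) fsx _] := pc (s x).
  by move: Wx; rewrite /orb3 /= fx fsx.
exists (Selfbij fb bf); split => //; split => //.
- have cO : clopen (orb3 W s) by exact: orb3_clopen.
  apply: fullperm_chart_local => // x.
  have [Wx|Wx] := pselect (orb3 W s x).
    exists (orb3 W s), s; split => //; last by move=> z Wz; case: (pc z) => + _; apply.
    apply: chart_res (iffLR (fullperm_chart _ _) sF) _ _ => //; by case: cO.
  exists (~` orb3 W s), id; split => //; last by move=> z Wz; case: (pc z) => _; apply.
  by apply: chart_id => //; case: (clopenC set0 cO).
- move=> x Wx /=; have Ox : orb3 W s x by constructor 1.
  have [/(_ Ox) -> _] := pc x.
  have [/(_ (iffRL (st x) Ox)) -> _] := pc (s x).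
  by have [? ?] := dU _ (WU _ Wx); split => /WU.
- move=> x /=; have [Wx|Wx] := pselect (orb3 W s x).
    have [/(_ Wx) -> _] := pc x.
    have [/(_ (iffRL (st x) Wx)) -> _] := pc (s x).
    by have [/(_ (iffRL (st _) (iffRL (st x) Wx))) -> _] := pc (s (s x)).
  by have [_ /(_ Wx) e] := pc x; rewrite !e.
- by move=> x; rewrite oE => Wx; have [_] := pc x; exact.
Qed.

Lemma piece_of_uniq s W (s1 s2 : selfbij X) :
  piece_of s W s1 -> piece_of s W s2 -> s1 = s2.
Proof.
move=> p1 p2; apply: selfbijP => x; have [a1 b1] := p1 x; have [a2 b2] := p2 x.
by have [Wx|Wx] := pselect (orb3 W s x); [rewrite a1 // a2|rewrite b1 // b2].
Qed.

(** A 3-cycle is the product of the 3-cycles obtained by cutting its first piece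
    into finitely many clopen parts; hence it belongs to a subgroup as soon as
    all its sufficiently small pieces do. *)
Lemma cyc3_ind (K : set (selfbij X)) U s : cyc3 U s -> K 1%g ->
  (forall g h, K g -> K h -> K (g * h)%g) ->
  (forall x, U x -> exists2 N, nbhs x N & forall W s', clopen W ->
     W `<=` U -> W `<=` N -> cyc3 W s' -> piece_of s W s' ->
     orb3 W s' = orb3 W s -> K s') -> K s.
Proof.
move=> cs K1 KM Kloc; have [sF cU dU s3 s1] := cs.
have st W x := orb3_stable W x cs.
pose p W := forall s' : selfbij X, piece_of s W s' -> K s'.
suff : p U.
  apply=> x; split => // Ux; exact: s1.
apply: (clopen_ind XC) => //.
- move=> s' ps'; rewrite (_ : s' = 1%g) //; apply: selfbijP => x.
  by have [_ ->] := ps' x => // -[].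
- move=> B C cB cC BU CU BC0 pB pC s' ps'.
  have [sB [cycB psB _]] := cyc3_piece cs cB BU.
  have [sC [cycC psC _]] := cyc3_piece cs cC CU.
  have BCn x : orb3 B s x -> orb3 C s x -> False.
    have BCx y : B y -> C y -> False.
      by move=> By Cy; have : (B `&` C) y by []; rewrite BC0.
    have d1 y : B y -> ~ C (s y) by move=> /BU /dU[h _] /CU.
    have d2 y : B y -> ~ C (s (s y)) by move=> /BU /dU[_ h] /CU.
    have d3 y : C y -> ~ B (s y) by move=> /CU /dU[h _] /BU.
    have d4 y : C y -> ~ B (s (s y)) by move=> /CU /dU[_ h] /BU.
    case=> By [] Cy; first [exact: BCx By Cy|exact: d1 By Cy|exact: d2 By Cy
      |exact: d3 Cy By|exact: d4 Cy By].
  rewrite (_ : s' = sB * sC)%g; first by apply: KM; [exact: pB|exact: pC].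
  apply: selfbijP => x /=.
  have [aU bU] := ps' x; have [aC bC] := psC x.
  have UE : orb3 (B `|` C) s x <-> orb3 B s x \/ orb3 C s x.
    rewrite /orb3 /=; split.
      by case=> -[] h; by [left; constructor|right; constructor|left;
        constructor 2|right; constructor 2|left; constructor 3|right; constructor 3].
    case=> -[] h; by [constructor 1; left|constructor 2; left|
      constructor 3; left|constructor 1; right|constructor 2; right|
      constructor 3; right].
  have [Cx|Cx] := pselect (orb3 C s x).
    rewrite aC // aU; last by apply/UE; right.
    have [_ ->] := psB (s x) => // /st Bx; exact: BCn Bx Cx.
  rewrite bC //; have [aB bB] := psB x.
  have [Bx|Bx] := pselect (orb3 B s x).
    by rewrite aB // aU //; apply/UE; left.
  by rewrite bB // bU // => /UE[].
- move=> x Ux; have [N Nx KN] := Kloc x Ux; exists N; split => // C cC CU CN s' ps'.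
  have [sC [cycC psC oC]] := cyc3_piece cs cC CU.
  by rewrite (piece_of_uniq ps' psC); exact: KN psC oC.
Qed.

End cycles.

(** * Multisections and permutations of their pieces *)

Lemma filter_forall_bigcap (T : Type) (I : finType) (F : set_system T)
  (f : I -> set T) : Filter F -> (forall i, F (f i)) ->
  F (\bigcap_(i in [set: I]) f i).
Proof.
by move=> FF Ff; apply: (filterS _ (filter_forall FF Ff)) => x h i _; exact: h.
Qed.

Section multisections.
Variables (X : topologicalType) (P : set (partial_map X)).

(** Disjoint copies f d (W) of a clopen set W, identified with each other by
    the pseudogroup: a finite symmetric group acts by permuting the copies. *)
Definition multisection (D : finType) (W : set X) (f : D -> X -> X) : Prop :=
  [/\ clopen W, forall d, chart P W (f d)
    & forall d e w w', W w -> W w' -> f d w = f e w' -> d = e].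

Hypothesis XC : cantor_like X.
Hypothesis PP : pseudogroup P.

Section action.
Variables (D : finType) (W : set X) (f : D -> X -> X).
Hypothesis Wf : multisection W f.

Lemma multisection_inj d e w w' : W w -> W w' -> f d w = f e w' ->
  d = e /\ w = w'.
Proof.
have [_ cf df] := Wf => Ww Ww' E; have de := df _ _ _ _ Ww Ww' E.
by split => //; rewrite -de in E; exact: chart_inj (cf d) _ _ E.
Qed.

(** The point f d (w) goes to f (s d) (w), and the points outside the pieces are
    fixed: for these the set below is empty and xget returns its default z. *)
Definition msperm_fun (s : {perm D}) (z : X) : X :=
  xget z [set y | exists d w, [/\ W w, z = f d w & y = f (s d) w]].

Lemma msperm_funE s d w : W w -> msperm_fun s (f d w) = f (s d) w.
Proof.
move=> Ww; apply: xget_unique => [|y [d' [w' [Ww' E ->]]]]; first by exists d, w.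
by have [<- <-] := multisection_inj Ww Ww' E.
Qed.

Definition ms_support : set X := [set z | exists d w, W w /\ z = f d w].

Lemma msperm_fun_out s z : ~ ms_support z -> msperm_fun s z = z.
Proof.
by move=> zf; apply: xgetPN => y [d [w [Ww E _]]]; apply: zf; exists d, w.
Qed.

Lemma msperm_funK s t : (s * t = 1)%g ->
  cancel (msperm_fun s) (msperm_fun t).
Proof.
move=> st z; have [[d [w [Ww ->]]]|zf] := pselect (ms_support z).
  by rewrite !msperm_funE // -permM st perm1.
by rewrite !msperm_fun_out.
Qed.

Definition msperm (s : {perm D}) : selfbij X :=
  Selfbij (msperm_funK (mulgV s)) (msperm_funK (mulVg s)).

Lemma mspermE s d w : W w -> msperm s (f d w) = f (s d) w.
Proof. exact: msperm_funE. Qed.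

Lemma msperm_out s z : ~ ms_support z -> msperm s z = z.
Proof. exact: msperm_fun_out. Qed.

(** The order is reversed, because permutations compose from left to right. *)
Lemma mspermM s t : msperm (s * t)%g = (msperm t * msperm s)%g.
Proof.
apply: selfbijP => z; have [[d [w [Ww ->]]]|zf] := pselect (ms_support z).
  by rewrite selfbijME !mspermE // permM.
by rewrite selfbijME !msperm_out.
Qed.

Lemma msperm1 : msperm 1%g = 1%g.
Proof.
apply: selfbijP => z; have [[d [w [Ww ->]]]|zf] := pselect (ms_support z).
  by rewrite !mspermE // perm1.
by rewrite !msperm_out.
Qed.

Lemma mspermV s : msperm s^-1%g = (msperm s)^-1%g.
Proof. by apply/esym/mulg1_eq; rewrite -mspermM mulVg msperm1. Qed.

Lemma ms_image_clopen d : clopen (f d @` W).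
Proof.
have [_ cX hX _] := XC; have [cW cf _] := Wf.
exact: (chart_clopen_image PP hX cX (cf d) cW).
Qed.

Lemma ms_support_clopen : clopen ms_support.
Proof.
rewrite (_ : ms_support = \bigcup_(d in [set: D]) (f d @` W)); last first.
  apply/seteqP; split => z; first by move=> [d [w [Ww ->]]]; exists d => //; exists w.
  by move=> [d _ [w Ww <-]]; exists d, w.
split; first by apply: bigcup_open => d _; case: (ms_image_clopen d).
by apply: closed_bigcup => [|d _]; first exact: finite_finset; case: (ms_image_clopen d).
Qed.

Lemma msperm_fullperm s : fullperm P (msperm s).
Proof.
have [_ cf _] := Wf; apply: fullperm_local => // z.
have [[d [w [Ww ->]]]|zf] := pselect (ms_support z).
  exists ([set p | W p.1 /\ p.2 = f (s d) p.1] \;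
    [set p | W p.1 /\ p.2 = f d p.1]^-1)%relation.
    by apply: (pseudo_comp PP) => //; [exact: cf|apply: (pseudo_inv PP); exact: cf].
  split.
    by move=> [x y] [v /= [Wv ->] [_ ->]]; rewrite /graph /= msperm_funE.
  by exists (f (s d) w); exists w.
exists (pid (~` ms_support)).
  by apply: (pseudo_id PP); case: (clopenC set0 ms_support_clopen).
split; last by exists z.
by move=> [x y] [/= xf ->]; rewrite /graph /= msperm_fun_out.
Qed.

Lemma msperm_cyc3 (s : {perm D}) d0 :
  s d0 != d0 -> s (s d0) != d0 -> (s * (s * s) = 1)%g ->
  (forall d, d != d0 -> d != s d0 -> d != s (s d0) -> s d = d) ->
  cyc3 P (f d0 @` W) (msperm s) /\
  orb3 (f d0 @` W) (msperm s) `<=`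
    f d0 @` W `|` (f (s d0) @` W `|` f (s (s d0)) @` W).
Proof.
move=> sd ssd s3 sfix.
have s3E d : s (s (s d)) = d by rewrite -!permM mulgA -mulgA s3 perm1.
have inU d w : W w -> (f d0 @` W) (f d w) -> d = d0.
  by move=> Ww [w' Ww' /multisection_inj[]].
have s3X x : msperm s (msperm s (msperm s x)) = x.
  have [[d [w [Ww ->]]]|zf] := pselect (ms_support x).
    by rewrite !mspermE // s3E.
  by rewrite !msperm_out.
split; [split|].
- exact: msperm_fullperm.
- exact: ms_image_clopen.
- move=> _ [w Ww <-]; rewrite !mspermE //.
  by split => /inU => /(_ Ww)/eqP; apply/negP.
- exact: s3X.
- move=> x xo; have [[d [w [Ww xE]]]|zf] := pselect (ms_support x); last first.
    exact: msperm_out.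
  rewrite xE mspermE // sfix //; apply/eqP => dE; apply: xo; rewrite xE dE.
  + by constructor 1; exists w.
  + by constructor 3; exists w => //; rewrite !mspermE // s3E.
  + by constructor 2; exists w => //; rewrite !mspermE // s3E.
- move=> x []; first by left.
  + move=> [w Ww /(congr1 (fun z => msperm s (msperm s z)))].
    by rewrite s3X !mspermE // => <-; right; right; exists w.
  + move=> [w Ww /(congr1 (msperm s))]; rewrite s3X mspermE // => <-.
    by right; left; exists w.
Qed.

Lemma msperm_tri C (x y z : D) : x != y -> y != z -> x != z ->
  f x @` W `<=` C -> f y @` W `<=` C -> f z @` W `<=` C ->
  alt_on P C (msperm (tperm x y * tperm y z)).
Proof.
move=> xy yz xz xC yC zC; set s := (_ * _)%g.
have sx : s x = z by rewrite permM tpermL tpermL.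
have sy : s y = x by rewrite permM tpermR tpermD // eq_sym.
have sz : s z = y by rewrite permM (tpermD xz yz) tpermR.
have so d : d != x -> d != y -> d != z -> s d = d.
  by move=> dx dy dz; rewrite permM !tpermD // eq_sym.
clearbody s; have [] := @msperm_cyc3 s x.
- by rewrite sx eq_sym.
- by rewrite sx sz eq_sym.
- apply/permP => d; rewrite !permM perm1.
  have [->|dx] := eqVneq d x; first by rewrite sx sz sy.
  have [->|dy] := eqVneq d y; first by rewrite sy sx sz.
  have [->|dz] := eqVneq d z; first by rewrite sz sy sx.
  by rewrite !so.
- by move=> d dx; rewrite sx sz => dz dy; exact: so.
- move=> c3 o3; apply: alt_on_cyc c3 _; apply: subset_trans o3 _.
  by rewrite sx sz => v [/xC|[/zC|/yC]].
Qed.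

Lemma msperm_alt_on C (s : {perm D}) : ms_support `<=` C -> ~~ odd_perm s ->
  alt_on P C (msperm s).
Proof.
move=> sC; have fC d : f d @` W `<=` C.
  by move=> _ [w Ww <-]; apply: sC; exists d, w.
move: s; apply: even_perm_ind.
- by rewrite msperm1; exact: alt_on_one.
- by move=> s t Hs Ht; rewrite mspermM; exact: alt_on_mul.
- by move=> x y z xy yz xz; exact: msperm_tri.
Qed.

End action.

Lemma multisection_sub (D : finType) W W' (f : D -> X -> X) :
  multisection W f -> clopen W' -> W' `<=` W -> multisection W' f.
Proof.
move=> [cW cf df] cW' W'W; split => //.
  by move=> d; apply: chart_res (cf d) _ _ => //; case: cW'.
by move=> d e w w' /W'W Ww /W'W Ww'; exact: df.
Qed.

(** Distinct points of one orbit are joined to x by a multisection as small as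
    wanted, by continuity at x. *)
Lemma multisection_exists (D : finType) (x : X) (y : D -> X)
    (F : D -> partial_map X) (V : D -> set X) :
  injective y -> (forall d, P (F d)) -> (forall d, F d (x, y d)) ->
  (forall d, nbhs (y d) (V d)) -> D ->
  exists W f, [/\ multisection W f, W x, forall d, f d x = y d,
    forall d, f d @` W `<=` V d & forall d w, W w -> F d (w, f d w)].
Proof.
move=> yi PF Fy Vy d00; have [f [U [cU FE]]] : exists (f : D -> X -> X) (U : D -> set X),
    (forall d, chart P (U d) (f d)) /\
    (forall d, F d = [set p | U d p.1 /\ p.2 = f d p.1]).
  have /choice[u Hu] : forall d, exists uf : set X * (X -> X),
      chart P uf.1 uf.2 /\ F d = [set p | uf.1 p.1 /\ p.2 = uf.2 p.1].
    by move=> d; have [U [f [cU oU FE]]] := chartP PP (PF d); exists (U, f).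
  exists (fun d => (u d).2), (fun d => (u d).1).
  by split => d; case: (Hu d).
have Ux d : U d x by have := Fy d; rewrite FE => -[].
have fx d : f d x = y d by have := Fy d; rewrite FE /= => -[_ ->].
have [|N [Ny Nd]] := finite_separation XC (enum_uniq D) (x := y).
  by move=> d e _ _; exact: yi.
have {}Ny d : nbhs (y d) (N d) by apply: Ny; rewrite mem_enum.
have {}Nd d e : d != e -> N d `&` N e = set0 by apply: Nd; rewrite mem_enum.
pose Q := \bigcap_(d in [set: D]) (U d `&` f d @^-1` (V d `&` N d)).
have Qx : nbhs x Q.
  apply: filter_forall_bigcap => d; apply: filterI.
    by apply: open_nbhs_in (Ux d); exact: chart_open (cU d).
  apply: (chart_cont PP (cU d) (Ux d)); rewrite fx; exact: filterI.
have [W [cW Wx WQ]] := clopen_basis XC Qx.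
exists W, f; split => //.
- split => //.
    by move=> d; apply: chart_res (cU d) _ _ => //; [case: cW|move=> w /WQ /(_ d I) []].
  move=> d e w w' /WQ /(_ d I)[_ [_ h1]] /WQ /(_ e I)[_ [_ h2]] E.
  have [//|de] := eqVneq d e.
  have : (N d `&` N e) (f d w) by split => //; rewrite E.
  by rewrite Nd.
- by move=> d _ [w /WQ /(_ d I)[_ [h _]] <-].
- by move=> d w /WQ /(_ d I)[h _]; rewrite FE.
Qed.

End multisections.

(** * Three-cycles of permutations on five points *)

(** Two 3-cycles meeting in one point have a 3-cycle as commutator.  A 3-cycle is
    written as a product of two transpositions throughout, which makes it even
    by construction and conjugation immediate. *)
Lemma tri_commutator (D : finType) (p q r s t : D) : uniq [:: p; q; r; s; t] ->
  (tperm p q * tperm q s = [~ tperm p r * tperm r q, tperm p t * tperm t s])%g.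
Proof.
rewrite /= !inE !negb_or => /and5P[/and4P[pq pr ps pt] /and3P[qr qs qt]
  /andP[rs rt] st _].
set y := (tperm p t * _)%g; rewrite commgEl conjMg !tpermJ.
have yp : y p = s by rewrite permM tpermL tpermL.
have yr : y r = r by rewrite permM !tpermD // eq_sym.
have yq : y q = q by rewrite permM !tpermD // eq_sym.
rewrite yp yr yq invMg !tpermV; apply/permP => d; rewrite !permM.
have N := (negbTE pq, negbTE pr, negbTE ps, negbTE qr, negbTE qs, negbTE rs).
have M := (eq_sym q p, eq_sym r p, eq_sym s p, eq_sym r q, eq_sym s q, eq_sym s r).
have [->|dp] := eqVneq d p; last have [->|dq] := eqVneq d q;
  last have [->|dr] := eqVneq d r; last have [->|ds] := eqVneq d s;
  rewrite !permE /=; do 9?(rewrite ?M ?N ?eqxx /=) => //.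
by do 9?rewrite ?(negbTE dp) ?(negbTE dq) ?(negbTE dr) ?(negbTE ds) /=.
Qed.

Lemma tri_conj (D : finType) (a b c d e : D) : uniq [:: a; b; c; d; e] ->
  (tperm a b * tperm b c = (tperm a b * tperm b d) ^ (tperm d e * tperm e c))%g.
Proof.
rewrite /= !inE !negb_or => /and5P[/and4P[ab ac ad ae] /and3P[bc bd be]
  /andP[cd ce] de _].
rewrite conjMg !tpermJ !permM tpermL tpermL.
by rewrite !(tpermD (z := a)) ?(tpermD (z := b)) // eq_sym.
Qed.

Lemma tri_rot (D : finType) (a b c : D) : uniq [:: a; b; c] ->
  (tperm a b * tperm b c = tperm b c * tperm c a)%g.
Proof.
rewrite /= !inE !negb_or => /and3P[/andP[ab ac] bc _].
apply/permP => d; rewrite !permM.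
have N := (negbTE ab, negbTE ac, negbTE bc).
have M := (eq_sym b a, eq_sym c a, eq_sym c b).
have [->|da] := eqVneq d a; last have [->|db] := eqVneq d b;
  last have [->|dc] := eqVneq d c;
  rewrite !permE /=; do 9?(rewrite ?M ?N ?eqxx /=) => //.
by do 9?rewrite ?(negbTE da) ?(negbTE db) ?(negbTE dc) /=.
Qed.

(** * Realizing germs by alternating elements *)

Section minimal_pseudogroup.
Variables (X : topologicalType) (P : set (partial_map X)).
Hypothesis XC : cantor_like X.
Hypothesis PP : pseudogroup P.
Hypothesis Pmin : dense_orbits P.

Lemma orbit_avoid x (V S : set X) : open V -> V !=set0 -> finite_set S ->
  exists y F, [/\ V y, ~ S y, P F & F (x, y)].
Proof.
move=> oV V0 fS; have [||y [F [[Vy Sy] PF Fxy]]] := @Pmin x (V `\` S).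
- exact: open_setD_finite.
- exact: open_setD_finite_neq0.
by exists y, F.
Qed.

(** In a perfect space every orbit meets every open set in infinitely many
    points, so a partial choice of distinct orbit points extends to D. *)
Lemma orbit_family (D : finType) (E : pred D) x (y0 : D -> X)
    (F0 : D -> partial_map X) (V S : set X) :
  {in E &, injective y0} -> (forall d, E d -> P (F0 d) /\ F0 d (x, y0 d)) ->
  open V -> V !=set0 -> finite_set S ->
  exists y F, [/\ injective y, forall d, E d -> y d = y0 d /\ F d = F0 d,
    forall d, ~~ E d -> V (y d) /\ ~ S (y d)
  & forall d, P (F d) /\ F d (x, y d)].
Proof.
move=> y0i F0E oV V0 fS.
suff: forall l : seq D, exists (y : D -> X) (F : D -> partial_map X),
  [/\ {in [pred d | E d || (d \in l)] &, injective y},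
    forall d, E d -> y d = y0 d /\ F d = F0 d,
    forall d, ~~ E d -> d \in l -> V (y d) /\ ~ S (y d)
  & forall d, E d || (d \in l) -> P (F d) /\ F d (x, y d)].
  move=> /(_ (enum D))[y [F [yi yE yV yF]]]; exists y, F; split => //.
  - by move=> d e; apply: yi; rewrite inE mem_enum orbT.
  - by move=> d /yV; apply; rewrite mem_enum.
  - by move=> d; apply: yF; rewrite mem_enum orbT.
elim=> [|a l [y [F [yi yE yV yF]]]].
  exists y0, F0; split => //.
    by move=> d e; rewrite !inE !orbF; exact: y0i.
  by move=> d; rewrite orbF; exact: F0E.
have [al|] := boolP (E a || (a \in l)).
  exists y, F.
  have eq d : E d || (d \in a :: l) = E d || (d \in l).
    by rewrite inE orbCA; have [->|] := eqVneq d a; rewrite ?al.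
  split => //.
  - by move=> d e; rewrite !inE/= -!in_cons !eq => h1 h2; apply: yi; rewrite inE.
  - by move=> d nE dl; apply: yV => //; have := eq d; rewrite dl (negbTE nE) /=.
  - by move=> d; rewrite eq; exact: yF.
rewrite negb_or => /andP[nEa nal].
pose T := [set z | exists2 d, d \in [seq d <- enum D | E d || (d \in l)] & z = y d].
have [|b [G [Vb Sb PG Gb]]] := @orbit_avoid x V (S `|` T) oV V0.
  rewrite finite_setU; split => //.
  rewrite (_ : T = [set` [seq y d | d <- enum D & E d || (d \in l)]]).
    exact: finite_seq.
  by apply/seteqP; split => z /=; [move=> [d dl ->]; exact: map_f|move=> /mapP].
have bN d : E d || (d \in l) -> b <> y d.
  move=> dl bE; apply: Sb; right; exists d => //.
  by rewrite mem_filter dl mem_enum.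
exists (fun d => if d == a then b else y d), (fun d => if d == a then G else F d).
split.
- move=> d e; rewrite !inE; have [->|da] := eqVneq d a; have [->|ea] := eqVneq e a => //=.
  + by move=> _ h /bN; case.
  + by move=> h _ /esym /bN; case.
  + exact: yi.
- by move=> d Ed; have [da|da] := eqVneq d a; [rewrite -da Ed in nEa|exact: yE].
- move=> d nE; rewrite inE; have [da _|da /=] := eqVneq d a; last exact: yV.
  by split => // Sb'; apply: Sb; left.
- by move=> d; rewrite inE; have [//|da] := eqVneq d a; exact: yF.
Qed.

Let o3 k (h : k < 3) : 'I_3 := Ordinal h.

(** A third orbit point w serves as the last point of a 3-cycle a, b, w on small
    neighbourhoods. *)
Lemma realize1 (V : set X) F a b : open V -> V a -> V b -> P F -> F (a, b) ->
  a <> b -> exists C g, [/\ clopen C, C `<=` V, alt_on P C g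
    & \near a, F (a, g a)].
Proof.
move=> oV Va Vb PF Fab ab.
pose i0 := @o3 0 isT; pose i1 := @o3 1 isT; pose i2 := @o3 2 isT.
pose E (d : 'I_3) := d != i2.
pose y0 (d : 'I_3) := if d == i0 then a else b.
pose F0 (d : 'I_3) := if d == i0 then pid setT else F.
have D3 (d : 'I_3) : [\/ d = i0, d = i1 | d = i2].
  case: d => -[|[|[|]]] // h; [constructor 1|constructor 2|constructor 3]; exact: val_inj.
have [||||y [G [yi yE yV yG]]] := @orbit_family 'I_3 E a y0 F0 V set0 _ _ oV _ _.
- move=> d e; rewrite !unfold_in /E /y0.
  by case: (D3 d) => ->; case: (D3 e) => -> //= _ _ h; case: ab; rewrite h.
- move=> d; rewrite /E /F0 /y0; case: (D3 d) => -> //= _; split => //.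
  exact: (pseudo_id PP openT).
- by exists a.
- exact: finite_set0.
have y0E : y i0 = a by have [] := yE i0 isT.
have y1E : y i1 = b by have [] := yE i1 isT.
have [||||W [f [Wf Wa fa fV Gf]]] := @multisection_exists _ _ XC PP 'I_3 a y G (fun=> V) yi.
- by move=> d; case: (yG d).
- by move=> d; case: (yG d).
- move=> d; apply: open_nbhs_in => //.
  by case: (D3 d) => ->; rewrite ?y0E ?y1E //; case: (yV i2 isT).
- exact: i0.
have f0 w : W w -> f i0 w = w.
  by move=> Ww; have := Gf i0 _ Ww; have [_ ->] := yE i0 isT; case.
have f1 w : W w -> F (w, f i1 w).
  by move=> Ww; have := Gf i1 _ Ww; have [_ ->] := yE i1 isT.
exists (ms_support W f), (msperm PP Wf (tperm i0 i2 * tperm i2 i1)); split.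
- exact: (ms_support_clopen XC PP Wf).
- by move=> _ [d [w [Ww ->]]]; apply: (fV d); exists w.
- apply: (msperm_alt_on XC) => //.
  by rewrite odd_permM !odd_tperm.
- have Wn : nbhs a W by apply: open_nbhs_in => //; case: Wf => -[].
  apply: filterS Wn => w Ww; rewrite -{2}(f0 _ Ww) mspermE //.
  by rewrite permM tpermL tpermL; exact: f1.
Qed.

End minimal_pseudogroup.

Section realization.
Variables (X : topologicalType) (P : set (partial_map X)).
Hypothesis XC : cantor_like X.
Hypothesis PP : pseudogroup P.
Hypothesis Pmin : dense_orbits P.

Lemma alt_on_fix_near C g x : clopen C -> alt_on P C g -> ~ C x ->
  \near x, g x = x.
Proof.
move=> cC gg Cx; have : nbhs x (~` C).
  by apply: open_nbhs_in => //; case: (clopenC set0 cC).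
by apply: filterS => z; exact: alt_on_supp gg.
Qed.

Lemma fullperm_nbhs g x N : fullperm P g -> nbhs (g x) N -> nbhs x (g @^-1` N).
Proof. by move=> gF; exact: (fullperm_cont PP gF). Qed.

Lemma near_FG_val F (g : selfbij X) x y : P F -> F (x, y) ->
  (\near x, F (x, g x)) -> g x = y.
Proof. by move=> PF Fxy /nbhs_singleton h; exact: (pseudo_fun PP PF h Fxy). Qed.

(** With sources and targets all distinct, the points can be moved one at a time
    by 3-cycles which avoid the other ones. *)
Lemma realize_disjoint (I : eqType) (is_ : seq I) (a b : I -> X)
    (F : I -> partial_map X) (V : set X) :
  open V -> uniq is_ -> {in is_ &, injective a} -> {in is_ &, injective b} ->
  {in is_, forall i, [/\ P (F i), F i (a i, b i), V (a i) & V (b i)]} ->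
  {in is_ &, forall i j, a i <> b j} ->
  exists C g, [/\ clopen C, C `<=` V, alt_on P C g
    & {in is_, forall i, \forall z \near a i, F i (z, g z)}].
Proof.
elim: is_ V => [|i l IH] V oV /=.
  move=> _ _ _ _ _; exists set0, 1%g; split => //; first exact: clopen0.
  exact: alt_on_one.
move=> /andP[il ul] ai bi Fi dij.
have l_in j : j \in l -> j \in i :: l by rewrite inE orbC => ->.
have ii : i \in i :: l by rewrite inE eqxx.
have [PFi Fii Vai Vbi] := Fi _ ii.
have nji j : j \in l -> j <> i by move=> jl ji; rewrite ji (negbTE il) in jl.
pose V1 := V `\` [set` map a l ++ map b l].
have oV1 : open V1 by apply: (open_setD_finite XC) => //; exact: finite_seq.
have mm z : z \in map a l ++ map b l -> exists2 j, j \in l & z = a j \/ z = b j.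
  by rewrite mem_cat => /orP[] /mapP[j jl ->]; exists j => //; [left|right].
have V1a : V1 (a i).
  split => //= /mm[j jl [] e]; last exact: (dij i j ii (l_in _ jl) e).
  by apply: (nji _ jl); apply: ai => //; exact: l_in.
have V1b : V1 (b i).
  split => //= /mm[j jl [] e]; first exact: (dij j i (l_in _ jl) ii (esym e)).
  by apply: (nji _ jl); apply: bi => //; exact: l_in.
have [C1 [g1 [cC1 C1V1 gg1 g1F]]] :=
  realize1 XC PP Pmin oV1 V1a V1b PFi Fii (dij _ _ ii ii).
pose V2 := V `\` [set a i; b i].
have oV2 : open V2.
  by apply: (open_setD_finite XC) => //; exact: finite_set2.
have [] := IH V2 oV2 ul.
- by move=> j k jl kl; apply: ai; exact: l_in.
- by move=> j k jl kl; apply: bi; exact: l_in.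
- move=> j jl; have [PFj Fj Vaj Vbj] := Fi _ (l_in _ jl).
  split => //; split => // -[] e.
  + by apply: (nji _ jl); apply: ai => //; exact: l_in.
  + exact: (dij j i (l_in _ jl) ii e).
  + exact: (dij i j ii (l_in _ jl) (esym e)).
  + by apply: (nji _ jl); apply: bi => //; exact: l_in.
- by move=> j k jl kl; apply: dij; exact: l_in.
move=> C2 [g2 [cC2 C2V2 gg2 g2F]].
exists (C1 `|` C2), (g2 * g1)%g; split.
- exact: clopenU.
- by move=> z [/C1V1[]|/C2V2[]].
- by apply: alt_on_mul; [apply: alt_on_mono gg2|apply: alt_on_mono gg1] => z; [right|left].
- move=> j; rewrite inE => /predU1P[->|jl].
    have g1b := near_FG_val PFi Fii g1F.
    have : nbhs (g1 (a i)) [set z | g2 z = z].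
      apply: alt_on_fix_near cC2 gg2 _; rewrite g1b => /C2V2[_]; apply; by right.
    move=> /(fullperm_nbhs (alt_on_fullperm PP gg1)); apply: filterS2 g1F => z /=.
    by move=> Fz ->.
  have : nbhs (a j) [set z | g1 z = z].
    apply: alt_on_fix_near cC1 gg1 _ => /C1V1[_]; apply => /=.
    by rewrite mem_cat map_f.
  by apply: filterS2 (g2F j jl) => z Fz; rewrite /= => ->.
Qed.

(** Going through fresh intermediate points reduces this to the case of disjoint
    sources and targets, used twice. *)
Lemma realize (I : eqType) (is_ : seq I) (a b : I -> X)
    (F : I -> partial_map X) (V : set X) :
  open V -> uniq is_ -> {in is_ &, injective a} -> {in is_ &, injective b} ->
  {in is_, forall i, [/\ P (F i), F i (a i, b i), V (a i) & V (b i)]} ->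
  exists C g, [/\ clopen C, C `<=` V, alt_on P C g
    & {in is_, forall i, \forall z \near a i, F i (z, g z)}].
Proof.
move=> oV ui ai bi Fi.
have : forall l, {subset l <= is_} -> uniq l ->
    exists (w : I -> X) (E : I -> partial_map X), {in l &, injective w} /\
    {in l, forall i, [/\ P (E i), E i (a i, w i), V (w i) &
       forall j, j \in is_ -> w i <> a j /\ w i <> b j]}.
  elim=> [|i l IH] li /=; first by move=> _; exists a, F.
  move=> /andP[il ul]; have [|w [E [wi Ew]]] := IH _ ul.
    by move=> j jl; apply: li; rewrite inE jl orbT.
  have iis : i \in is_ by apply: li; rewrite inE eqxx.
  have [_ _ Vai _] := Fi i iis.
  have [||wi0 [Ei [Vw wS PEi Ewi]]] := @orbit_avoid _ _ XC Pmin (a i) V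
    [set` map w l ++ map a is_ ++ map b is_] oV; first by exists (a i).
    exact: finite_seq.
  rewrite /= !mem_cat in wS.
  exists (fun j => if j == i then wi0 else w j), (fun j => if j == i then Ei else E j).
  have nw j : j \in l -> wi0 <> w j.
    by move=> jl e; apply: wS; rewrite e map_f.
  split.
  - move=> j k; rewrite !inE; have [->|ji] := eqVneq j i; have [->|ki] := eqVneq k i => //=.
    + by move=> _ /nw h /h.
    + by move=> /nw h _ /esym /h.
    + exact: wi.
  - move=> j; rewrite inE; have [-> _|ji /=] := eqVneq j i; last exact: Ew.
    split => // k ks; split => e; apply: wS; rewrite e map_f ?orbT //.
move=> /(_ is_ (fun _ h => h) ui)[w [E [wi Ew]]].
have [||C1 [g1 [cC1 C1V gg1 g1E]]] := @realize_disjoint I is_ a w E V oV ui ai wi.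
- by move=> i iis; have [? ? ? _] := Ew i iis; have [_ _ ? _] := Fi i iis; split.
- move=> i j iis jis e; have [_ _ _ h] := Ew j jis.
  by case: (h i iis) => h1 _; apply: h1.
pose F' i := (F i \; (E i)^-1)%relation.
have [||C2 [g2 [cC2 C2V gg2 g2F]]] := @realize_disjoint I is_ w b F' V oV ui wi bi.
- move=> i iis; have [PE Ei Vw _] := Ew i iis; have [PF Fii _ Vb] := Fi i iis.
  split => //; last by exists (a i).
  by apply: (pseudo_comp PP) => //; exact: (pseudo_inv PP).
- by move=> i j iis jis; have [_ _ _ h] := Ew i iis; case: (h j jis).
exists (C1 `|` C2), (g2 * g1)%g; split.
- exact: clopenU.
- by move=> z [/C1V|/C2V].
- by apply: alt_on_mul; [apply: alt_on_mono gg2|apply: alt_on_mono gg1] => z; [right|left].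
- move=> i iis; have [PE Ei _ _] := Ew i iis.
  have g1w := near_FG_val PE Ei (g1E i iis).
  have := g2F i iis; rewrite -g1w => /(fullperm_nbhs (alt_on_fullperm PP gg1)).
  apply: filterS2 (g1E i iis) => z Ez /= [z' Ez' Fz'].
  rewrite /= in Ez' Fz'; have zz' := pseudo_inj PP PE Ez Ez'.
  by rewrite -zz' in Fz'.
Qed.

End realization.

(** * Commutators and gluing in alternating groups *)

Section perfectness.
Variables (X : topologicalType) (P : set (partial_map X)).
Hypothesis XC : cantor_like X.
Hypothesis PP : pseudogroup P.
Hypothesis Pmin : dense_orbits P.

Let o5 k (h : k < 5) : 'I_5 := Ordinal h.

(** A small piece of a 3-cycle is the 3-cycle of three of the pieces of a
    multisection; this transfers identities between permutations to it. *)
Lemma piece_msperm (D : finType) (W : set X) (f : D -> X -> X)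
    (Wf : multisection P W f) (s s' : selfbij X) (p q r : D) (t : {perm D}) :
  (forall x, s (s (s x)) = x) -> piece_of s W s' ->
  (forall w, W w -> [/\ f p w = w, f q w = s w & f r w = s (s w)]) ->
  t p = q -> t q = r -> t r = p -> 
  (forall d, d != p -> d != q -> d != r -> t d = d) -> s' = msperm PP Wf t.
Proof.
move=> s3 ps fE tp tq tr td; apply: selfbijP => x.
have [io no] := ps x.
have oE : orb3 W s x -> exists d w, [/\ W w, x = f d w & d \in [:: p; q; r]].
  case=> Wx; have [fp fq fr] := fE _ Wx.
  - by exists p, x; rewrite fp !inE eqxx.
  - by exists r, (s x); rewrite fr s3 !inE eqxx !orbT.
  - by exists q, (s (s x)); rewrite fq s3 !inE eqxx !orbT.
have [xo|xo] := pselect (orb3 W s x).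
  rewrite io //; have [d [w [Ww -> dd]]] := oE xo.
  rewrite mspermE //; have [fp fq fr] := fE _ Ww.
  by move: dd; rewrite !inE => /or3P[] /eqP ->; rewrite ?tp ?tq ?tr ?fp ?fq ?fr.
rewrite no //; have [[d [w [Ww xE]]]|xm] := pselect (ms_support W f x); last first.
  by rewrite msperm_out.
have [fp fq fr] := fE _ Ww.
rewrite xE mspermE // td //; apply/eqP => de; apply: xo; rewrite xE de.
- by rewrite fp; constructor 1.
- by rewrite fq; constructor 3; rewrite s3.
- by rewrite fr; constructor 2; rewrite s3.
Qed.

Let i0 := o5 (isT : 0 < 5).
Let i1 := o5 (isT : 1 < 5).
Let i2 := o5 (isT : 2 < 5).
Let i3 := o5 (isT : 3 < 5).
Let i4 := o5 (isT : 4 < 5).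

Let D5 (d : 'I_5) : [\/ d = i0, d = i1, d = i2 | (d = i3) \/ (d = i4)].
Proof.
case: d => -[|[|[|[|[|]]]]] // h; [constructor 1|constructor 2|constructor 3|
 constructor 4; left|constructor 4; right]; exact: val_inj.
Qed.

(** The two extra pieces, for which there is room in any nonempty open set B,
    bring in a group of even permutations of five points. *)
Lemma cyc3_multisection U s x (A0 A1 A2 B : set X) : cyc3 P U s -> U x ->
  nbhs x A0 -> nbhs (s x) A1 -> nbhs (s (s x)) A2 -> open B -> B !=set0 ->
  exists N (f : 'I_5 -> X -> X), [/\ nbhs x N, multisection P N f,
     forall w, N w -> [/\ f i0 w = w, f i1 w = s w & f i2 w = s (s w)]
   & [/\ f i0 @` N `<=` A0, f i1 @` N `<=` A1, f i2 @` N `<=` A2,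
        f i3 @` N `<=` B & f i4 @` N `<=` B]].
Proof.
move=> cs Ux Ax A1x A2x oB B0; have [sF cU dU s3 s1] := cs.
pose E (d : 'I_5) := d < 3.
pose y0 (d : 'I_5) := if d == i0 then x else if d == i1 then s x else s (s x).
pose F0 (d : 'I_5) := if d == i0 then pid setT else
  if d == i1 then graph s else graph (s * s)%g.
have [d1 d2] := dU _ Ux.
have x1 : x <> s x by move=> h; apply: d1; rewrite -h.
have x2 : x <> s (s x) by move=> h; apply: d2; rewrite -h.
have x12 : s x <> s (s x) by move=> h; exact: x1 (selfbij_inj h).
have [|||y [G [yi yE yV yG]]] :=
   @orbit_family _ _ XC Pmin 'I_5 E x y0 F0 B set0 _ _ oB B0.
- move=> d e; rewrite !unfold_in /E /y0.
  case: (D5 d) => [->|->|->|[]->]; case: (D5 e) => [->|->|->|[]->] //= _ _ h;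
    by [case: x1; rewrite h|case: x2; rewrite h|case: x12; rewrite h].
- move=> d; rewrite /E /F0 /y0; case: (D5 d) => [->|->|->|[]->] //= _; split => //.
  + exact: (pseudo_id PP openT).
  + exact: fullpermM.
- exact: finite_set0.
have y0E : y i0 = x by have [] := yE i0 isT.
have y1E : y i1 = s x by have [] := yE i1 isT.
have y2E : y i2 = s (s x) by have [] := yE i2 isT.
have By3 : B (y i3) by have [] := yV i3 isT.
have By4 : B (y i4) by have [] := yV i4 isT.
pose V (d : 'I_5) := if d == i0 then A0 else if d == i1 then A1 else
   if d == i2 then A2 else B.
have [||||W [f [Wf Wx fx fV Gf]]] := @multisection_exists _ _ XC PP 'I_5 x y G V yi.
- by move=> d; case: (yG d).
- by move=> d; case: (yG d).
- move=> d; rewrite /V; case: (D5 d) => [->|->|->|[]->] /=; rewrite ?y0E ?y1E ?y2E //;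
    exact: open_nbhs_in.
- exact: i0.
exists W, f; split => //.
- by apply: open_nbhs_in => //; case: Wf => -[].
- move=> w Ww; split.
  + by have := Gf i0 _ Ww; have [_ ->] := yE i0 isT; case.
  + by have := Gf i1 _ Ww; have [_ ->] := yE i1 isT.
  + by have := Gf i2 _ Ww; have [_ ->] := yE i2 isT.
Qed.

Let tri (a b c : 'I_5) : {perm 'I_5} := (tperm a b * tperm b c)%g.

(** This reduces membership of the small pieces of s in K to a question about
    3-cycles of pieces of multisections, which can be settled by identities in
    the alternating group on five points. *)
Lemma cyc3_local (K : set (selfbij X)) U s x A0 A1 A2 B :
  cyc3 P U s -> U x ->
  nbhs x A0 -> nbhs (s x) A1 -> nbhs (s (s x)) A2 -> open B -> B !=set0 ->
  (forall W f (Wf : multisection P W f),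
     [/\ f i0 @` W `<=` A0, f i1 @` W `<=` A1, f i2 @` W `<=` A2,
        f i3 @` W `<=` B & f i4 @` W `<=` B] -> K (msperm PP Wf (tri i0 i2 i1))) ->
  exists2 N, nbhs x N & forall W s', clopen W ->
     W `<=` U -> W `<=` N -> cyc3 P W s' -> piece_of s W s' ->
     orb3 W s' = orb3 W s -> K s'.
Proof.
move=> cs Ux A0x A1x A2x oB B0 HK.
have [N [f [Nx Nf fE [f0 f1 f2 f3 f4]]]] := cyc3_multisection cs Ux A0x A1x A2x oB B0.
exists N => // W s' cW WU WN cs' ps' _.
have Wf := multisection_sub PP Nf cW WN.
rewrite (_ : s' = msperm PP Wf (tri i0 i2 i1)).
  by apply: HK; split; [apply: subset_trans f0|apply: subset_trans f1|
    apply: subset_trans f2|apply: subset_trans f3|apply: subset_trans f4];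
    exact: image_subset.
case: cs => _ _ _ s3 _.
apply: (@piece_msperm _ W f Wf s s' i0 i1 i2) => //.
- by move=> w /WN /fE.
- by rewrite permM tpermL tpermL.
- by rewrite permM (tpermD (z := i1)) // tpermR.
- by rewrite permM tpermR tpermD.
- by move=> d h0 h1 h2; rewrite permM !tpermD // eq_sym.
Qed.

(** With two spare pieces inside its own support, a small 3-cycle is a commutator
    of 3-cycles. *)
Lemma alt_on_commutators (K : set (selfbij X)) C : K 1%g ->
  (forall g h, K g -> K h -> K (g * h)%g) ->
  (forall c d, alt_on P C c -> alt_on P C d -> K [~ c, d]%g) ->
  alt_on P C `<=` K.
Proof.
move=> K1 KM Kc g; elim=> // {g} [g h _ + _|U s cs sC]; first exact: KM.
apply: (cyc3_ind XC PP cs K1 KM) => x Ux.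
have oO : open (orb3 U s) by case: (cyc3_orb_clopen PP cs).
have [_ _ _ s3 _] := cs.
have Oz z : orb3 U s z -> nbhs z C by move=> Oz; apply: filterS sC _; exact: open_nbhs_in.
apply: (@cyc3_local K U s x C C C (orb3 U s)) => //.
- by apply: Oz; constructor 1.
- by apply: Oz; constructor 3; rewrite s3.
- by apply: Oz; constructor 2; rewrite s3.
- by exists x; constructor 1.
move=> W f Wf [f0 f1 f2 f3 f4].
rewrite /tri (@tri_commutator _ i0 i2 i3 i1 i4) //.
have WC : ms_support W f `<=` C.
  move=> _ [d [w [Ww ->]]]; case: (D5 d) => [->|->|->|[]->].
  - by apply: f0; exists w.
  - by apply: f1; exists w.
  - by apply: f2; exists w.
  - by apply/sC/f3; exists w.
  - by apply/sC/f4; exists w.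
have E (a b : {perm 'I_5}) :
    msperm PP Wf [~ a, b]%g = [~ (msperm PP Wf b)^-1, (msperm PP Wf a)^-1]%g.
  by rewrite !commgEl !conjgE !mspermM !mspermV !invgK !mulgA.
rewrite E; apply: Kc; apply: alt_on_inv; apply: (msperm_alt_on XC) => //.
  by rewrite odd_permM !odd_tperm.
by rewrite odd_permM !odd_tperm.
Qed.

(** Among the three pieces of a small 3-cycle, two lie in the same set, C or C'.
    The 3-cycle is therefore obtained from one inside this set, in which the
    third piece is replaced by a piece in the intersection, by conjugating with
    a 3-cycle inside the set containing the third piece. *)
Lemma alt_on_glue (K : set (selfbij X)) (C C' : set X) : K 1%g ->
  (forall g h, K g -> K h -> K (g * h)%g) -> (forall g, K g -> K g^-1%g) ->
  clopen C -> clopen C' -> C `&` C' !=set0 ->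
  alt_on P C `<=` K -> alt_on P C' `<=` K -> alt_on P (C `|` C') `<=` K.
Proof.
move=> K1 KM KV cC cC' CC' CK CK' g; elim=> // {g} [g h _ + _|U s cs sC]; first exact: KM.
apply: (cyc3_ind XC PP cs K1 KM) => x Ux.
have [_ _ _ s3 _] := cs.
have Oz z : orb3 U s z -> exists A, nbhs z A /\ (A = C \/ A = C').
  case: cC => oC _; case: cC' => oC' _.
  by move=> /sC[Cz|Cz]; [exists C|exists C']; split; by [exact: open_nbhs_in|left|right].
have [A0 [A0x A0E]] : exists A, nbhs x A /\ (A = C \/ A = C').
  by apply: Oz; constructor 1.
have [A1 [A1x A1E]] : exists A, nbhs (s x) A /\ (A = C \/ A = C').
  by apply: Oz; constructor 3; rewrite s3.
have [A2 [A2x A2E]] : exists A, nbhs (s (s x)) A /\ (A = C \/ A = C').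
  by apply: Oz; constructor 2; rewrite s3.
apply: (@cyc3_local K U s x A0 A1 A2 (C `&` C')) => //.
  by case: (clopenI cC cC').
move=> W f Wf [f0 f1 f2 f3 f4].
have f3C : f i3 @` W `<=` C by move=> z /f3[].
have f3C' : f i3 @` W `<=` C' by move=> z /f3[].
have f4C : f i4 @` W `<=` C by move=> z /f4[].
have f4C' : f i4 @` W `<=` C' by move=> z /f4[].
have KD (D : set X) (a b c : 'I_5) : D = C \/ D = C' -> uniq [:: a; b; c] ->
    f a @` W `<=` D -> f b @` W `<=` D -> f c @` W `<=` D -> K (msperm PP Wf (tri a b c)).
  move=> DE; rewrite /= !inE negb_or => /and3P[/andP[ab ac] bc _] aD bD cD.
  have : alt_on P D (msperm PP Wf (tri a b c)) by apply: (msperm_tri XC).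
  by case: DE => ->; [exact: CK|exact: CK'].
have Kconj0 (p q : {perm 'I_5}) : K (msperm PP Wf p) -> K (msperm PP Wf q) ->
    K (msperm PP Wf (p ^ q)%g).
  move=> Kp Kq; rewrite conjgE !mspermM mspermV.
  by apply: (KM); [apply: (KM)|exact: KV].
have Kconj (a b c d e : 'I_5) : uniq [:: a; b; c; d; e] -> K (msperm PP Wf (tri a b d)) ->
    K (msperm PP Wf (tri d e c)) -> K (msperm PP Wf (tri a b c)).
  by move=> u Kd Kc; rewrite /tri (tri_conj u); exact: Kconj0.
have K2 (a b c : 'I_5) D D' : D = C \/ D = C' -> D' = C \/ D' = C' ->
    uniq [:: a; b; c; i3; i4] -> f a @` W `<=` D -> f b @` W `<=` D -> f c @` W `<=` D' ->
    K (msperm PP Wf (tri a b c)).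
  move=> DE DE' u aD bD cD; apply: (Kconj a b c i3 i4) => //.
    apply: (KD D) => //; last by case: DE => ->.
    move: u; rewrite /= !inE !negb_or.
    by move=> /and3P[/and4P[ab ac a3 _] /and3P[bc b3 _] _]; rewrite ab a3 b3.
  apply: (KD D') => //; try by case: DE' => ->.
  move: u; rewrite /= !inE !negb_or => /and3P[_ _ cc].
  have /andP[c3 c4] : (c != i3) && (c != i4) by move: cc; rewrite ?andbT.
  by rewrite (eq_sym i3 c) (eq_sym i4 c) c3 c4.
have R0 : tri i0 i2 i1 = tri i2 i1 i0 by rewrite /tri tri_rot.
have R1 : tri i0 i2 i1 = tri i1 i0 i2 by rewrite R0 /tri tri_rot.
have [e|e] : A0 = A2 \/ A1 = A2 \/ A0 = A1.
  move: A0E A1E A2E; case=> ->; case=> ->; case=> ->; tauto.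
- by apply: (K2 _ _ _ A0 A1) => //; rewrite e.
case: e => e.
- by rewrite R0; apply: (K2 _ _ _ A2 A0) => //; rewrite -e.
- by rewrite R1; apply: (K2 _ _ _ A0 A2) => //; rewrite e.
Qed.

End perfectness.

(** * Monochromatic rectangles in Heisenberg groups *)

Definition supp_in (X : Type) (g : X -> X) (U : set X) : Prop :=
  forall x, ~ U x -> g x = x.

Lemma supp_in_stable (X : Type) (g : selfbij X) U x :
  supp_in g U -> U x -> U (g x).
Proof.
move=> gU Ux; apply: contrapT => nU; have gx := selfbij_inj (gU _ nU).
by apply: nU; rewrite gx.
Qed.

Lemma supp_inV (X : Type) (g : selfbij X) U : supp_in g U -> supp_in g^-1%g U.
Proof. by move=> gU x /gU h; rewrite -{1}h selfbijK. Qed.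

Lemma supp_inM (X : Type) (g h : selfbij X) U :
  supp_in g U -> supp_in h U -> supp_in (g * h)%g U.
Proof. by move=> gU hU x Ux; rewrite selfbijME hU // gU. Qed.

Lemma supp_in_sub (X : Type) (g : X -> X) U V :
  U `<=` V -> supp_in g U -> supp_in g V.
Proof. by move=> UV gU x Vx; apply: gU => /UV. Qed.

Lemma supp_commute (X : Type) (g h : selfbij X) U V :
  supp_in g U -> supp_in h V -> U `&` V = set0 -> (g * h = h * g)%g.
Proof.
move=> gU hV UV0; apply: selfbijP => x; rewrite !selfbijME.
have UV y : U y -> ~ V y by move=> Uy Vy; have : (U `&` V) y by []; rewrite UV0.
have [Ux|Ux] := pselect (U x).
  by rewrite !hV //; apply: UV => //; exact: supp_in_stable.
rewrite (gU x) //; have [Vx|Vx] := pselect (V x); last by rewrite hV // gU.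
by rewrite gU // => /UV; apply; exact: supp_in_stable.
Qed.

Lemma supp_in_conj (X : Type) (g h : selfbij X) U :
  supp_in g U -> supp_in (h * g * h^-1)%g (h^-1%g @^-1` U).
Proof. by move=> gU x Ux; rewrite !selfbijME gU // selfbijVK. Qed.

Definition subgrp (X : Type) (K : set (selfbij X)) : Prop :=
  [/\ K 1%g, forall g h, K g -> K h -> K (g * h)%g & forall g, K g -> K g^-1%g].

Lemma subgrp_conj (X : Type) (K : set (selfbij X)) c : subgrp K ->
  subgrp [set g | K (c^-1 * g * c)%g].
Proof.
move=> [K1 KM KV]; split => /=.
- by rewrite mulg1 mulVg.
- move=> g h Kg Kh.
  have -> : (c^-1 * (g * h) * c = (c^-1 * g * c) * (c^-1 * h * c))%g.
    by rewrite !mulgA mulgK.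
  exact: KM.
- by move=> g /KV; rewrite !invgM invgK mulgA.
Qed.

(** Among R + 1 columns each row has two entries of the same colour; there are
    more rows than possibilities for the two columns and the colour. *)
Lemma monochromatic_rectangle (T : finType) R (f : T -> T -> 'I_R) :
  R.+1 * R.+1 * R < #|T| -> exists u u' v v', [/\ u != u', v != v',
    f u v = f u v', f u' v = f u v & f u' v' = f u v].
Proof.
move=> RT.
have [R0|R0] := posnP R.
  have : 0 < #|T| by apply: leq_trans RT.
  by move=> /card_gt0P[x _]; have := ltn_ord (f x x); rewrite {2}R0.
have RT' : R.+1 <= #|T|.
  by apply: leq_trans (ltnW RT); rewrite -{1}(muln1 R.+1) -mulnA leq_mul // muln_gt0.
pose e (k : 'I_R.+1) : T := enum_val (widen_ord RT' k).
have ei : injective e by move=> k k' /enum_val_inj /(congr1 val) /= /val_inj.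
have /choice[s Hs] : forall u, exists s : 'I_R.+1 * 'I_R.+1,
    s.1 != s.2 /\ f u (e s.1) = f u (e s.2).
  move=> u; have : ~~ injectiveb (fun k => f u (e k)).
    apply/negP => /injectiveP /leq_card; by rewrite !card_ord ltnn.
  by move=> /injectivePn[k [k' kk' E]]; exists (k, k').
have : ~~ injectiveb (fun u => (s u, f u (e (s u).1))).
  apply/negP => /injectiveP /leq_card; rewrite !card_prod !card_ord.
  by rewrite leqNgt RT.
move=> /injectivePn[u [u' uu' [E E2]]].
have [s12 fs] := Hs u; have [_ fs'] := Hs u'.
exists u, u', (e (s u).1), (e (s u).2); split => //.
- by apply: contra_neq s12; exact: ei.
- by rewrite E2 E.
- by rewrite E2 E -fs'.
Qed.

(** In the application x, an element of the first group conjugated by p, is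
    supported away from both groups.  So it can be moved past their elements,
    and the conjugates of p at the four corners multiply to an expression
    without p. *)
Lemma rectangle_product (G : groupType) (a a' b b' g p : G) :
  (let x := (p * (a * a'^-1) * p^-1)%g in
    [/\ commute x a, commute x a', commute x b & commute x b']) ->
  let k a b := (g^-1 * (b^-1 * a^-1) * p * (a * b * g))%g in
  (k a b * (k a' b)^-1 * k a' b' * (k a b')^-1 =
   g^-1 * (b^-1 * (a^-1 * a') * b * (b'^-1 * (a'^-1 * a) * b')) * g)%g.
Proof.
set x := (p * _ * _)%g => -[xa xa' xb xb'] k.
have kk (c c' d : G) : (k c d * (k c' d)^-1 =
    g^-1 * (d^-1 * (c^-1 * (p * (c * c'^-1) * p^-1) * c') * d) * g)%g.
  by rewrite /k !invgM !invgK !mulgA !mulgK.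
rewrite -mulgA !kk -/x.
have -> : (p * (a' * a^-1) * p^-1 = x^-1)%g by rewrite /x !invgM !invgK !mulgA.
have pull (y c : G) : commute y c -> forall h k : G, (c^-1 * (y * h) * k = y * (c^-1 * h * k))%g.
  by move=> yc h l; rewrite !mulgA -(commuteV yc).
have sV (c : G) : commute x c -> commute x^-1%g c.
  by move=> xc; apply: commute_sym; apply: commuteV; exact: commute_sym.
have := pull _ _ xa 1%g a'; rewrite !mulg1 => ->.
have := pull _ _ (sV _ xa') 1%g a; rewrite !mulg1 => ->.
rewrite (pull _ _ xb) (pull _ _ (sV _ xb')).
set B := (b^-1 * _ * b)%g; set B' := (b'^-1 * _ * b')%g.
have xB : (x * B = B * x)%g.
  apply: commuteM => //; apply: commuteM; first exact: commuteV.
  by apply: commuteM => //; exact: commuteV.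
by clearbody B B' x; rewrite xB !mulgA !mulgK.
Qed.

Section heisenberg.
Import GRing.Theory.
Local Open Scope ring_scope.
Variables (X : topologicalType) (P : set (partial_map X)).
Hypothesis XC : cantor_like X.
Hypothesis PP : pseudogroup P.
Hypothesis Pmin : dense_orbits P.

(** The Heisenberg group modulo q acts on the q^2 points (u, v) by
    a_i : (u, v) -> (u + i, v), b_j : (u, v) -> (u, v + j u) and the central
    z_c : (u, v) -> (u, v + c).  These permutations are squares, q being odd,
    hence even, and z_c has no fixed point for c nonzero. *)
Lemma heisenberg U x N : open U -> U x -> exists q (a b z : 'F_q -> selfbij X) C,
  [/\ prime q /\ (N < q)%N, [/\ clopen C, C `<=` U & C x],
   [/\ forall i, alt_on P C (a i), forall i, alt_on P C (b i) & forall i, alt_on P C (z i)],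
   [/\ {morph a : i j / i + j >-> (i * j)%g}, {morph b : i j / i + j >-> (i * j)%g}
     & {morph z : i j / i + j >-> (i * j)%g}] &
   [/\ forall i j, (z i * a j = a j * z i)%g, forall i j, (z i * b j = b j * z i)%g,
     forall i j, (b j * a i = z (i * j)%R * a i * b j)%g &
     forall y, C y -> injective (fun c => z c y)]].
Proof.
move=> oU Ux; have [q Nq pq] := prime_above (maxn N 2).
have N_q : (N < q)%N by apply: leq_ltn_trans Nq; exact: leq_maxl.
have q2 : (2 < q)%N by apply: leq_ltn_trans Nq; exact: leq_maxr.
pose D : finType := ('F_q * 'F_q)%type.
pose a0 (i : 'F_q) (d : D) : D := (d.1 + i, d.2).
pose b0 (j : 'F_q) (d : D) : D := (d.1, d.2 + j * d.1).
pose z0 (c : 'F_q) (d : D) : D := (d.1, d.2 + c).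
have a0i i : injective (a0 i).
  by apply: (can_inj (g := a0 (- i))) => -[u v]; rewrite /a0 /= addrK.
have b0i i : injective (b0 i).
  by apply: (can_inj (g := b0 (- i))) => -[u v]; rewrite /b0 /= mulNr addrK.
have z0i i : injective (z0 i).
  by apply: (can_inj (g := z0 (- i))) => -[u v]; rewrite /z0 /= addrK.
pose pa i := perm (a0i i); pose pb i := perm (b0i i); pose pz i := perm (z0i i).
have pD : [/\ forall i j, pa (i + j) = (pa j * pa i)%g,
    forall i j, pb (i + j) = (pb j * pb i)%g & forall i j, pz (i + j) = (pz j * pz i)%g].
  split=> i j; apply/permP => -[u v]; rewrite permM !permE /a0 /b0 /z0 /=.
  - by rewrite -addrA (addrC i).
  - by rewrite mulrDl -addrA (addrC (i * u)).
  - by rewrite -addrA (addrC i).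
have [paD pbD pzD] := pD.
(* q is odd, so that each of these permutations is the square of another one. *)
have two : (2%:R : 'F_q) != 0.
  by rewrite -(dvdn_pcharf (pchar_Fp pq)) gtnNdvd.
have half (i : 'F_q) : i = i / 2%:R + i / 2%:R.
  by rewrite -mulr2n -[RHS]mulr_natr divfK.
have ea i : ~~ odd_perm (pa i) by rewrite (half i) paD odd_permM addbb.
have eb i : ~~ odd_perm (pb i) by rewrite (half i) pbD odd_permM addbb.
have ez i : ~~ odd_perm (pz i) by rewrite (half i) pzD odd_permM addbb.
have [||||y [F [yi yE yV yF]]] := @orbit_family _ _ XC Pmin D (pred1 (0, 0)) x
    (fun=> x) (fun=> pid setT) U set0 _ _ oU.
- by move=> d e; rewrite !inE => /eqP -> /eqP ->.
- by move=> d _; split => //; exact: (pseudo_id PP openT).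
- by exists x.
- exact: finite_set0.
have [||||W [f [Wf Wx fx fV _]]] := @multisection_exists _ _ XC PP D x y F (fun=> U) yi.
- by move=> d; case: (yF d).
- by move=> d; case: (yF d).
- move=> d; apply: open_nbhs_in => //.
  have [dE|dE] := boolP (pred1 (0, 0) d); first by case: (yE d dE) => ->.
  by case: (yV d dE).
- exact: (0, 0).
pose T := msperm PP Wf.
have TM s t : T (s * t)%g = (T t * T s)%g by exact: mspermM.
exists q, (T \o pa), (T \o pb), (T \o pz), (ms_support W f); split.
- by split.
- split; first exact: (ms_support_clopen XC PP Wf).
    by move=> _ [d [w [Ww ->]]]; apply: (fV d); exists w.
  exists (0, 0), x; split => //; rewrite fx.
  by have [-> _] := yE (0, 0) (eqxx _).
- by split=> i; apply: (msperm_alt_on XC).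
- by split=> i j /=; rewrite (paD, pbD, pzD) TM.
- split=> [i j|i j|i j|_ [d [w [Ww ->]]] c c'] /=.
  + rewrite -!TM; congr T; apply/permP => -[u v]; by rewrite !permM !permE.
  + rewrite -!TM; congr T; apply/permP => -[u v].
    by rewrite !permM !permE /b0 /z0 /= addrAC.
  + rewrite -!TM; congr T; apply/permP => -[u v].
    by rewrite !permM !permE /b0 /z0 /a0 /= mulrDr addrA (mulrC j i).
  + rewrite !(msperm_funE PP Wf) // => /(multisection_inj PP Wf Ww Ww)[].
    by rewrite !permE /z0 => /(congr1 snd) /= h _; exact: addrI h.
Qed.

Lemma morph_inv (q : nat) (a : 'F_q -> selfbij X) :
  {morph a : i j / i + j >-> (i * j)%g} -> forall i, a (- i) = (a i)^-1%g.
Proof.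
move=> aD i; have a0 : a 0 = 1%g.
  have := aD 0 0; rewrite addr0 => h.
  by apply: (mulgI (a 0)); rewrite mulg1.
by apply/esym/mulg1_eq; rewrite -aD addrN.
Qed.

(** The product over the corners of the rectangle is z at +-(i - i')(j - j'), a
    nonzero element of a field, of which every element is a multiple. *)
Lemma heisenberg_rectangle (K : set (selfbij X)) q (a b z : 'F_q -> selfbij X)
    (U : set X) (p g : selfbij X) (i i' j j' : 'F_q) :
  subgrp K -> prime q ->
  (forall i, supp_in (a i) U) -> (forall i, supp_in (b i) U) ->
  {morph a : i j / i + j >-> (i * j)%g} -> {morph b : i j / i + j >-> (i * j)%g} ->
  {morph z : i j / i + j >-> (i * j)%g} ->
  (forall i j, (z i * a j = a j * z i)%g) ->
  (forall i j, (b j * a i = z (i * j)%R * a i * b j)%g) ->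
  (forall x, U x -> ~ U (p x)) -> (forall i, (z i * g = g * z i)%g) ->
  i != i' -> j != j' ->
  let k i j := (g^-1 * ((b j)^-1 * (a i)^-1) * p * (a i * b j * g))%g in
  K (k i j) -> K (k i' j) -> K (k i' j') -> K (k i j') -> forall c, K (z c).
Proof.
move=> [K1 KM KV] pq aU bU aD bD zD za ba pU zg ii' jj' k K1_ K2 K3 K4.
have aV := morph_inv aD; have bV := morph_inv bD; have zV := morph_inv zD.
pose e := i' - i.
have pc u (h : selfbij X) : supp_in h U -> commute (p * a u * p^-1)%g h.
  move=> hU; have sc := supp_commute hU (@supp_in_conj _ _ p _ (aU u)).
  apply/esym/sc.
  apply/seteqP; split => // x /= [Ux Upx].
  by case: (pU _ Upx); rewrite selfbijVK.
have kE : (k i j * (k i' j)^-1 * k i' j' * (k i j')^-1 = z (e * (j' - j))%R)%g.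
  rewrite (@rectangle_product _ (a i) (a i') (b j) (b j') g p); last 1 first.
  - by split; rewrite -aV -aD; exact: pc.
  rewrite -!aV -!aD -!bV (addrC (- i)) (addrC (- i')) -/e.
  have -> : i - i' = - e by rewrite opprB.
  have bab m n : (b (- n)%R * a m * b n = z (- (m * n))%R * a m)%g.
    by rewrite ba -mulgA bV mulVg mulg1 mulrN.
  rewrite bab bab mulNr opprK.
  rewrite (_ : z (- (e * j)) * a e * (z (e * j')%R * a (- e)%R) = z (e * (j' - j))%R)%g.
    by rewrite -mulgA zg mulKg.
  by rewrite -mulgA (mulgA (a e)) -za -mulgA aV mulgV mulg1 -zD mulrBr addrC.
have Kz : K (z (e * (j' - j))).
  by rewrite -kE; apply: (KM); [apply: (KM) => //; apply: (KM) => //|]; exact: KV.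
move=> c; set w := e * _ in Kz.
have w0 : w != 0 by rewrite mulf_neq0 // subr_eq0 eq_sym.
rewrite (_ : c = w *+ (c / w)%R); last first.
  rewrite -mulr_natr natr_Zp mulrCA mulfV // mulr1 //.
elim: (nat_of_ord _) => [|n IH]; first by rewrite mulr0n -(addrN 0) zD zV mulgV.
by rewrite mulrS zD; exact: KM.
Qed.

End heisenberg.

(** * Confined subgroups absorb alternating groups *)

Section disjoint_confinement.
Import GRing.Theory.
Variables (X : topologicalType) (P : set (partial_map X)).
Hypothesis XC : cantor_like X.
Hypothesis PP : pseudogroup P.
Hypothesis Pmin : dense_orbits P.

Lemma alt_on_supp_in C g : alt_on P C g -> supp_in g C.
Proof. by move=> gg x; exact: alt_on_supp gg. Qed.

(** Only finitely many conjugators L are needed, and this allows an induction on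
    the number of sets U i.  When a set U i with a Heisenberg group is added,
    either some element c = a^u b^v of it is such that no g in L gives a conjugate
    of p i by c * g in K, and the induction hypothesis applies to c K c^-1, which
    contains the same z j as K; or every c is coloured by such a g, and the prime
    has been chosen large with respect to L. *)
Lemma disjoint_confinement (I : eqType) (is_ : seq I) (p : I -> selfbij X) (U : I -> set X) :
  uniq is_ ->
  {in is_, forall i, [/\ open (U i), U i !=set0 & forall x, U i x -> ~ U i (p i x)]} ->
  {in is_ &, forall i j, i != j -> U i `&` U j = set0} ->
  exists (z : I -> selfbij X) (L : seq (selfbij X)),
  [/\ {in is_, forall i, exists C, [/\ clopen C, C `<=` U i, alt_on P C (z i) & z i <> 1%g]},
     {in L, forall g, alt_on P setT g /\ supp_in g [set x | exists2 i, i \in is_ & U i x]}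
   & forall K, subgrp K ->
      {in L, forall g, exists2 i, i \in is_ & K (g^-1 * p i * g)%g} ->
      exists2 i, i \in is_ & K (z i)].
Proof.
elim: is_ => [|i l IH] /=.
  move=> _ _ _; exists (fun=> 1%g), [:: 1%g]; split => //.
    by move=> g; rewrite inE => /eqP ->; split => //; exact: alt_on_one.
  by move=> K _ /(_ 1%g); rewrite inE eqxx => /(_ isT)[].
move=> /andP[il ul] HU dU.
have l_in j : j \in l -> j \in i :: l by rewrite inE orbC => ->.
have ii : i \in i :: l by rewrite inE eqxx.
have [||z [L [Hz HL HK]]] := IH ul.
- by move=> j jl; apply: HU; exact: l_in.
- by move=> j k jl kl; apply: dU; exact: l_in.
have nji j : j \in l -> j != i by apply: contraTneq => ->.
have [oU [x Ux] pU] := HU i ii.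
set R := size L.
have [q [a [b [h [C [[pq Rq] [cC CU Cx] [ga gb gh] [aD bD hD] [ha hb ba hi]]]]]]] :=
  heisenberg XC PP Pmin (R.+1 * R.+1 * R) oU Ux.
have aU k : supp_in (a k) (U i) by exact: supp_in_sub (alt_on_supp_in (ga k)).
have bU k : supp_in (b k) (U i) by exact: supp_in_sub (alt_on_supp_in (gb k)).
have hU k : supp_in (h k) (U i) by exact: supp_in_sub (alt_on_supp_in (gh k)).
have UL g : g \in L -> forall k : selfbij X, supp_in k (U i) -> (k * g = g * k)%g.
  move=> gL k kU; have [_ gs] := HL g gL; apply: (supp_commute kU gs).
  apply/seteqP; split => // y [Uy [j jl Ujy]].
  have : (U j `&` U i) y by [].
  by rewrite dU //; [exact: l_in|exact: nji].
exists (fun j => if j == i then h 1%R else z j).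
exists [seq (a uv.1 * b uv.2 * g)%g | uv <- enum {: 'F_q * 'F_q}, g <- L].
split.
- move=> j; rewrite inE => /predU1P[->|jl].
    rewrite eqxx; exists C; split => //.
    move=> h1; have := hi x Cx 1%R (1 + 1)%R; rewrite hD h1 mulg1 => /(_ erefl).
    by move=> /eqP; rewrite -subr_eq0 opprD addrA subrr sub0r oppr_eq0 oner_eq0.
  rewrite (negbTE (nji _ jl)); exact: Hz.
- move=> _ /allpairsP[[[u v] g] /= [_ gL ->]]; have [gg gs] := HL g gL.
  split.
    by apply: alt_on_mul => //; apply: alt_on_mul; apply: alt_on_mono (subsetT C) _.
  apply: supp_inM; first apply: supp_inM.
  + by apply: supp_in_sub (aU u) => y Uy; exists i.
  + by apply: supp_in_sub (bU v) => y Uy; exists i.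
  + by apply: supp_in_sub gs => y [j jl Uy]; exists j => //; exact: l_in.
- move=> K sK KL.
  pose k u v g := (g^-1 * ((b v)^-1 * (a u)^-1) * p i * (a u * b v * g))%g.
  have [[u [v Huv]]|Hcol] := pselect (exists u v, forall g, g \in L -> ~ K (k u v g)).
    pose c := (a u * b v)%g.
    have cU : supp_in c (U i) by exact: supp_inM.
    have [|j jl Kj] := HK _ (subgrp_conj c sK).
      move=> g gL; have [|j] := KL (a u * b v * g)%g.
        by apply/allpairsP; exists ((u, v), g); rewrite mem_enum.
      rewrite inE => /predU1P[->|jl] Kj.
        case: (Huv g gL); move: Kj; by rewrite /k !invgM !mulgA.
      exists j => //=; rewrite -/c in Kj.
      by move: Kj; rewrite (UL g gL c cU) invgM !mulgA.
    exists j; first exact: l_in.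
    rewrite (negbTE (nji _ jl)); move: Kj => /=.
    have [D [_ DU gz _]] := Hz j jl.
    have cz : (z j * c = c * z j)%g.
      apply: (supp_commute (alt_on_supp_in gz) cU).
      apply/seteqP; split => // y [/DU Uj Ui].
      have : (U j `&` U i) y by [].
      by rewrite dU //; [exact: l_in|exact: nji].
    by rewrite -mulgA cz mulKg.
  have /choice[col Hc] : forall uv : 'F_q * 'F_q, exists n : 'I_R, K (k uv.1 uv.2 (nth 1%g L n)).
    move=> [u v] /=; apply: contrapT => nH; apply: Hcol; exists u, v => g gL Kg.
    apply: nH; have gi : index g L < R by rewrite index_mem.
    by exists (Ordinal gi) => /=; rewrite nth_index.
  have [|u [u' [v [v' [uu' vv' E1 E2 E3]]]]] :=
     @monochromatic_rectangle 'F_q R (fun u v => col (u, v)).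
    by rewrite card_Fp.
  exists i => //; rewrite eqxx.
  set g := nth 1%g L (col (u, v)).
  have gL : g \in L by exact: mem_nth.
  apply: (@heisenberg_rectangle X K q a b h (U i) (p i) g u u' v v') => //.
  + by move=> c; exact: UL.
  + exact: (Hc (u, v)).
  + by have := Hc (u', v); rewrite /= E2.
  + by have := Hc (u', v'); rewrite /= E3.
  + by have := Hc (u, v'); rewrite /= -E1.
Qed.

End disjoint_confinement.

Section finite_selections.
Variable X : topologicalType.
Hypothesis XC : cantor_like X.

Lemma distinct_points (I : eqType) (s : seq I) (O : I -> set X) (x0 : X) : uniq s ->
  {in s, forall i, open (O i) /\ O i !=set0} ->
  exists x : I -> X, {in s &, injective x} /\ {in s, forall i, O i (x i)}.
Proof.
elim: s => [_ _|i l IH /= /andP[il ul] HO]; first by exists (fun=> x0).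
have l_in j : j \in l -> j \in i :: l by rewrite inE orbC => ->.
have [|x [xi xO]] := IH ul; first by move=> j jl; apply: HO; exact: l_in.
have [oO O0] := HO i (mem_head i l).
have [y [Oy ny]] := open_setD_finite_neq0 XC oO O0 (finite_seq (map x l)).
rewrite /= in ny.
exists (fun j => if j == i then y else x j); split.
  move=> j k; rewrite !inE; have [->|ji] := eqVneq j i; have [->|ki] := eqVneq k i => //=.
  - by move=> _ kl e; case: ny; rewrite e map_f.
  - by move=> jl _ e; case: ny; rewrite -e map_f.
  - exact: xi.
by move=> j; rewrite inE; have [->|ji] := eqVneq j i => //=; exact: xO.
Qed.

Lemma seq_of_bounded_set (Q : set X) n :
  (forall s : seq X, uniq s -> (forall x, x \in s -> Q x) -> size s <= n) ->
  exists s : seq X, [/\ uniq s, size s <= n & forall x, x \in s <-> Q x].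
Proof.
move=> Qn; apply: contrapT => nQ.
suff /(_ n.+1)[s [us sQ sn]] : forall k, exists s : seq X,
    [/\ uniq s, forall x, x \in s -> Q x & size s = k].
  by have := Qn s us sQ; rewrite sn ltnn.
elim=> [|k [s [us sQ sk]]]; first by exists [::].
have [x [Qx xs]] : exists x, Q x /\ x \notin s.
  apply: contrapT => nx; apply: nQ; exists s; split => //; first exact: Qn.
  move=> x; split; first exact: sQ.
  by move=> Qx; apply: contrapT => xs; apply: nx; exists x; split => //; exact/negP.
exists (x :: s); split => /=; [by rewrite xs| |by rewrite sk].
by move=> y; rewrite inE => /predU1P[->|/sQ].
Qed.

(** From a clopen neighbourhood of ys which avoids the preimages of ys under z,
    remove its image under z: the points of ys remain, and what remains is
    disjoint from its image. *)
Lemma displaced_clopen (P : set (partial_map X)) (z : selfbij X) (ys : seq X) (N : set X) :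
  pseudogroup P -> fullperm P z -> {in ys, forall y, nbhs y N} ->
  {in ys &, forall y y', z y <> y'} ->
  exists C, [/\ clopen C, C `<=` N, {in ys, forall y, C y} & forall x, C x -> ~ C (z x)].
Proof.
move=> PP zF yN zy.
have [C1 [cC1 C1N C1y]] : exists C1, [/\ clopen C1, C1 `<=` N `\` [set` map z^-1%g ys]
    & {in ys, forall y, C1 y}].
  have : {in ys, forall y, nbhs y (N `\` [set` map z^-1%g ys])}.
    move=> y yys; apply: filterI; first exact: yN.
    apply: open_nbhs_in.
      by apply: closed_openC; apply: (finite_closed XC); exact: finite_seq.
    by move=> /= /mapP[y' ys' e]; apply: (zy y y' yys ys'); rewrite e selfbijVK.
  elim: ys {yN zy} (N `\` _) => [|y l IH] M HM.
    by exists set0; split => //; exact: clopen0.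
  have [|C [cC CM Cl]] := IH M; first by move=> y' yl; apply: HM; rewrite inE yl orbT.
  have [C' [cC' C'y C'M]] := clopen_basis XC (HM y (mem_head y l)).
  exists (C' `|` C); split; first exact: clopenU.
    by move=> w [/C'M|/CM].
  by move=> w; rewrite inE => /predU1P[->|/Cl]; [left|right].
exists (C1 `\` (z^-1%g @^-1` C1)); split.
- by apply: clopen_setD => //; apply: (fullperm_clopen PP) => //; exact: fullpermV.
- by move=> w [/C1N[]].
- move=> y yys; split; first exact: C1y.
  by move=> /= /C1N[_]; apply; rewrite /= map_f.
- by move=> x [C1x _] [_]; apply; rewrite /= fwdK.
Qed.

End finite_selections.

Section confinement.
Variables (X : topologicalType) (P : set (partial_map X)).
Hypothesis XC : cantor_like X.
Hypothesis PP : pseudogroup P.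
Hypothesis Pmin : dense_orbits P.

Definition absorbed (K : set (selfbij X)) (C : set X) : Prop :=
  clopen C /\ alt_on P C `<=` K.

(** If some c0 over C i violates the conclusion for i, then the hypothesis at the
    products c * c0 shows that the other indices suffice for the remaining
    conjugators c, since c0 commutes with everything over the other U j. *)
Lemma full_fiber (I : eqType) (s : seq I) (z : I -> selfbij X) (C U : I -> set X)
  (K : set (selfbij X)) : uniq s ->
  {in s, forall i, supp_in (z i) (U i) /\ C i `<=` U i} ->
  {in s &, forall i j, i != j -> U i `&` U j = set0} ->
  (forall c, alt_on P setT c -> supp_in c [set x | exists2 i, i \in s & U i x] ->
     exists2 i, i \in s & K (c^-1 * z i * c)%g) ->
  exists2 i, i \in s & forall c, alt_on P (C i) c -> K (c^-1 * z i * c)%g.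
Proof.
elim: s => [_ _ _ /(_ 1%g)|i l IH /= /andP[il ul] zU dU HK].
  by case=> [||i] //; exact: alt_on_one.
have l_in j : j \in l -> j \in i :: l by rewrite inE orbC => ->.
have ii : i \in i :: l by rewrite inE eqxx.
have [Hi|nHi] := pselect (forall c, alt_on P (C i) c -> K (c^-1 * z i * c)%g).
  by exists i.
have [c0 [gc0 nK0]] : exists c, alt_on P (C i) c /\ ~ K (c^-1 * z i * c)%g.
  apply: contrapT => h; apply: nHi => c gc; apply: contrapT => nK; apply: h.
  by exists c.
have c0U : supp_in c0 (U i).
  by have [_ CU] := zU i ii; exact: supp_in_sub (alt_on_supp_in gc0).
have dUi j : j \in l -> U j `&` U i = set0.
  by move=> jl; apply: dU; [exact: l_in|exact: ii|apply: contraTneq jl => ->].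
have [|||j jl Hj] := IH ul.
- by move=> j jl; apply: zU; exact: l_in.
- by move=> j k jl kl; apply: dU; exact: l_in.
- move=> c gc cs; have cc0 : (c * c0 = c0 * c)%g.
    apply: (supp_commute cs c0U); apply/seteqP; split => // y [[j jl Ujy] Uiy].
    by rewrite -(dUi j jl).
  have [||j] := HK (c * c0)%g.
  + by apply: alt_on_mul => //; apply: alt_on_mono gc0.
  + apply: supp_inM; last by apply: supp_in_sub c0U => y Uy; exists i.
    by apply: supp_in_sub cs => y [j jl Uy]; exists j => //; exact: l_in.
  + rewrite inE => /predU1P[->|jl] Kj.
      case: nK0; move: Kj.
      rewrite invgM -!mulgA.
      have -> : (c^-1 * (z i * (c * c0)) = c^-1 * (c * (z i * c0)))%g.
        congr (_ * _)%g; rewrite !mulgA; congr (_ * _)%g; apply/esym.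
        have [ziU _] := zU i ii; apply: (supp_commute cs ziU).
        apply/seteqP; split => // y [[k kl Uky] Uiy].
        by rewrite -(dUi k kl).
      by rewrite mulKg !mulgA.
    exists j => //; move: Kj; rewrite cc0 invgM.
    have -> : (c^-1 * c0^-1 * z j * (c0 * c) = c^-1 * (c0^-1 * (z j * c0)) * c)%g.
      by rewrite !mulgA.
    have [zjU _] := zU j (l_in _ jl).
    by rewrite (supp_commute zjU c0U (dUi j jl)) mulKg.
by exists j => //; exact: l_in.
Qed.

(** The elements h c = c^-1 (z c z^-1) of K have their second factor over z(C),
    away from C.  Comparing h c * h d with h (c * d) cancels it and leaves the
    commutator of c and d. *)
Lemma conj_fiber_absorbed (K : set (selfbij X)) (C : set X) (z : selfbij X) :
  subgrp K -> (forall x, C x -> ~ C (z x)) ->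
  (forall c, alt_on P C c -> K (c^-1 * z * c)%g) -> alt_on P C `<=` K.
Proof.
move=> [K1 KM KV] zC Kz; apply: (alt_on_commutators XC PP Pmin) => // c d gc gd.
pose h c := (c^-1 * (z * c * z^-1))%g.
have Kh c' : alt_on P C c' -> K (h c').
  move=> gc'; rewrite /h !mulgA; apply: KM; first exact: Kz.
  by apply: KV; have := Kz 1%g (alt_on_one _ _); rewrite mulg1 invg1 mul1g.
have zc : commute (z * c * z^-1)%g d^-1%g.
  apply: esym; apply: (supp_commute (supp_inV (alt_on_supp_in gd))
    (@supp_in_conj _ _ z _ (alt_on_supp_in gc))).
  apply/seteqP; split => // x /= [Cx Cx']; apply: (zC _ Cx').
  by rewrite selfbijVK.
rewrite (_ : [~ c, d]%g = h c * h d * (h (c * d))^-1)%g.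
  by apply: (KM); [apply: (KM); exact: Kh|apply: KV; apply: Kh; exact: alt_on_mul].
have -> : (h c * h d = c^-1 * d^-1 * (z * (c * d) * z^-1))%g.
  rewrite /h; set u := (z * c * z^-1)%g in zc *.
  have -> : (z * (c * d) * z^-1 = u * (z * d * z^-1))%g by rewrite /u !mulgA mulgVK.
  by clearbody u; rewrite !mulgA -(mulgA _ u) zc !mulgA.
rewrite /h; set Z := (z * (c * d) * z^-1)%g; clearbody Z.
by rewrite commgEl conjgE !invgM !invgK !mulgA mulgK.
Qed.

(** Minimality provides g in the alternating full group moving each pair x (i, _)
    to two points v (i, _) of the support of z i, chosen such that neither of
    them is moved by z i onto one of them.  The previous lemmas apply to small
    neighbourhoods of the v (i, _) and to the subgroup g K g^-1. *)
Lemma absorbed_pair (I : eqType) (s : seq I) (z : I -> selfbij X) (U : I -> set X) :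
  uniq s ->
  {in s, forall i, exists C, [/\ clopen C, C `<=` U i, alt_on P C (z i) & z i <> 1%g]} ->
  {in s, forall i, open (U i)} ->
  {in s &, forall i j, i != j -> U i `&` U j = set0} ->
  forall K, subgrp K ->
  (forall g, alt_on P setT g -> exists2 i, i \in s & K (g^-1 * z i * g)%g) ->
  forall x : I * bool -> X,
  {in [seq (i, b) | i <- s, b <- [:: true; false]] &, injective x} ->
  exists i C, [/\ i \in s, absorbed K C, C (x (i, true)) & C (x (i, false))].
Proof.
move=> us Hz oU dU K sK HK x xi.
have zs i : i \in s -> supp_in (z i) (U i) /\ fullperm P (z i).
  move=> /Hz[C [_ CU gz _]]; split; last exact: (alt_on_fullperm PP gz).
  exact: supp_in_sub (alt_on_supp_in gz).
have /choice[vF HvF] : forall i, exists vF : (X * partial_map X) * (X * partial_map X),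
    i \in s -> [/\ P vF.1.2 /\ vF.1.2 (x (i, true), vF.1.1),
      P vF.2.2 /\ vF.2.2 (x (i, false), vF.2.1),
      U i vF.1.1 /\ U i vF.2.1, vF.1.1 <> vF.2.1 &
      forall y y', y \in [:: vF.1.1; vF.2.1] -> y' \in [:: vF.1.1; vF.2.1] -> z i y <> y'].
  move=> i; have [is_|] := boolP (i \in s); last first.
    by exists ((x (i, true), set0), (x (i, true), set0)).
  have [zU zF] := zs i is_; have [_ [_ _ _ z1]] := Hz i is_.
  pose O := [set y | z i y <> y].
  have oO : open O.
    by have [_ _ hX _] := XC; apply: moved_points_open => //; exact: fullperm_cont zF.
  have [y0 Oy0] : O !=set0.
    apply: contrapT => nO; apply: z1; apply: selfbijP => y.
    by apply: contrapT => zy; apply: nO; exists y.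
  have OU : O `<=` U i by move=> y zy; apply: contrapT => /zU.
  have [v [F [Ov PF Fv]]] := @Pmin (x (i, true)) O oO (ex_intro _ y0 Oy0).
  have [|v' [F' [Ov' nv' PF' Fv']]] := @orbit_avoid _ _ XC Pmin (x (i, false)) O
    [set` [:: v; z i v; (z i)^-1%g v]] oO (ex_intro _ y0 Oy0); first exact: finite_seq.
  exists ((v, F), (v', F')) => _ /=; split => //.
  - by split; exact: OU.
  - by move=> vv'; apply: nv'; rewrite /= vv' inE eqxx.
  - move=> y y'; rewrite !inE => /orP[] /eqP -> /orP[] /eqP -> //.
    + by move=> e; apply: nv'; rewrite /= -e !inE eqxx orbT.
    + by move=> e; apply: nv'; rewrite /= -e fwdK !inE eqxx !orbT.
pose v (ib : I * bool) := if ib.2 then (vF ib.1).1.1 else (vF ib.1).2.1.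
pose F (ib : I * bool) := if ib.2 then (vF ib.1).1.2 else (vF ib.1).2.2.
pose js := [seq (i, b) | i <- s, b <- [:: true; false]].
have js_in i b : ((i, b) \in js) = (i \in s).
  apply/allpairsP/idP => [[[i' b'] /= [is_ _ [-> _]]]//|is_].
  by exists (i, b); case: b.
have [||||C0 [g [_ _ gg gF]]] := @realize _ _ XC PP Pmin (I * bool)%type js x v F setT openT.
- by apply: allpairs_uniq => // -[i b] [j c] _ _ [-> ->].
- exact: xi.
- move=> [i b] [j c]; rewrite !js_in => is_ js_ E.
  have Uv k d : k \in s -> U k (v (k, d)).
    by move=> ks; have [_ _ [h1 h2] _ _] := HvF k ks; case: d.
  have ij : i = j.
    apply: contrapT => /eqP nij; have : (U i `&` U j) (v (i, b)).
      by split; [exact: Uv|rewrite E; exact: Uv].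
    by rewrite dU.
  move: E; rewrite -ij /v /=; have [_ _ _ nv _] := HvF i is_.
  by case: b; case: c => // e; case: nv.
- move=> [i b]; rewrite js_in => is_; have [[P1 F1] [P2 F2] _ _ _] := HvF i is_.
  by rewrite /F /v /=; case: b.
have gx i b : i \in s -> g (x (i, b)) = v (i, b).
  move=> is_; have ibs : (i, b) \in js by rewrite js_in.
  have [[P1 F1] [P2 F2] _ _ _] := HvF i is_.
  have h := gF _ ibs; move: h; rewrite /F /v /=.
  by case: (b) => h; apply: (near_FG_val PP _ _ h).
pose K' := [set k | K (g^-1 * k * g)%g].
have sK' : subgrp K' by exact: subgrp_conj.
have gT : alt_on P setT g by apply: alt_on_mono gg.
have /choice[C HC] : forall i, exists C, i \in s -> [/\ clopen C, C `<=` U i,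
    C (v (i, true)) /\ C (v (i, false)) & forall x, C x -> ~ C (z i x)].
  move=> i; have [is_|] := boolP (i \in s); last by exists set0.
  have [_ _ [U1 U2] _ zv] := HvF i is_; have [_ zF] := zs i is_.
  have [||C [cC CU Cy Cz]] := @displaced_clopen _ XC P (z i)
      [:: (vF i).1.1; (vF i).2.1] (U i) PP zF.
  - by move=> y; rewrite !inE => /orP[] /eqP ->; apply: open_nbhs_in => //; exact: oU.
  - by move=> y y' yi yi'; exact: zv.
  exists C => _; split => //.
  by split; apply: Cy; rewrite !inE eqxx // orbT.
have [|||i is_ Hi] := @full_fiber I s z C U K' us.
- by move=> i is_; split; [case: (zs i is_)|case: (HC i is_)].
- exact: dU.
- move=> c gc _; have [|i is_ Ki] := HK (c * g)%g; first exact: alt_on_mul.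
  by exists i => //; rewrite /K' /=; move: Ki; rewrite invgM !mulgA.
have [cC CU [C1 C2] Cz] := HC i is_.
have CK := conj_fiber_absorbed sK' Cz Hi.
exists i, (g @^-1` C i); split => //.
- split; first by apply: (fullperm_clopen PP) => //; exact: (alt_on_fullperm PP gT).
  move=> k gk; have := alt_on_conj PP (alt_on_fullperm PP gT) gk.
  rewrite (_ : g^-1%g @^-1` (g @^-1` C i) = C i); last first.
    by apply/seteqP; split => y /=; rewrite selfbijVK.
  by move=> /CK; rewrite /K' /= !mulgA mulVg mul1g mulgVK.
- by rewrite /= gx.
- by rewrite /= gx.
Qed.

End confinement.

(** * Elements trivial near a finite set *)

Section germ_stabilizers.
Variables (X : topologicalType) (P : set (partial_map X)).
Hypothesis XC : cantor_like X.
Hypothesis PP : pseudogroup P.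
Hypothesis Pmin : dense_orbits P.

(** The alternating group over the complement of the finite set s, as the union
    of the alternating groups over clopen sets avoiding s. *)
Definition alt_off (s : seq X) (g : selfbij X) : Prop :=
  exists C, [/\ clopen C, forall x, x \in s -> ~ C x & alt_on P C g].

Lemma alt_off_one s : alt_off s 1%g.
Proof. by exists set0; split; [exact: clopen0|move=> x _ []|exact: alt_on_one]. Qed.

Lemma alt_off_mul s g h : alt_off s g -> alt_off s h -> alt_off s (g * h)%g.
Proof.
move=> [C [cC sC gg]] [D [cD sD gh]]; exists (C `|` D); split.
- exact: clopenU.
- by move=> x xs []; [exact: sC|exact: sD].
- by apply: alt_on_mul; [apply: alt_on_mono gg|apply: alt_on_mono gh] => x; [left|right].
Qed.

Lemma alt_off_inv s g : alt_off s g -> alt_off s g^-1%g.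
Proof. by move=> [C [cC sC gg]]; exists C; split => //; exact: alt_on_inv. Qed.

Lemma alt_off_conj s g h : fullperm P h -> alt_off (map h s) g ->
  alt_off s (h^-1 * g * h)%g.
Proof.
move=> hF [C [cC sC gg]]; exists (h @^-1` C); split.
- exact: (fullperm_clopen PP).
- by move=> x xs; apply: sC; exact: map_f.
- have := alt_on_conj PP (fullpermV PP hF) gg; rewrite invgK.
  by apply: alt_on_mono.
Qed.

Lemma alt_off_sub s s' g : {subset s <= s'} -> alt_off s' g -> alt_off s g.
Proof. by move=> ss [C [cC sC gg]]; exists C; split => // x /ss; exact: sC. Qed.

Lemma alt_off_fullperm s g : alt_off s g -> fullperm P g.
Proof. by move=> [C [_ _ gg]]; exact: (alt_on_fullperm PP gg). Qed.

(** Equality of germs at the points of s. *)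
Definition agree (s : seq X) (g h : X -> X) : Prop :=
  {in s, forall x, \forall z \near x, g z = h z}.

Lemma agree_pt s g h x : agree s g h -> x \in s -> g x = h x.
Proof. by move=> gh /gh /nbhs_singleton. Qed.

Lemma agree_sym s g h : agree s g h -> agree s h g.
Proof. by move=> gh x /gh; apply: filterS => z ->. Qed.

Lemma agree_trans s g h k : agree s g h -> agree s h k -> agree s g k.
Proof. by move=> gh hk x xs; apply: filterS2 (gh x xs) (hk x xs) => z -> ->. Qed.

Lemma agree_comp s (g g' h h' : selfbij X) : fullperm P h -> agree s h h' ->
  agree (map h s) g g' -> agree s (g * h)%g (g' * h')%g.
Proof.
move=> hF hh gg x xs; have := fullperm_nbhs PP hF (gg (h x) (map_f h xs)).
by apply: filterS2 (hh x xs) => z hz; rewrite /= -hz.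
Qed.

Lemma realize_agree (s o : seq X) (g : selfbij X) : uniq s -> fullperm P g ->
  (forall x, x \in s -> x \notin o /\ g x \notin o) ->
  exists2 k, alt_off o k & agree s k g.
Proof.
move=> us gF so.
have oV : open (~` [set` o]).
  by apply: closed_openC; apply: (finite_closed XC); exact: finite_seq.
have [|||C [k [cC Co gk kF]]] := realize XC PP Pmin (a := id) (b := g)
  (F := fun=> graph g) oV us.
- by move=> x y _ _.
- by move=> x y _ _; exact: selfbij_inj.
- by move=> x xs; have [h1 h2] := so x xs; split => //; apply/negP.
exists k; first by exists C; split => // x xo /Co.
by move=> x xs; apply: filterS (kF x xs) => z; exact.
Qed.

Lemma avoid_seq (s : seq X) (x0 : X) : exists o, o \notin s.
Proof.
have [|o [_ so]] := open_setD_finite_neq0 XC (@openT X) _ (finite_seq s).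
  by exists x0.
by exists o; apply/negP.
Qed.

(** Some t in the alternating full group, supported where k is trivial, moves s
    into a neighbourhood of o avoided by the generators of k.  It commutes with
    k, so that k = t^-1 k t, whose generators avoid s since those of k avoid
    t(s). *)
Lemma alt_off_transfer (s : seq X) (o : X) k : uniq s -> o \notin s ->
  alt_off [:: o] k -> agree s k id -> alt_off s k.
Proof.
move=> us os [C [cC oC gk]] ks.
have oNC : open (~` C) by case: (clopenC set0 cC).
have Co : (~` C) o by apply: oC; rewrite inE.
pose V := (~` C) `|` interior [set z | k z = z].
have oV : open V by apply: openU => //; exact: open_interior.
have kV x : V x -> k x = x.
  by move=> [|/interior_subset//]; exact: alt_on_supp gk.
have sV x : x \in s -> V x by move=> xs; right; exact: ks.
have /choice[r Hr] : forall l, exists rF : (X -> X) * (X -> partial_map X), uniq l ->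
    [/\ {in l &, injective rF.1}, {in l, forall x, ~ C (rF.1 x)} &
    {in l, forall x, P (rF.2 x) /\ rF.2 x (x, rF.1 x)}].
  elim=> [|x l [[r F] Hl]]; first by exists (id, fun=> set0).
  have [y [G [Cy ny PG Gy]]] := @orbit_avoid _ _ XC Pmin x (~` C) [set` map r l]
    oNC (ex_intro _ o Co) (finite_seq _).
  exists ((fun z => if z == x then y else r z), (fun z => if z == x then G else F z)).
  move=> /= /andP[xl /Hl[/= ri rC rF]]; split.
  - move=> z w; rewrite !inE; have [->|zx] := eqVneq z x; have [->|wx] := eqVneq w x => //=.
    + by move=> _ wl e; case: ny; rewrite /= e map_f.
    + by move=> zl _ e; case: ny; rewrite /= -e map_f.
    + exact: ri.
  - by move=> z; rewrite inE; have [//|zx] := eqVneq z x; exact: rC.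
  - by move=> z; rewrite inE; have [->//|zx] := eqVneq z x; exact: rF.
have [ri rC rF] := Hr s us.
have [|||D [t [cD DV gt tF]]] := realize XC PP Pmin (a := id) (b := (r s).1)
  (F := (r s).2) oV us.
- by move=> x y _ _.
- exact: ri.
- move=> x xs; have [PF Fx] := rF x xs; split => //; first exact: sV.
  by left; exact: rC.
have tr x : x \in s -> t x = (r s).1 x.
  by move=> xs; have [PF Fx] := rF x xs; exact: (near_FG_val PP PF Fx (tF x xs)).
have tk : (t * k = k * t)%g.
  apply: selfbijP => x; rewrite !selfbijME.
  have [Vx|Vx] := pselect (D x).
    rewrite (kV x) ?(kV (t x)) //; [apply/DV|exact/DV].
    exact: (supp_in_stable (alt_on_supp_in gt)).
  rewrite (alt_on_supp gt Vx) (alt_on_supp gt) // => Dk.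
  have kx := selfbij_inj (kV _ (DV _ Dk)).
  by apply: Vx; rewrite -kx.
have -> : k = (t^-1 * k * t)%g by rewrite -mulgA -tk mulKg.
apply: alt_off_conj; first exact: (alt_on_fullperm PP gt).
exists C; split => // _ /mapP[x xs ->]; rewrite tr //; exact: rC.
Qed.

(** Up to an element of alt_off s, the element g is the standard lift of its own
    germ along s, which is a product of 3-cycles missing some point o. *)
Definition tame (s : seq X) (g : selfbij X) : Prop :=
  exists o k, [/\ o \notin s, o \notin map g s, alt_off [:: o] k, agree s k g
    & alt_off s (k^-1 * g)%g].

(** The choice of o is immaterial: two lifts of the same germ, one missing o and
    one missing b, can be compared with a third one which misses both. *)
Lemma tame_any s g o : uniq s -> fullperm P g -> o \notin s -> o \notin map g s -> tame s g ->
  exists k, [/\ alt_off [:: o] k, agree s k g & alt_off s (k^-1 * g)%g].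
Proof.
move=> us gF os ogs [b [k' [bs bgs gk' kg' gkg']]].
have [|k gk kg] := @realize_agree s [:: o; b] g us gF.
  move=> x xs; rewrite !inE; split.
    by apply/norP; split; apply: contraTneq xs => ->.
  by apply/norP; split; [apply: contraNneq ogs => <-|apply: contraNneq bgs => <-]; exact: map_f.
have gko : alt_off [:: o] k.
  by apply: alt_off_sub gk => x; rewrite !inE => ->.
have gkb : alt_off [:: b] k.
  by apply: alt_off_sub gk => x; rewrite !inE => ->; rewrite orbT.
exists k; split => //.
rewrite (_ : k^-1 * g = (k^-1 * k') * (k'^-1 * g))%g; last by rewrite mulgA mulgK.
apply: alt_off_mul => //; apply: alt_off_transfer us bs _ _.
  by apply: alt_off_mul => //; exact: alt_off_inv.
have kk' : agree s k' k by exact: agree_trans (agree_sym kg).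
by move=> x xs; have := kk' x xs; apply: filterS => z /= ->; rewrite fwdK.
Qed.

Lemma tame_mul (x0 : X) g h : fullperm P g -> fullperm P h ->
  (forall s, uniq s -> tame s g) -> (forall s, uniq s -> tame s h) ->
  forall s, uniq s -> tame s (g * h)%g.
Proof.
move=> gF hF ng nh s us.
have [ o] := avoid_seq (s ++ map h s ++ map (g * h)%g s) x0.
rewrite !mem_cat !negb_or => /and3P[os ohs oghs].
have uhs : uniq (map h s) by rewrite map_inj_uniq //; exact: selfbij_inj.
have [k1 [gk1 kh1 kk1]] := tame_any us hF os ohs (nh s us).
have [|k2 [gk2 kg2 kk2]] := tame_any uhs gF ohs _ (ng _ uhs).
  by rewrite -map_comp.
have kE : map k1 s = map h s by apply/eq_in_map => x xs; exact: agree_pt kh1 xs.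
exists o, (k2 * k1)%g; split => //.
- exact: alt_off_mul.
- by apply: agree_comp => //; [exact: alt_off_fullperm gk1|rewrite kE].
- rewrite (_ : (_ * _)%g = (k1^-1 * (k2^-1 * g) * k1) * (k1^-1 * h))%g; last first.
    by rewrite invgM !mulgA mulgK.
  apply: alt_off_mul => //; apply: alt_off_conj; last by rewrite kE.
  exact: alt_off_fullperm gk1.
Qed.

(** A 3-cycle whose support is not everything is its own standard lift, and all
    3-cycles are products of such. *)
Lemma tame_alt_on (x0 : X) g : alt_on P setT g -> forall s, uniq s -> tame s g.
Proof.
move=> gg; suff [] : fullperm P g /\ forall s, uniq s -> tame s g by [].
have K1 : fullperm P 1%g /\ forall s, uniq s -> tame s 1%g.
  split; first exact: fullperm1.
  move=> s us; have [ o os] := avoid_seq s x0.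
  exists o, 1%g; split => //.
  - by rewrite (eq_map (_ : _ =1 id)) ?map_id.
  - exact: alt_off_one.
  - by move=> x _; exact: nearW.
  - by rewrite mulVg; exact: alt_off_one.
have KM g' h : (fullperm P g' /\ forall s, uniq s -> tame s g') ->
    (fullperm P h /\ forall s, uniq s -> tame s h) ->
    (fullperm P (g' * h)%g /\ forall s, uniq s -> tame s (g' * h)%g).
  by move=> [gF ng] [hF nh]; split; [exact: fullpermM|exact: tame_mul].
elim: gg => // {g} [g h _ Hg _ Hh|U c cs _]; first exact: KM.
apply: (@cyc3_ind _ _ XC PP (fun g => fullperm P g /\ forall s, uniq s -> tame s g) _ _ cs K1 KM).
move=> x Ux; have [cF _ dU c3 _] := cs.
have [y] := avoid_seq [:: x; c x; c (c x)] x0.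
rewrite !inE !negb_or => /and3P[/eqP yx /eqP yc /eqP ycc].
exists (~` [set` [:: y; c y; c (c y)]]).
  apply: open_nbhs_in.
    by apply: closed_openC; apply: (finite_closed XC); exact: finite_seq.
  rewrite /= !inE => /or3P[] /eqP xE; first exact: yx.
  - by apply: ycc; rewrite xE c3.
  - by apply: yc; rewrite xE c3.
move=> W c' cW WU WN cs' ps' oE; split; first by case: cs'.
move=> s us; have cO := cyc3_orb_clopen PP cs'.
have oO : open (~` orb3 W c') by case: (clopenC set0 cO).
have Oy : (~` orb3 W c') y.
  by rewrite /= oE => -[] /WN; rewrite /= !inE eqxx ?orbT.
have [ o [Oo no]] := open_setD_finite_neq0 XC oO (ex_intro _ y Oy)
   (finite_seq (s ++ map c' s)).
move: no => /= /negP; rewrite mem_cat negb_or => /andP[os ocs].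
exists o, c'; split => //.
- exists (orb3 W c'); split => //; first by move=> w; rewrite inE => /eqP ->.
  exact: alt_on_cyc cs' _.
- by move=> w _; exact: nearW.
- by rewrite mulVg; exact: alt_off_one.
Qed.

Lemma alt_off_of_agree (x0 : X) (s : seq X) g : uniq s -> alt_on P setT g ->
  agree s g id -> alt_off s g.
Proof.
move=> us gg gs; have [ o [k [os _ gk kg kgs]]] := tame_alt_on x0 gg us.
rewrite -[g](mulKVg k); apply: alt_off_mul => //.
by apply: alt_off_transfer us os gk _; exact: agree_trans gs.
Qed.

End germ_stabilizers.

(** * Confined subgroups of the alternating full group *)

Section confined.
Variables (X : topologicalType) (P : set (partial_map X)).
Hypothesis XC : cantor_like X.
Hypothesis PP : pseudogroup P.
Hypothesis Pmin : dense_orbits P.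

(** The points without a neighbourhood over which the alternating group lies in
    K: for K a confined subgroup, the finite set Q attached to it. *)
Definition exceptional (K : set (selfbij X)) : set X :=
  [set x | ~ exists C, absorbed P K C /\ C x].

Lemma nontrivial_moves (g : selfbij X) : fullperm P g -> g <> 1%g ->
  open [set x | g x <> x] /\ [set x | g x <> x] !=set0.
Proof.
move=> gF g1; split; last first.
  apply: contrapT => nx; apply: g1; apply: selfbijP => x.
  by apply: contrapT => gx; apply: nx; exists x.
by have [_ _ hX _] := XC; apply: moved_points_open => //; exact: fullperm_cont gF.
Qed.

Lemma absorbed_sub K C D : absorbed P K C -> clopen D -> D `<=` C -> absorbed P K D.
Proof. by move=> [cC CK] cD DC; split => // g /(alt_on_mono DC)/CK. Qed.

Section pairing.
Variables (I : eqType) (s : seq I) (K : set (selfbij X)).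
Hypothesis us : uniq s.
Hypothesis sK : subgrp K.
Let js := [seq (i, b) | i <- s, b <- [:: true; false]].
Hypothesis Hpairs : forall x : I * bool -> X, {in js &, injective x} ->
  exists i C, [/\ i \in s, absorbed P K C, C (x (i, true)) & C (x (i, false))].

Let ujs : uniq js.
Proof. by apply: allpairs_uniq => // -[i b] [j c] _ _ [-> ->]. Qed.

Let js_in i b : ((i, b) \in js) = (i \in s).
Proof.
apply/allpairsP/idP => [[[i' b'] /= [is_ _ [-> _]]]//|is_].
by exists (i, b); case: b.
Qed.

(** C and D contain enough points to form disjoint pairs with one member in each;
    the absorbed set provided for one of these pairs links C and D. *)
Lemma absorbed_setU C D : absorbed P K C -> absorbed P K D -> absorbed P K (C `|` D).
Proof.
move=> gC gD; have [cC CK] := gC; have [cD DK] := gD; have [K1 KM KV] := sK.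
have [->|/set0P[x0 Cx0]] := eqVneq C set0; first by rewrite set0U.
have [->|/set0P[y0 Dy0]] := eqVneq D set0; first by rewrite setU0.
have [|x [xi xO]] := @distinct_points X XC _ js (fun ib => if ib.2 then C else D) x0 ujs.
  by move=> [i [|]] _ /=; [case: cC|case: cD]; split => //; [exists x0|exists y0].
have [i [E [is_ [cE EK] E1 E2]]] := Hpairs xi.
have Ct : C (x (i, true)) by apply: (xO (i, true)); rewrite js_in.
have Df : D (x (i, false)) by apply: (xO (i, false)); rewrite js_in.
have CEK : alt_on P (C `|` E) `<=` K.
  by apply: (alt_on_glue XC PP Pmin K1 KM KV) => //; exists (x (i, true)).
split; first exact: clopenU.
move=> g gg; have : alt_on P (C `|` E `|` D) g.
  by apply: alt_on_mono gg => y [|]; [left; left|right].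
move: g {gg}; apply: (alt_on_glue XC PP Pmin K1 KM KV) => //; first exact: clopenU.
by exists (x (i, false)); split => //; right.
Qed.

Lemma absorbed_off_exceptional C : clopen C -> C `&` exceptional K = set0 -> absorbed P K C.
Proof.
move=> cC CQ; have [K1 KM KV] := sK.
suff [D [gD CD]] : exists D, absorbed P K D /\ C `<=` D by exact: absorbed_sub gD cC CD.
apply: (@compact_ind _ C (fun B => exists D, absorbed P K D /\ B `<=` D)).
- exact: (compact_clopen XC).
- exists set0; split => //; split; first exact: clopen0.
  move=> g /alt_on_supp_in g0; rewrite (_ : g = 1%g) //.
  by apply: selfbijP => x; exact: g0.
- move=> A B [D [gD AD]] [E [gE BE]]; exists (D `|` E); split; first exact: absorbed_setU.
  exact: setUSS.
- by move=> A B AB [D [gD BD]]; exists D; split => //; exact: subset_trans BD.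
- move=> x Cx; have [D [gD Dx]] : exists D, absorbed P K D /\ D x.
    by apply: contrapT => h; have : (C `&` exceptional K) x by []; rewrite CQ.
  exists D; last by exists D; split.
  by apply: open_nbhs_in => //; case: gD => -[].
Qed.

(** Too many exceptional points could be grouped into pairs, one of which would
    lie in an absorbed set. *)
Lemma exceptional_bounded (t : seq X) : uniq t -> (forall x, x \in t -> exceptional K x) ->
  size t <= size js.
Proof.
move=> ut tQ; rewrite leqNgt; apply/negP => st.
have x0 : X by case: t st {ut tQ}.
pose x ib := nth x0 t (index ib js).
have xt ib : ib \in js -> index ib js < size t.
  by move=> ibj; apply: ltn_trans st; rewrite index_mem.
have [|i [C [is_ gC Cx _]]] := Hpairs (x := x).
  move=> p q pj qj /eqP; rewrite nth_uniq ?xt // => /eqP E.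
  by rewrite -(nth_index p pj) E (nth_index p qj).
apply: (tQ (x (i, true))); last by exists C.
by apply: mem_nth; apply: xt; rewrite js_in.
Qed.

End pairing.

(** The bound r depends on L only; the finite set s depends on K. *)
Theorem confined_subgroups (x0 : X) (L : seq (selfbij X)) :
  (forall p, p \in L -> alt_on P setT p /\ p <> 1%g) ->
  exists r, forall K, subgrp K ->
  (forall g, alt_on P setT g -> exists2 p, p \in L & K (g^-1 * p * g)%g) ->
  exists s : seq X, [/\ uniq s, size s <= r, forall x, x \in s <-> exceptional K x
    & forall g, alt_on P setT g -> agree s g id -> K g].
Proof.
move=> HL; pose l := undup L; have ul : uniq l by exact: undup_uniq.
have lL p : p \in l -> alt_on P setT p /\ p <> 1%g by rewrite mem_undup; exact: HL.
have [|x [xi xp]] := @distinct_points X XC _ l (fun p : selfbij X => [set x | p x <> x]) x0 ul.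
  by move=> p pl; have [gp p1] := lL p pl; exact: nontrivial_moves (alt_on_fullperm PP gp) p1.
have [N [Nx dN]] := finite_separation XC ul xi.
have /choice[U HU] : forall p, exists U, p \in l ->
    [/\ clopen U, U `<=` N p, U (x p) & forall y, U y -> ~ U (p y)].
  move=> p; have [pl|] := boolP (p \in l); last by exists set0.
  have [gp p1] := lL p pl.
  have [||U [cU UN Ux Up]] := @displaced_clopen X XC P p [:: x p] (N p) PP (alt_on_fullperm PP gp).
  - by move=> y; rewrite inE => /eqP ->; exact: Nx.
  - by move=> y y'; rewrite !inE => /eqP -> /eqP ->; exact: xp.
  by exists U => _; split => //; apply: Ux; rewrite inE.
have dU : {in l &, forall p q, p != q -> U p `&` U q = set0}.
  move=> p q pl ql pq; have [_ pN _ _] := HU p pl; have [_ qN _ _] := HU q ql.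
  apply/seteqP; split => // y [/pN h1 /qN h2].
  by rewrite -(dN p q pl ql pq).
have [||z [M [Hz HM HK]]] := @disjoint_confinement X P XC PP Pmin _ l id U ul.
- by move=> p pl; have [[oU _] _ Ux Up] := HU p pl; split => //; exists (x p).
- exact: dU.
exists (size [seq (i, b) | i <- l, b <- [:: true; false]]) => K sK KL.
have Kz g : alt_on P setT g -> exists2 i, i \in l & K (g^-1 * z i * g)%g.
  move=> gg; apply: (HK [set k | K (g^-1 * k * g)%g]); first exact: subgrp_conj.
  move=> m mM; have [gm _] := HM m mM.
  have [|p pL Kp] := KL (m * g)%g; first exact: alt_on_mul.
  exists p; first by rewrite mem_undup.
  by move: Kp; rewrite /= invgM !mulgA.
have oU : {in l, forall p, open (U p)} by move=> p pl; have [[]] := HU p pl.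
have Hp := @absorbed_pair X P XC PP Pmin _ l z U ul Hz oU dU K sK Kz.
have [s [us ss sQ]] := seq_of_bounded_set (exceptional_bounded Hp).
exists s; split => // g gg gs.
have [C [cC sC gC]] := alt_off_of_agree XC PP Pmin x0 us gg gs.
have [|_] := absorbed_off_exceptional ul sK Hp cC; last exact.
apply/seteqP; split => // y [Cy /sQ ys]; exact: sC ys Cy.
Qed.

End confined.

(** * The finite sets attached to the points of Y *)

Section support_map.
Variables (X Y : topologicalType) (P : set (partial_map X)) (x0 : X).
Hypothesis XC : cantor_like X.
Hypothesis PP : pseudogroup P.
Hypothesis Pmin : dense_orbits P.
Hypothesis Yhaus : hausdorff_space Y.
Hypothesis Ycompact : compact [set: Y].
Local Notation A := (alt_on P [set: X]).
Variable alpha : selfbij X -> selfbij Y.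
Hypothesis alphaM : forall g h, A g -> A h -> alpha (g * h)%g = (alpha g * alpha h)%g.
Hypothesis alpha_cont : forall g, A g -> continuous (alpha g).

Lemma move_off (s : seq X) x (V : set X) : open V -> V x ->
  exists C g, [/\ clopen C, C `<=` V, alt_on P C g & g x \notin s].
Proof.
move=> oV Vx; have [w [F [Vw ns PF Fxw]]] :=
  @orbit_avoid _ _ XC Pmin x V [set` x :: s] oV (ex_intro _ x Vx) (finite_seq _).
have xw : x <> w by move=> e; apply: ns; rewrite /= e mem_head.
have [C [g [cC CV gg gF]]] := realize1 XC PP Pmin oV Vx Vw PF Fxw xw.
exists C, g; split => //; rewrite (near_FG_val PP PF Fxw gF).
by apply/negP => ws; apply: ns; rewrite /= inE ws orbT.
Qed.

(** A point of t outside s could be moved out of t by an element trivial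
    near s. *)
Lemma fixed_sub (s t : seq X) :
  (forall g, A g -> agree s g id -> forall x, x \in t -> g x \in t) ->
  {subset t <= s}.
Proof.
move=> H x xt; apply: contrapT => /negP xs.
have oV : open (~` [set` s]).
  by apply: closed_openC; apply: (finite_closed XC); exact: finite_seq.
have [C [g [cC CV gg gx]]] := @move_off t x _ oV (negP xs).
have ag : agree s g id.
  by move=> y ys; apply: alt_on_fix_near cC gg _ => /CV; exact.
by have := H g (alt_on_mono (@subsetT _ C) gg) ag x xt; rewrite (negbTE gx).
Qed.

Let A1 : A 1%g. Proof. exact: alt_on_one. Qed.
Let AM g h : A g -> A h -> A (g * h)%g. Proof. exact: alt_on_mul. Qed.
Let AV g : A g -> A g^-1%g. Proof. exact: alt_on_inv. Qed.

Lemma alpha1 : alpha 1%g = 1%g.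
Proof.
have := alphaM A1 A1; rewrite mulg1 => h.
by apply: (mulgI (alpha 1%g)); rewrite mulg1.
Qed.

Lemma alphaV g : A g -> alpha g^-1%g = (alpha g)^-1%g.
Proof.
move=> Ag; apply/esym/mulg1_eq; rewrite -alphaM ?mulgV ?alpha1 //; exact: AV.
Qed.

Definition germ_stabilizer (y : Y) : set (selfbij X) :=
  [set g | A g /\ \forall y' \near y, alpha g y' = y'].

Definition action_support : set Y :=
  closure [set y | exists2 g, A g & alpha g y <> y].

Lemma alpha_nbhs g y N : A g -> nbhs (alpha g y) N -> nbhs y (alpha g @^-1` N).
Proof. by move=> Ag; exact: alpha_cont. Qed.

Lemma germ_stabilizer_subgrp y : subgrp (germ_stabilizer y).
Proof.
split.
- by split => //; apply: nearW => y'; rewrite alpha1.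
- move=> g h [Ag Hg] [Ah Hh]; split; first exact: AM.
  by apply: filterS2 Hg Hh => y' e1 e2; rewrite alphaM // selfbijME e2 e1.
- move=> g [Ag Hg]; split; first exact: AV.
  by apply: filterS Hg => y' e; rewrite alphaV // -{1}e selfbijK.
Qed.

Lemma germ_stabilizer_conj y g k : A g ->
  germ_stabilizer y k -> germ_stabilizer (alpha g y) (g * k * g^-1)%g.
Proof.
move=> Ag [Ak Hk]; split; first by apply: AM; [exact: AM|exact: AV].
have := Hk; rewrite -{1}(selfbijK (alpha g) y) -alphaV // => H.
have := alpha_nbhs (AV Ag) H; apply: filterS => y' /= e.
rewrite alphaM ?alphaM //; [|exact: AM|exact: AV].
by rewrite !selfbijME e alphaV // selfbijVK.
Qed.

Lemma action_support_alpha g y : A g -> action_support y -> action_support (alpha g y).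
Proof.
move=> Ag Zy N Nn; have [y' [[k Ak ky] Ny']] := Zy _ (alpha_nbhs Ag Nn).
exists (alpha g y'); split => //; exists (g * k * g^-1)%g.
  by apply: AM; [exact: AM|exact: AV].
rewrite alphaM ?alphaM //; [|exact: AM|exact: AV].
rewrite !selfbijME alphaV // selfbijK => h; exact: ky (selfbij_inj h).
Qed.

Lemma germ_stabilizer_near y g : germ_stabilizer y g ->
  \forall y' \near y, germ_stabilizer y' g.
Proof. by move=> [Ag /nbhs_interior Hg]; apply: filterS Hg => y' ?; split. Qed.

Hypothesis germ_nontrivial : forall y, action_support y ->
  exists2 g, germ_stabilizer y g & g <> 1%g.

Lemma finite_witnesses : exists L : seq (selfbij X),
  (forall p, p \in L -> A p /\ p <> 1%g) /\
  forall y, action_support y -> exists2 p, p \in L & germ_stabilizer y p.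
Proof.
pose p (B : set Y) := exists L : seq (selfbij X),
  (forall p, p \in L -> A p /\ p <> 1%g) /\
  forall y, B y -> exists2 p, p \in L & germ_stabilizer y p.
suff : p action_support by [].
apply: compact_ind.
- by apply: subclosed_compact Ycompact _ => //; exact: closed_closure.
- by exists [::]; split.
- move=> B C [L [HL BL]] [M [HM CM]]; exists (L ++ M); split.
    by move=> q; rewrite mem_cat => /orP[/HL|/HM].
  move=> y [/BL|/CM] [q qL Hq]; exists q => //; rewrite mem_cat qL ?orbT //.
- by move=> B C BC [L [HL CL]]; exists L; split => // y /BC/CL.
- move=> y /germ_nontrivial[g gy g1].
  exists [set y' | germ_stabilizer y' g]; first exact: germ_stabilizer_near.
  exists [:: g]; split.
    by move=> q; rewrite inE => /eqP ->; split => //; case: gy.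
  by move=> y' Hy'; exists g => //; rewrite inE.
Qed.

Lemma exceptional_sets : exists r (qs : Y -> seq X), forall y, action_support y ->
  [/\ uniq (qs y), size (qs y) <= r,
    forall x, x \in qs y <-> exceptional P (germ_stabilizer y) x
  & forall g, A g -> agree (qs y) g id -> germ_stabilizer y g].
Proof.
have [L [HL LZ]] := finite_witnesses.
have [r Hr] := confined_subgroups XC PP Pmin x0 HL.
have /choice[qs Hq] : forall y, exists s : seq X, action_support y ->
  [/\ uniq s, size s <= r,
    forall x, x \in s <-> exceptional P (germ_stabilizer y) x
  & forall g, A g -> agree s g id -> germ_stabilizer y g].
  move=> y; have [Zy|nZy] := pselect (action_support y); last by exists [::].
  have [|s Hs] := Hr _ (germ_stabilizer_subgrp y); last by exists s.
  move=> g Ag; have [p pL Hp] := LZ _ (action_support_alpha Ag Zy).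
  exists p => //; have := germ_stabilizer_conj (AV Ag) Hp.
  by rewrite invgK alphaV // selfbijK.
by exists r, qs.
Qed.

Section with_exceptional_sets.
Variables (r : nat) (qs : Y -> seq X).
Hypothesis qsP : forall y, action_support y ->
  [/\ uniq (qs y), size (qs y) <= r,
    forall x, x \in qs y <-> exceptional P (germ_stabilizer y) x
  & forall g, A g -> agree (qs y) g id -> germ_stabilizer y g].

Lemma exceptional_conj y g x : A g ->
  exceptional P (germ_stabilizer (alpha g y)) (g x) ->
  exceptional P (germ_stabilizer y) x.
Proof.
move=> Ag Ex [C [[cC CK] Cx]]; apply: Ex.
exists (g^-1%g @^-1` C); split; last by rewrite /= fwdK.
have gF := alt_on_fullperm PP Ag.
split; first by apply: (fullperm_clopen PP) => //; exact: fullpermV.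
move=> k gk; have := alt_on_conj PP (fullpermV PP gF) gk; rewrite invgK.
rewrite (_ : g @^-1` _ = C); last by apply/seteqP; split => z /=; rewrite fwdK.
by move=> /CK /(germ_stabilizer_conj Ag); rewrite !mulgA mulgV mul1g mulgK.
Qed.

Lemma exceptional_alpha y g x : A g -> action_support y ->
  (g x \in qs (alpha g y)) = (x \in qs y).
Proof.
move=> Ag Zy; have Zgy := action_support_alpha Ag Zy.
have [_ _ Ey _] := qsP Zy; have [_ _ Egy _] := qsP Zgy.
apply/idP/idP => [/Egy /(exceptional_conj Ag)/Ey//|/Ey Ex].
apply/Egy; apply: (@exceptional_conj _ g^-1%g); first exact: AV.
by rewrite alphaV // !selfbijK.
Qed.

(** Around a point x outside W choose a central element z of a Heisenberg group
    with prime q > r, trivial near qs y.  For y' near y it fixes y' and thus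
    preserves qs y', which has at most r points, whereas it moves every point of
    its support in an orbit of size q: so qs y' avoids a neighbourhood of x. *)
Lemma exceptional_usc y W : action_support y -> open W -> (forall x, x \in qs y -> W x) ->
  \forall y' \near y, action_support y' -> forall x, x \in qs y' -> W x.
Proof.
move=> Zy oW sW; have [uy sy Ey Ky] := qsP Zy.
pose p (B : set X) := \forall y' \near y, action_support y' ->
  forall x, x \in qs y' -> ~ B x.
suff : p (~` W).
  by rewrite /p; apply: filterS => y' H Zy' x xq; apply: contrapT => nW; exact: H nW.
apply: compact_ind.
- have [_ cX _ _] := XC; apply: subclosed_compact cX _ => //; exact: open_closedC.
- by rewrite /p; apply: nearW => y' _ x _ [].
- by move=> B C; rewrite /p; apply: filterS2 => y' HB HC Zy' x xq [|]; [exact: HB|exact: HC].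
- by move=> B C BC; rewrite /p; apply: filterS => y' HC Zy' x xq /BC; exact: HC.
- move=> x nWx; have oV : open (~` [set` qs y]).
    by apply: closed_openC; apply: (finite_closed XC); exact: finite_seq.
  have [|q [a [b [z [C [[pq rq] [cC CV Cx] [_ _ gz] _ [_ _ _ zi]]]]]]] :=
    @heisenberg _ _ XC PP Pmin _ x r oV.
    by move=> /sW.
  exists C; first by apply: open_nbhs_in => //; case: cC.
  have : \forall y' \near y, forall c, germ_stabilizer y' (z c).
    apply: filter_forall => c; apply: germ_stabilizer_near; apply: Ky.
      exact: alt_on_mono (gz c).
    by move=> x' x'q; apply: alt_on_fix_near cC (gz c) _ => /CV; exact.
  apply: filterS => y' Hz Zy' x' x'q Cx'; have [uy' sy' _ _] := qsP Zy'.
  have zq c : z c x' \in qs y'.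
    have [Az /nbhs_singleton e] := Hz c.
    by rewrite -{1}e exceptional_alpha.
  have : size [seq z c x' | c <- enum {: 'F_q}] <= size (qs y').
    apply: uniq_leq_size; first by rewrite map_inj_uniq ?enum_uniq //; exact: zi.
    by move=> _ /mapP[c _ ->].
  rewrite size_map -cardE card_Fp // => qs_; move: (leq_trans qs_ sy').
  by rewrite leqNgt rq.
Qed.

(** If qs y is empty, then so is qs y' for y' near y in Z by semicontinuity, and
    the whole group fixes y', contradicting that y is a limit of moved points. *)
Lemma exceptional_neq0 y : action_support y -> exists x, x \in qs y.
Proof.
move=> Zy; apply: contrapT => nq.
have := @exceptional_usc y set0 Zy open0.
have sW x : x \in qs y -> set0 x by move=> xq; apply: nq; exists x.
move=> /(_ sW) H; have [y' [[g Ag gy'] Hy']] := Zy _ H.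
have Zy' : action_support y' by apply: subset_closure; exists g.
have [_ _ _ Ky'] := qsP Zy'.
have [|_ /nbhs_singleton] := Ky' g Ag; last by [].
by move=> x /(Hy' Zy').
Qed.

Lemma exceptional_moved y x V : action_support y -> x \in qs y -> nbhs x V ->
  exists C g, [/\ clopen C, C `<=` V, alt_on P C g & alpha g y <> y].
Proof.
move=> Zy xq Vx; have oV : open V° by exact: open_interior.
have [C [g [cC CV gg gx]]] := @move_off (qs y) x _ oV Vx.
exists C, g; split => //; first by apply: subset_trans CV _; exact: interior_subset.
move=> gy; have := exceptional_alpha x (alt_on_mono (@subsetT _ C) gg) Zy.
by rewrite gy xq (negbTE gx).
Qed.

(** Some g supported in V moves y, hence also y' for y' near y; but it would fix
    y' if qs y' avoided V. *)
Lemma exceptional_lsc y x V : action_support y -> x \in qs y -> nbhs x V ->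
  \forall y' \near y, action_support y' -> exists2 x', x' \in qs y' & V x'.
Proof.
move=> Zy xq Vx; have [C [g [cC CV gg gy]]] := exceptional_moved Zy xq Vx.
have Ag : A g by exact: alt_on_mono gg.
have := open_nbhs_in (moved_points_open Yhaus (alpha_cont Ag)) gy; apply: filterS => y' gy' Zy'.
apply: contrapT => nV; have [_ _ _ Ky'] := qsP Zy'; apply: gy'.
have [|_ /nbhs_singleton//] := Ky' g Ag.
by move=> x' x'q; apply: alt_on_fix_near cC gg _ => /CV Vx'; apply: nV; exists x'.
Qed.

Lemma action_support_clopen : clopen action_support.
Proof.
split; last exact: closed_closure.
rewrite openE => y Zy; have [x xq] := exceptional_neq0 Zy.
have [C [g [cC CV gg gy]]] := exceptional_moved Zy xq (@filterT _ (nbhs x) _).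
have Ag : A g by exact: alt_on_mono gg.
have := open_nbhs_in (moved_points_open Yhaus (alpha_cont Ag)) gy; apply: filterS => y' gy'.
by apply: subset_closure; exists g.
Qed.

End with_exceptional_sets.
End support_map.

(** * The topology of symmetric powers *)

Lemma ptws_nbhs_box (I : finType) (X : topologicalType) (t : {ptws I -> X}) N :
  nbhs t N -> exists B : I -> set X, (forall i, nbhs (t i) (B i)) /\
    (forall t' : I -> X, (forall i, B i (t' i)) -> N t').
Proof.
pose F : set_system {ptws I -> X} := filter_from
  [set B : I -> set X | forall i, nbhs (t i) (B i)]
  (fun B => [set t' | forall i, B i (t' i)]).
have FF : Filter F.
  apply: filter_from_filter; first by exists (fun=> setT) => i; exact: filterT.
  move=> B C Bt Ct; exists (fun i => B i `&` C i).
    by move=> i; apply: filterI; [exact: Bt|exact: Ct].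
  by move=> t' BC; split => i; case: (BC i).
suff Ft : F --> t by move=> /Ft[B Bt BN]; exists B; split => // t' /BN.
apply/cvg_sup => i A.
rewrite nbhsE => -[B [[C oC <-] Ct] BA].
exists (fun j => if j == i then C else setT).
  move=> j /=; have [->|_] := eqVneq j i; last exact: filterT.
  exact: open_nbhs_in.
by move=> t' /(_ i); rewrite /= eqxx => Ci; exact: BA.
Qed.

Lemma ptws_box_nbhs (I : finType) (X : topologicalType) (t : {ptws I -> X})
    (B : I -> set X) : (forall i, nbhs (t i) (B i)) ->
  nbhs t [set t' : {ptws I -> X} | forall i, B i (t' i)].
Proof.
move=> Bt; apply: (@filter_forall {ptws I -> X} I (fun i t' => B i (t' i)) (nbhs t)
  (nbhs_filter t)) => i.
exact: (@proj_continuous I (fun=> X) i t (B i) (Bt i)).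
Qed.

(** Naming the underlying set makes equations about it usable for rewriting,
    which the overloaded projection hinders. *)
Definition points (X : topologicalType) (r : nat) (A : symmetric_power X r) : set X := \val A.

Section symmetric_power_theory.
Variables (X : topologicalType) (r : nat).
Hypothesis XC : cantor_like X.
Local Notation symX := (symmetric_power X r).

Lemma sym_inj (A B : symX) : points A = points B -> A = B.
Proof. by move=> AB; apply: val_inj. Qed.

Lemma sym_neq0 (A : symX) : points A !=set0.
Proof. by have /set_mem[] := valP A. Qed.

Lemma sym_range (A : symX) : exists t : 'I_r -> X, points A = range t.
Proof.
have [[a Aa] /pcard_leP[f]] : points A !=set0 /\ (points A #<= `I_r)%card.
  exact: set_mem (valP A).
have fi : {in points A &, injective f} by exact: inj.
have fA : set_fun (points A) `I_r f by exact: funS.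
have /choice[t Ht] : forall i : 'I_r, exists x, points A x /\
    forall y, points A y -> f y = i -> y = x.
  move=> i; have [[x [Ax fx]]|nx] := pselect (exists x, points A x /\ f x = i).
    exists x; split => // y Ay fy; apply: fi; rewrite ?inE //.
    by rewrite fy fx.
  by exists a; split => // y Ay fy; case: nx; exists y.
exists t; apply/seteqP; split => [x Ax|_ [i _ <-]]; last by case: (Ht i).
have fr : f x < r by exact: fA.
exists (Ordinal fr) => //; have [_ h] := Ht (Ordinal fr).
by apply: esym; exact: h.
Qed.

Lemma sym_of_range (t : 'I_r -> X) (i : 'I_r) : exists A : symX, points A = range t.
Proof.
suff rt : range t \in [set A : set X | A !=set0 /\ (A #<= `I_r)%card].
  by exists (exist _ (range t) rt).
apply/mem_set; split; first by exists (t i), i.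
apply: card_le_trans (card_image_le _ _) _.
by have := @card_II r; rewrite card_eq_le => /andP[].
Qed.

Lemma sym_of_seq (s : seq X) x : x \in s -> size s <= r ->
  exists A : symX, points A = [set` s].
Proof.
move=> xs sr; have s0 : 0 < size s by case: s xs sr.
have [A AE] := @sym_of_range (fun i => nth x s i) (Ordinal (leq_trans s0 sr)).
exists A; rewrite AE; apply/seteqP; split => [_ [i _ <-]|y /= ys].
  have [si|si] := ltnP i (size s); first exact: mem_nth.
  by rewrite /= nth_default.
have ir : index y s < r by apply: leq_trans sr; rewrite index_mem.
by exists (Ordinal ir) => //=; rewrite nth_index.
Qed.

Lemma sym_seq (A : symX) : exists s : seq X,
  [/\ uniq s, points A = [set` s] & exists x, x \in s].
Proof.
have [t tE] := sym_range A.
exists (undup [seq t i | i <- enum 'I_r]); split; first exact: undup_uniq.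
  rewrite tE; apply/seteqP; split => [_ [i _ <-]|y]; rewrite /= mem_undup.
    by apply: map_f; rewrite mem_enum.
  by move=> /mapP[i _ ->]; exists i.
have [a] := sym_neq0 A; rewrite tE => -[i _ _].
by exists (t i); rewrite mem_undup; apply: map_f; rewrite mem_enum.
Qed.

Lemma sym_openP (O : set symX) : open O <->
  open [set t : {ptws 'I_r -> X} | exists2 A : symX, O A & points A = range t].
Proof. by []. Qed.

Lemma sym_open_sub (W : set X) : open W -> open [set A : symX | points A `<=` W].
Proof.
move=> oW; apply/sym_openP; rewrite openE => t [A AW AE].
have : nbhs t [set t' : {ptws 'I_r -> X} | forall i, W (t' i)].
  apply: (@ptws_box_nbhs _ X t (fun=> W)) => i; apply: open_nbhs_in => //.
  by apply: AW; rewrite AE; exists i.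
apply: filterS => t' Wt'; have [i] : exists i : 'I_r, True.
  by have [a] := sym_neq0 A; rewrite AE => -[i]; exists i.
move=> _; have [B BE] := sym_of_range t' i; exists B => //=.
by rewrite BE => _ [j _ <-].
Qed.

Lemma sym_open_meet (W : set X) : open W ->
  open [set A : symX | exists2 x, points A x & W x].
Proof.
move=> oW; apply/sym_openP; rewrite openE => t [A [x Ax Wx] AE].
have [i _ tx] : range t x by rewrite -AE.
have : nbhs t [set t' : {ptws 'I_r -> X} | forall j, (if j == i then W else setT) (t' j)].
  apply: (@ptws_box_nbhs _ X t (fun j => if j == i then W else setT)) => j.
  have [->|_] := eqVneq j i; last exact: filterT.
  by apply: open_nbhs_in => //; rewrite tx.
apply: filterS => t' Wt'; have [B BE] := sym_of_range t' i; exists B => //=.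
exists (t' i); first by rewrite BE; exists i.
by have := Wt' i; rewrite eqxx.
Qed.

(** The preimage of O in X^r contains a box around each of the finitely many
    tuples with range A; U x is the intersection of the factors at x of all
    these boxes, made disjoint from the U x' for the other points x' of A. *)
Lemma sym_nbhs (A : symX) O : nbhs A O -> exists U : X -> set X,
  (forall x, points A x -> nbhs x (U x)) /\
  forall B : symX, (forall y, points B y -> exists2 x, points A x & U x y) ->
    (forall x, points A x -> exists2 y, points B y & U x y) -> O B.
Proof.
rewrite nbhsE => -[M [opM MA] MO].
have [s [us AE [x0 x0s]]] := sym_seq A.
pose D : finType := {ffun 'I_r -> 'I_(size s)}.
pose tf (f : D) i := nth x0 s (f i).
have /choice[Bx HB] : forall f : D, exists B : 'I_r -> set X, range (tf f) = points A ->
    (forall i, nbhs (tf f i) (B i)) /\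
    forall t' : 'I_r -> X, (forall i, B i (t' i)) -> exists2 A : symX, M A & points A = range t'.
  move=> f; have [fA|nfA] := pselect (range (tf f) = points A); last by exists (fun=> setT).
  have : nbhs (tf f : {ptws 'I_r -> X})
      [set t : {ptws 'I_r -> X} | exists2 A : symX, M A & points A = range t].
    by apply: open_nbhs_in; [exact/sym_openP|exists A].
  by move=> /ptws_nbhs_box[B HB]; exists B.
have [N [Nx dN]] := @finite_separation X XC X s id us (fun x y _ _ e => e).
have As x : points A x <-> x \in s by rewrite AE.
exists (fun x => N x `&` [set y | forall (f : D) (i : 'I_r),
  range (tf f) = points A -> tf f i = x -> Bx f i y]).
split.
  move=> x /As xs; apply: filterI; first exact: Nx.
  apply: filter_forall => f; apply: filter_forall => i.
  have [[fA fx]|nf] := pselect (range (tf f) = points A /\ tf f i = x); last first.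
    by apply: nearW => y fA fx; case: nf.
  have [Bn _] := HB f fA; have := Bn i; rewrite fx.
  by apply: filterS.
move=> B BA AB; apply: MO.
have [t' t'E] := sym_range B.
have /choice[k Hk] : forall i, exists k : 'I_(size s), 
    N (nth x0 s k) (t' i) /\ forall (f : D) (j : 'I_r),
      range (tf f) = points A -> tf f j = nth x0 s k -> Bx f j (t' i).
  move=> i; have [|x /As xs [Nxi Hx]] := BA (t' i); first by rewrite t'E; exists i.
  have xi : index x s < size s by rewrite index_mem.
  by exists (Ordinal xi); rewrite /= nth_index.
pose f : D := [ffun i => k i].
have tfE i : tf f i = nth x0 s (k i) by rewrite /tf ffunE.
have fA : range (tf f) = points A.
  rewrite AE; apply/seteqP; split => [_ [i _ <-]|x xs]; first by rewrite tfE; exact: mem_nth.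
  have [y By [Nxy _]] := AB x (iffRL (As x) xs).
  have [i _ iy] : range t' y by rewrite -t'E.
  exists i => //; rewrite tfE; apply: contrapT => /eqP ne.
  have [Nki _] := Hk i; have : (N (nth x0 s (k i)) `&` N x) y by split => //; rewrite -iy.
  by rewrite dN //; exact: mem_nth.
have [_ H] := HB f fA.
have [|A' MA' A'E] := H t'.
  by move=> i; have [_ h] := Hk i; apply: h => //; exact: tfE.
by rewrite (_ : B = A') //; apply: sym_inj; rewrite A'E.
Qed.

Lemma sym_hausdorff (A B : symX) : A <> B -> exists O M, [/\ open O, open M, O A, M B
  & O `&` M = set0].
Proof.
wlog [x [Ax nBx]] : A B / exists x, points A x /\ ~ points B x.
  move=> H AB; have [h|nh] := pselect (exists x, points A x /\ ~ points B x); first exact: H.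
  have [h|nh'] := pselect (exists x, points B x /\ ~ points A x).
    have [|N [M [opN opM OB OA d]]] := H B A h; first by move=> e; apply: AB.
    by exists M, N; split => //; rewrite setIC.
  exfalso; apply: AB; apply: sym_inj; apply/seteqP; split => x h; apply: contrapT => nx.
    by apply: nh; exists x.
  by apply: nh'; exists x.
move=> _; have [s [us BE _]] := sym_seq B.
have : nbhs x (~` [set` s]).
  apply: open_nbhs_in; last by rewrite -BE.
  by apply: closed_openC; apply: (finite_closed XC); exact: finite_seq.
move=> /(clopen_basis XC)[C [cC Cx CB]].
exists [set D : symX | exists2 y, points D y & C y], [set D : symX | points D `<=` ~` C].
have [oC' _] := clopenC set0 cC; case: cC => oC _.
split.
- exact: sym_open_meet.
- exact: sym_open_sub.
- by exists x.
- by move=> y; rewrite BE => ys /CB; apply.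
- by apply/seteqP; split => // D [[y Dy Cy] /(_ y Dy)].
Qed.

End symmetric_power_theory.

(** * Partial homeomorphisms of symmetric powers *)

Lemma germ_near (X : topologicalType) (F K : partial_map X) x :
  (\forall y \near x, forall z, F (y, z) <-> K (y, z)) -> germ F x = germ K x.
Proof.
move=> FK; apply/seteqP; split => -[L y] [/= hL Ly yx HL]; split => //=.
  by apply: filterS2 FK HL => w h1 h2 z; rewrite h2.
by apply: filterS2 FK HL => w h1 h2 z; rewrite h2 h1.
Qed.

Lemma near_germ (X : topologicalType) (F K : partial_map X) x y :
  partial_homeo F -> F.`1 x -> germ F x = germ K y ->
  x = y /\ \forall x' \near x, forall z, F (x', z) <-> K (x', z).
Proof.
move=> hF Fx e; have : germ F x (F, x).
  by split => //=; apply: nearW => y' z.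
by rewrite e => -[/= _ _ -> ?].
Qed.

Lemma restriction_homeo (Y : topologicalType) (s : selfbij Y) W :
  continuous s -> continuous s^-1%g -> open W ->
  partial_homeo [set p | W p.1 /\ p.2 = s p.1].
Proof.
move=> cs csV oW; exists W, (s^-1%g @^-1` W), s, s^-1%g; split => //.
- by split => //; apply: open_comp => // x _; exact: csV.
- by split => x Wx //=; rewrite fwdK.
- by split => x Wx; [exact: selfbijK|exact: selfbijVK].
- by split; apply: continuous_subspaceT.
Qed.

Lemma partial_homeo_dom_open (Y : topologicalType) (F : partial_map Y) :
  partial_homeo F -> open F.`1.
Proof.
move=> [U [V [f [g [[oU _] _ _ _ ->]]]]].
rewrite (_ : _.`1 = U) //; apply/seteqP; split => [x [y []]//|x Ux].
by exists (f x).
Qed.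

Section symmetric_pseudogroup.
Variables (X : topologicalType) (r : nat) (P : set (partial_map X)).
Hypothesis XC : cantor_like X.
Hypothesis PP : pseudogroup P.
Hypothesis Pmin : dense_orbits P.
Local Notation symX := (symmetric_power X r).
Local Notation A := (alt_on P [set: X]).

Lemma sym_image (g : X -> X) (B : symX) : exists C : symX, points C = g @` points B.
Proof.
have [t tE] := sym_range B; have [x] := sym_neq0 B.
rewrite tE => -[i _ _]; have [C CE] := @sym_of_range X r (g \o t) i.
exists C; rewrite CE; apply/seteqP; split => [_ [j _ <-]|_ [_ [j _ <-] <-]].
  by exists (t j) => //; exists j.
by exists j.
Qed.

Definition sym_fun (g : X -> X) (B : symX) : symX := projT1 (cid (sym_image g B)).

Lemma sym_funE g B : points (sym_fun g B) = g @` points B.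
Proof. by rewrite /sym_fun; case: cid. Qed.

Lemma sym_funK (g h : X -> X) : cancel g h -> cancel (sym_fun g) (sym_fun h).
Proof.
move=> gh B; apply: sym_inj; rewrite !sym_funE; apply/seteqP; split => x.
  by move=> [_ [y By <-] <-]; rewrite gh.
by move=> Bx; exists (g x); [exists x|exact: gh].
Qed.

Definition symbij (g : selfbij X) : selfbij symX :=
  Selfbij (sym_funK (@fwdK _ g)) (sym_funK (@bwdK _ g)).

Lemma symbijE g B : points (symbij g B) = g @` points B.
Proof. exact: sym_funE. Qed.

Lemma symbijM g h : symbij (g * h)%g = (symbij g * symbij h)%g.
Proof.
apply: selfbijP => B; apply: sym_inj; rewrite selfbijME !symbijE.
by rewrite image_comp.
Qed.

Lemma symbij1 : symbij 1%g = 1%g.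
Proof. by apply: selfbijP => B; apply: sym_inj; rewrite symbijE image_id. Qed.

Lemma symbijV g : symbij g^-1%g = (symbij g)^-1%g.
Proof. by apply/esym/mulg1_eq; rewrite -symbijM mulgV symbij1. Qed.

Lemma symbij_cont g : fullperm P g -> continuous (symbij g).
Proof.
move=> gF; apply/continuousP => W oW; apply/sym_openP.
rewrite openE => t [B /= WB BE].
have : nbhs ((g \o t) : {ptws 'I_r -> X})
    [set t : {ptws 'I_r -> X} | exists2 A : symX, W A & points A = range t].
  apply: open_nbhs_in; first exact/sym_openP.
  exists (symbij g B) => //; rewrite symbijE; apply/seteqP; split.
    move=> _ [x +  <-]; rewrite (_ : points B = range t) // => -[i _ <-]; by exists i.
  move=> _ [i _ <-]; exists (t i) => //.
  by rewrite (_ : points B = range t) //; exists i.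
move=> /ptws_nbhs_box[C [Cn CW]].
have : nbhs t [set t' : {ptws 'I_r -> X} | forall i, C i (g (t' i))].
  apply: (@ptws_box_nbhs _ X t (fun i => g @^-1` C i)) => i.
  by apply: (fullperm_nbhs PP gF); exact: Cn.
apply: filterS => t' /(CW (g \o t')) [D WD DE].
exists (symbij g^-1%g D).
  by change (W (symbij g (symbij g^-1%g D))); rewrite symbijV selfbijVK.
rewrite symbijE DE; apply/seteqP; split.
  by move=> _ [_ [i _ <-] <-]; exists i => //=; rewrite fwdK.
by move=> _ [i _ <-]; exists (g (t' i)); [exists i|rewrite /= fwdK].
Qed.

Lemma symbij_nbhs g B N : fullperm P g -> nbhs (symbij g B) N -> nbhs B (symbij g @^-1` N).
Proof. by move=> gF; exact: symbij_cont. Qed.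

Lemma symmetric_action_graph g : symmetric_action r (graph g) = graph (symbij g).
Proof.
have im (B : symX) : pimage (graph g) (points B) = g @` points B.
  rewrite /pimage /graph; apply/seteqP; split => y /=.
    by move=> [x Bx ->]; exists x.
  by move=> [x Bx <-]; exists x.
apply/seteqP; split => -[B C] /=.
  move=> [_ /= CE]; apply: sym_inj; rewrite symbijE; by rewrite -im.
rewrite /graph /= => ->; split => /=; first by move=> x _; exists (g x).
have := im B; rewrite /points => ->; exact: sym_funE.
Qed.

Lemma agree_symbij (s : seq X) (B : symX) (g h : selfbij X) :
  points B = [set` s] -> agree s g h -> \forall C \near B, symbij g C = symbij h C.
Proof.
move=> BE gh; pose W := interior [set z | g z = h z].
have : nbhs B [set C : symX | points C `<=` W].
  apply: open_nbhs_in; first by apply: sym_open_sub; exact: open_interior.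
  by move=> x; rewrite BE => xs; exact: gh.
apply: filterS => C CW; apply: sym_inj; rewrite !symbijE; apply/seteqP; split.
  by move=> _ [x Cx <-]; exists x => //; rewrite (interior_subset (CW x Cx)).
by move=> _ [x Cx <-]; exists x => //; rewrite (interior_subset (CW x Cx)).
Qed.

(** Replacing one point x of B by a nearby x' outside B gives a set B' which f
    also preserves.  If f moved x, then x = f y for another point y of B, so
    that x would belong to f(B') = B'.  Hence f fixes the points of B, and then
    x' as the only other point of B'. *)
Lemma symbij_fix (s : seq X) (B : symX) (f : selfbij X) : points B = [set` s] ->
  (\forall C \near B, symbij f C = C) -> agree s f id.
Proof.
move=> BE fB; have [U [Un UB]] := sym_nbhs XC fB.
have Bs x : points B x <-> x \in s by rewrite BE.
pose move (x x' z : X) := if z == x then x' else z.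
have Hm x x' : x \in s -> U x x' -> forall z, (exists2 w, w \in s & z = move x x' w) <->
    (exists2 w, w \in s & z = f (move x x' w)).
  move=> xs Ux z; have [C CE] := sym_image (move x x') B.
  have fC : symbij f C = C.
    apply: UB => y.
      rewrite CE => -[w Bw <-]; exists w => //; rewrite /move.
      by have [->|_] := eqVneq w x => //; apply: nbhs_singleton; exact: Un.
    move=> By; exists (move x x' y); first by rewrite CE; exists y.
    rewrite /move; have [->//|_] := eqVneq y x.
    by apply: nbhs_singleton; exact: Un.
  split.
    move=> [w ws zE]; have : points C z by rewrite CE; exists w => //; exact/Bs.
    rewrite -fC symbijE CE => -[_ [v /Bs vs <-] <-]; by exists v.
  move=> [w ws zE]; have : points (symbij f C) z.
    rewrite symbijE zE; exists (move x x' w) => //.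
    by rewrite CE; exists w => //; exact/Bs.
  by rewrite fC CE => -[v /Bs vs <-]; exists v.
have fs x : x \in s -> f x = x.
  move=> xs; apply: contrapT => /eqP fx.
  have Ux : U x x by apply: nbhs_singleton; apply: Un; exact/Bs.
  have mx w : move x x w = w by rewrite /move; case: eqP.
  have [y ys xy] : exists2 y, y \in s & x = f y.
    have [H1 _] := Hm x x xs Ux x; have [|y ys] := H1.
      by exists x => //; rewrite mx.
    by rewrite mx => e; exists y.
  have yx : y != x by apply: contra_neq fx => yx; rewrite {2}xy yx.
  have oU : open (interior (U x)) by exact: open_interior.
  have [x' [Ux' nx']] := open_setD_finite_neq0 XC oU
     (ex_intro _ x (Un x (iffRL (Bs x) xs))) (finite_seq s).
  have [_ H] := Hm x x' xs (interior_subset Ux') x.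
  have [|w ws] := H; first by exists y => //; rewrite /move (negbTE yx).
  rewrite /move; have [_ e|wx e] := eqVneq w x.
    by apply: nx'; rewrite /= -e.
  by rewrite e eqxx in wx.
move=> x xs; apply: filterS (Un x (iffRL (Bs x) xs)) => x' Ux'.
have [x's|x's] := boolP (x' \in s); first exact: fs.
have [_ H] := Hm x x' xs Ux' (f x').
have [|w ws] := H; first by exists x => //; rewrite /move eqxx.
rewrite /move; have [//|wx e] := eqVneq w x.
have := fs w ws; rewrite -{2}e => h; have wx' := selfbij_inj h.
by rewrite -wx' ws in x's.
Qed.

Lemma symbij_agree (s : seq X) (B : symX) (g h : selfbij X) : fullperm P g -> fullperm P h ->
  points B = [set` s] ->
  (\forall C \near B, symbij g C = symbij h C) -> agree s (h^-1 * g)%g id.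
Proof.
move=> gF hF BE gh; apply: (symbij_fix BE); apply: filterS gh => C e.
by rewrite symbijM selfbijME e symbijV selfbijK.
Qed.

Variable G : set (germ_type X).
Hypothesis GP : pseudogroup_of G = P.

Lemma symmetric_pseudogroup_local (F : partial_map symX) B :
  pseudogroup_of (symmetric_groupoid r G) F -> F.`1 B ->
  exists2 g, A g & \forall C \near B, forall D, F (C, D) <-> D = symbij g C.
Proof.
move=> [hF gF] FB; have [K [B' [[L LG <-] KB' e]]] := gF B FB.
have [BB' HF] := near_germ hF FB e; subst B'.
rewrite GP in LG.
have [s [us BE _]] := sym_seq B.
have [D [/= BL0 _]] := KB'.
have BL : points B `<=` L.`1 := BL0.
have /choice[b Hb] : forall x, exists y, x \in s -> L (x, y).
  move=> x; have [xs|] := boolP (x \in s); last by exists x.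
  by have [|y Lxy] := BL x; [rewrite BE|exists y].
have [|||C [g [cC _ gg gL]]] := @realize _ _ XC PP Pmin X s id b (fun=> L) setT openT us.
- by move=> x y _ _.
- by move=> x y xs ys e'; apply: (pseudo_inj PP LG (Hb x xs)); rewrite e'; exact: Hb.
- by move=> x xs; split => //; exact: Hb.
exists g; first exact: alt_on_mono gg.
pose W := interior [set z | L (z, g z)].
have : nbhs B [set C : symX | points C `<=` W].
  apply: open_nbhs_in; first by apply: sym_open_sub; exact: open_interior.
  by move=> x; rewrite BE => xs; exact: gL.
apply: filterS2 HF => E HE EW D'; rewrite HE.
have LE x : points E x -> L (x, g x) by move=> /EW/interior_subset.
have im : pimage L (points E) = g @` points E.
  apply/seteqP; split => [y [x Ex Lxy]|_ [x Ex <-]].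
    by exists x => //; exact: (pseudo_fun PP LG (LE x Ex) Lxy).
  by exists x => //; exact: LE.
split => [[_ D'E]|->].
  by apply: sym_inj; rewrite symbijE -im; exact: D'E.
split => /=; first by move=> x Ex; exists (g x); exact: LE.
by have := sym_funE g E; rewrite -im; exact.
Qed.

Lemma symmetric_pseudogroup_intro (g : selfbij X) (W : set symX) : fullperm P g -> open W ->
  pseudogroup_of (symmetric_groupoid r G) [set p | W p.1 /\ p.2 = symbij g p.1].
Proof.
move=> gF oW; split.
  apply: restriction_homeo => //; first exact: symbij_cont.
  by rewrite -symbijV; apply: symbij_cont; exact: fullpermV.
move=> B [C [/= WB _]].
exists (symmetric_action r (graph g)), B; split.
- by exists (graph g) => //; rewrite GP.
- by rewrite symmetric_action_graph; exists (symbij g B).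
- rewrite symmetric_action_graph; apply: germ_near.
  by apply: filterS (open_nbhs_in oW WB) => D WD E; split => [[]|].
Qed.

Lemma symmetric_pseudogroup_pid (W : set symX) : open W ->
  pseudogroup_of (symmetric_groupoid r G) (pid W).
Proof.
move=> oW; have := symmetric_pseudogroup_intro (fullperm1 PP) oW; rewrite symbij1.
by [].
Qed.

Lemma symmetric_pseudogroup_graph (g : selfbij X) : fullperm P g ->
  pseudogroup_of (symmetric_groupoid r G) (graph (symbij g)).
Proof.
move=> gF; have := symmetric_pseudogroup_intro gF openT.
rewrite (_ : [set p | _] = graph (symbij g)) //.
by apply/seteqP; rewrite /graph; split => p /= // [].
Qed.

Lemma symmetric_pseudogroup_restr (g : selfbij X) (W : set symX) :
  fullperm P g -> open W ->
  pseudogroup_of (symmetric_groupoid r G) (graph (symbij g) \; pid W)%relation.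
Proof.
move=> gF oW; have := symmetric_pseudogroup_intro gF oW; congr (pseudogroup_of _ _).
apply/seteqP; split => -[C D] /=; first by move=> [WC ->]; exists C.
by move=> [E [/= WC ->]]; rewrite /graph /= => ->.
Qed.

End symmetric_pseudogroup.

(** * Graphs of bijections and the alternating full group *)

Lemma cantor_like_homeomorphic (X Y : topologicalType) :
  homeomorphic X Y -> cantor_like Y -> cantor_like X.
Proof.
move=> [f [g [fK gK cf cg]]] [/perfectTP pY cY hY zY]; split.
- apply/perfectTP => x ox; apply: (pY (f x)).
  rewrite (_ : [set f x] = g @^-1` [set x]); first exact: open_comp.
  by apply/seteqP; split => y /= => [->|<-]; rewrite ?fK ?gK.
- rewrite (_ : [set: X] = g @` [set: Y]).
    by apply: continuous_compact cY; exact: continuous_subspaceT.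
  by apply/seteqP; split => // x _; exists (f x).
- move=> x y xy; have fxy : f x = f y; last by rewrite -(fK x) fxy fK.
  apply: hY => A B Ax By; have [z [Az Bz]] := xy _ _ (cf x _ Ax) (cf y _ By).
  by exists (f z).
- move=> x y xy; have [|U [cU Ux nUy]] := zY (f x) (f y).
    by apply: contra_neq xy => e; rewrite -(fK x) e fK.
  by exists (f @^-1` U); split => //; exact: preimage_clopen.
Qed.

Section translation.
Variables (X : topologicalType) (G : set (germ_type X)).
Hypothesis GP : pseudogroup (pseudogroup_of G).
Local Notation P := (pseudogroup_of G).

Lemma full_groupP F : full_group G F <-> exists g, F = graph g /\ fullperm P g.
Proof.
split; last first.
  move=> [g [-> gF]]; split => //; apply/seteqP; split => // x _.
    by exists (g x).
  by exists (g^-1%g x); rewrite /graph /= bwdK.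
move=> [PF F1 F2]; have [U [V [f [g [_ [fUV gVU] [fK gK] _ FE]]]]] := pseudo_homeo GP PF.
have Ux x : U x.
  have : [set: X] x by []; rewrite -F1 FE => -[y [+ _]]; exact.
have Vy y : V y.
  have : [set: X] y by []; rewrite -F2 FE => -[x [Ux' /= ->]]; exact: fUV.
pose s := @Selfbij X f g (fun x => fK x (Ux x)) (fun y => gK y (Vy y)).
have Fs : F = graph s.
  by rewrite FE /graph; apply/seteqP; split => -[x y] /= => [[]|].
by exists s; split => //; rewrite /fullperm /= -Fs.
Qed.

Lemma three_cycle_cyc3 s : three_cycle G (graph s) -> exists U, cyc3 P U s.
Proof.
move=> [Hs _ sss [U1 [U2 [U3 [[c1 _ _] [d12 _ d13] [e1 e2 e3] sfix]]]]].
have [s' [/graph_inj <- sF]] := (full_groupP _).1 Hs.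
have sE (U V : set X) x : pimage (graph s) U = V -> U x -> V (s x).
  by move=> <- Ux; exists x.
have sE' (U V : set X) y : pimage (graph s) U = V -> V y -> exists2 x, U x & y = s x.
  by move=> <- [x Ux]; exists x.
have s3 x : s (s (s x)) = x.
  have : (graph s \; (graph s \; graph s))%relation (x, s (s (s x))).
    by exists (s (s x)) => //; exists (s x).
  by rewrite sss => -[].
exists U1; split => //.
- move=> x U1x; split => h.
    have : (U1 `&` U2) (s x) by split => //; exact: sE e1 U1x.
    by rewrite d12.
  have : (U1 `&` U3) (s (s x)) by split => //; exact: (sE _ _ _ e2 (sE _ _ _ e1 U1x)).
  by rewrite d13.
- move=> x nx; have : graph s (x, x); last by rewrite /graph /= => <-.
  apply: sfix => -[[U1x|U2x]|U3x]; apply: nx.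
  + by constructor 1.
  + by have [y U1y ->] := sE' _ _ _ e1 U2x; constructor 3; rewrite s3.
  + have [y U2y ->] := sE' _ _ _ e2 U3x; have [w U1w ->] := sE' _ _ _ e1 U2y.
    by constructor 2; rewrite s3.
Qed.

Lemma cyc3_three_cycle U s : cyc3 P U s -> s <> 1%g -> three_cycle G (graph s).
Proof.
move=> cs s1; have [sF cU dU s3 sfix] := cs.
split.
- by apply/full_groupP; exists s.
- by rewrite -graph1 => /graph_inj.
- rewrite -!graphM -graph1; congr graph; apply: selfbijP => x; exact: s3.
- have cs1 := fullperm_clopen GP sF cU; have cs2 := fullperm_clopen GP sF cs1.
  exists U, (s @^-1` (s @^-1` U)), (s @^-1` U); split; [by split|split|split|].
  + by apply/seteqP; split => // x [/= /dU[_ h] /h].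
  + by apply/seteqP; split => // x [/= h /dU[/(_ h)]].
  + by apply/seteqP; split => // x [/= /dU[h _] /h].
  + apply/seteqP; rewrite /pimage /graph; split => y /=.
      by move=> [x Ux ->]; rewrite s3.
    by move=> Uy; exists (s (s y)) => //; rewrite s3.
  + apply/seteqP; rewrite /pimage /graph; split => y /=.
      by move=> [x Ux ->].
    by move=> Uy; exists (s (s y)) => //; rewrite s3.
  + apply/seteqP; rewrite /pimage /graph; split => y /=.
      by move=> [x Ux ->].
    by move=> Uy; exists (s (s y)) => //; rewrite s3.
  + move=> x nx; have sx : s x = x.
      by apply: sfix => -[] h; apply: nx; [left; left|right|left; right].
    by rewrite /graph /= sx.
Qed.

Lemma alternatingP F : alternating_full_group G F <->
  exists g, F = graph g /\ alt_on P setT g.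
Proof.
split.
  move: F; apply: smallest_sub.
    split.
    - by move=> _ [g [-> /(alt_on_fullperm GP) gF]]; apply/full_groupP; exists g.
    - by exists 1%g; rewrite graph1; split => //; exact: alt_on_one.
    - move=> _ _ [g [-> gg]] [h [-> gh]]; exists (g * h)%g.
      by rewrite graphM; split => //; exact: alt_on_mul.
    - move=> _ [g [-> gg]]; exists g^-1%g; rewrite graphV; split => //.
      exact: alt_on_inv.
  move=> F cF; have [[s [FE _]] _] : (exists g, F = graph g /\ fullperm P g) /\ True.
    by split => //; apply/full_groupP; case: cF.
  rewrite FE in cF *; have [U cs] := three_cycle_cyc3 cF.
  by exists s; split => //; exact: alt_on_cyc cs _.
move=> [g [-> gg]] S [[_ S1 SM _] S3].
elim: gg => [|g' h _ Hg _ Hh|U s cs _].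
- by rewrite graph1.
- by rewrite graphM; exact: SM.
- have [->|s1] := pselect (s = 1%g); first by rewrite graph1.
  by apply: S3; exact: cyc3_three_cycle cs s1.
Qed.

End translation.

(** * Extending the homomorphism *)

Section extension.
Variables (X Y : topologicalType) (P : set (partial_map X)).
Hypothesis XC : cantor_like X.
Hypothesis PP : pseudogroup P.
Hypothesis Pmin : dense_orbits P.
Hypothesis Yhaus : hausdorff_space Y.
Variables (G : set (germ_type X)) (H : set (germ_type Y)).
Hypothesis GP : pseudogroup_of G = P.
Local Notation PH := (pseudogroup_of H).
Hypothesis HP : pseudogroup PH.
Local Notation A := (alt_on P [set: X]).
Variable alpha : selfbij X -> selfbij Y.
Hypothesis alphaM : forall g h, A g -> A h -> alpha (g * h)%g = (alpha g * alpha h)%g.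
Hypothesis alpha_full : forall g, A g -> fullperm PH (alpha g).
Local Notation Z := (action_support P alpha).
Variables (r : nat) (qs : Y -> seq X).
Hypothesis qsP : forall y, Z y ->
  [/\ uniq (qs y), size (qs y) <= r,
    forall x, x \in qs y <-> exceptional P (germ_stabilizer P alpha y) x
  & forall g, A g -> agree (qs y) g id -> germ_stabilizer P alpha y g].
Local Notation symX := (symmetric_power X r).
Variable q : Y -> symX.
Hypothesis qE : forall y, Z y -> points (q y) = [set` qs y].
Local Notation PS := (pseudogroup_of (symmetric_groupoid r G)).

Let alpha_cont g : A g -> continuous (alpha g).
Proof. by move=> /alpha_full; exact: fullperm_cont. Qed.
Let AM g h : A g -> A h -> A (g * h)%g. Proof. exact: alt_on_mul. Qed.
Let AV g : A g -> A g^-1%g. Proof. exact: alt_on_inv. Qed.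
Let AF g : A g -> fullperm P g. Proof. exact: (alt_on_fullperm PP). Qed.
Let Zclopen : clopen Z.
Proof. exact: (action_support_clopen XC PP Pmin Yhaus alphaM alpha_cont qsP). Qed.
Let Zalpha g y : A g -> Z y -> Z (alpha g y).
Proof. exact: (action_support_alpha alphaM alpha_cont). Qed.

(** Upper and lower semicontinuity together are continuity into the symmetric
    power. *)
Lemma support_map_cont y O : Z y -> nbhs (q y) O -> \forall y' \near y, Z y' /\ O (q y').
Proof.
move=> Zy /(sym_nbhs XC)[U [Un UO]].
pose W := \bigcup_(x in [set` qs y]) (U x)°.
have oW : open W by apply: bigcup_open => x _; exact: open_interior.
have sW x : x \in qs y -> W x by move=> xq; exists x => //; apply: Un; rewrite qE.
have n1 := exceptional_usc XC PP Pmin alphaM alpha_cont qsP Zy oW sW.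
have n2 : \forall y' \near y, forall x, x \in qs y -> Z y' -> exists2 x', x' \in qs y' & U x x'.
  have : forall s : seq X, {subset s <= qs y} -> \forall y' \near y, forall x, x \in s ->
      Z y' -> exists2 x', x' \in qs y' & U x x'.
    elim=> [|x s IH] sq; first by apply: nearW => y' x.
    have xq : x \in qs y by apply: sq; exact: mem_head.
    have Ux : nbhs x (U x) by apply: Un; rewrite qE.
    have nx := exceptional_lsc XC PP Pmin Yhaus alphaM alpha_cont qsP Zy xq Ux.
    have {}IH : \forall y' \near y, forall x, x \in s -> Z y' -> exists2 x', x' \in qs y' & U x x'.
      by apply: IH => z zs; apply: sq; rewrite inE zs orbT.
    apply: filterS2 nx IH => y' h1 h2 z; rewrite inE => /predU1P[->|zs] Zy'; first exact: h1.
    exact: h2.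
  by apply.
have n3 : nbhs y Z by apply: open_nbhs_in => //; case: Zclopen.
near=> y'; have Zy' : Z y' by near: y'.
split=> //; apply: UO => x; rewrite !qE //= => xq.
  have /(_ Zy' x xq)[x' x'q /interior_subset Ux] : Z y' -> forall x, x \in qs y' -> W x by near: y'.
  by exists x'.
have /(_ x xq Zy')[x' x'q Ux] :
  forall x, x \in qs y -> Z y' -> exists2 x', x' \in qs y' & U x x' by near: y'.
by exists x' => //; rewrite qE.
Unshelve. all: by end_near. Qed.

Lemma support_map_alpha g y : A g -> Z y -> q (alpha g y) = symbij r g (q y).
Proof.
move=> Ag Zy; apply: sym_inj; rewrite symbijE !qE //; last exact: Zalpha.
have E x := exceptional_alpha PP alphaM alpha_cont qsP x Ag Zy.
apply/seteqP; split => [x /= xq|_ [x xq <-]]; last by rewrite /= E.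
by exists (g^-1%g x); rewrite ?bwdK //= -E bwdK.
Qed.

Lemma near_stabilizer g h y : A g -> A h -> Z y ->
  (\forall C \near q y, symbij r g C = symbij r h C) ->
  \forall y' \near y, alpha g y' = alpha h y'.
Proof.
move=> Ag Ah Zy gh; have [_ _ _ Ky] := qsP Zy.
have := symbij_agree XC (AF Ag) (AF Ah) (qE Zy) gh.
move=> /(Ky _ (AM (AV Ah) Ag))[_]; apply: filterS => y' e.
by rewrite -{2}e -[RHS]selfbijME -alphaM ?mulVKg //; exact: AM (AV Ah) Ag.
Qed.

(** The points of Z at whose attached finite set F has the same germ as g. *)
Definition represented (g : selfbij X) (F : partial_map symX) : set Y :=
  [set y | Z y /\ \forall C \near q y, forall D, F (C, D) <-> D = symbij r g C].

Lemma represented_open g F : open (represented g F).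
Proof.
rewrite openE => y [Zy /nbhs_interior gF].
by apply: filterS (support_map_cont Zy gF) => y' [].
Qed.

Lemma represented_uniq g h F y : A g -> A h -> represented g F y -> represented h F y ->
  alpha g y = alpha h y.
Proof.
move=> Ag Ah [Zy gF] [_ hF].
have : \forall C \near q y, symbij r g C = symbij r h C.
  by apply: filterS2 gF hF => C h1 h2; apply/h2/h1.
by move=> /(near_stabilizer Ag Ah Zy)/nbhs_singleton.
Qed.

(** Near a point y, the germ of F at q y is that of some g in the alternating full
    group, and F is let act as alpha g. *)
Definition extension (F : partial_map symX) : partial_map Y :=
  [set p | exists g, [/\ A g, represented g F p.1 & p.2 = alpha g p.1]].

Lemma PS_local F C D : PS F -> F (C, D) ->
  exists2 g, A g & \forall C' \near C, forall D', F (C', D') <-> D' = symbij r g C'.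
Proof.
move=> PF FCD; apply: (symmetric_pseudogroup_local XC PP Pmin GP PF).
by exists D.
Qed.

(** The extension is the union of the restrictions of the alpha g to the open
    sets [represented g F], so it suffices that these are compatible.  Since F
    is injective, two points with the same image have the same finite set
    attached to them, and hence a common representative of F. *)
Lemma extension_restrict F : PS F -> pseudogroup_of (restrict_groupoid H Z) (extension F).
Proof.
move=> PF; have hF : partial_homeo F by case: PF.
have PE : PH (extension F).
  pose FF := [set K : partial_map Y | exists2 g, A g &
    K = (graph (alpha g) \; pid (represented g F))%relation].
  rewrite (_ : extension F = \bigcup_(K in FF) K); last first.
    apply/seteqP; split => [[y y'] [g [Ag gF /= ->]]|[y y'] [K [g Ag ->] [z [/= gF ->]]]].
      exists (graph (alpha g) \; pid (represented g F))%relation; first by exists g.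
      by exists y.
    by rewrite /graph /= => ->; exists g.
  case: (HP) => _ _ _ _; apply.
    move=> _ [g Ag ->]; apply: (pseudo_comp HP); first exact: alpha_full.
    by apply: (pseudo_id HP); exact: represented_open.
  move=> _ _ [g Ag ->] [h Ah ->]; split.
    move=> y y1 y2 [z [/= gF ->] +] [w [/= hF' ->]]; rewrite /graph /= => -> ->.
    exact: represented_uniq gF hF'.
  move=> y1 y2 y [z [/= gF ->] yE] [w [/= hF' ->] yE'].
  rewrite /graph /= in yE yE'.
  have [Zy1 gF1] := gF; have [Zy2 hF2] := hF'.
  have q12 : q y1 = q y2.
    apply: (partial_homeo_inj (y := symbij r g (q y1)) hF).
      by apply/(nbhs_singleton gF1).
    by apply/(nbhs_singleton hF2); rewrite -!support_map_alpha // -yE yE'.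
  have hF1 : represented h F y1 by split => //; rewrite q12.
  have := represented_uniq Ag Ah gF hF1; rewrite -yE yE' => e.
  by apply: (selfbij_inj (g := alpha h)); rewrite -e.
split; first exact: (pseudo_homeo HP).
move=> y [y' yy']; split; first by case: PE => _; apply; exists y'.
exists (extension F), y, y'; split => //.
- exact: (pseudo_homeo HP).
- by case: yy' => g [_ []].
- by case: yy' => g [Ag [Zy _] /= ->]; exact: Zalpha.
Qed.

Lemma extension_graph g : A g ->
  extension (symmetric_action r (graph g)) = (graph (alpha g) \; pid Z)%relation.
Proof.
move=> Ag; rewrite symmetric_action_graph.
have gg y : Z y -> represented g (graph (symbij r g)) y.
  by move=> Zy; split; [exact: Zy|apply: filterE => C D; rewrite /graph /=].
apply/seteqP; split => [[y y'] [h [Ah hF /= ->]]|[y y'] [z [/= Zy ->]]].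
  have [Zy _] := hF; exists y => //; rewrite /graph /=.
  exact: represented_uniq hF (gg y Zy).
by rewrite /graph /= => ->; exists g; split => //=; exact: gg.
Qed.

Lemma extension_comp F K : PS F -> PS K ->
  extension (F \; K)%relation = (extension F \; extension K)%relation.
Proof.
move=> PF PK; apply/seteqP; split.
  move=> [y y'] [g [Ag [Zy gFK] /= ->]].
  have [C /= KC FC] : (F \; K)%relation (q y, symbij r g (q y)) by apply/(nbhs_singleton gFK).
  have [h Ah hK] := PS_local PK KC.
  have CE : C = symbij r h (q y) by apply/(nbhs_singleton hK).
  exists (alpha h y); first by exists h.
  exists (g * h^-1)%g; split => /=.
  - exact: AM Ag (AV Ah).
  - split; first exact: Zalpha.
    have n : nbhs (symbij r h^-1%g (symbij r h (q y))) [set C' |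
       (forall D', K (C', D') <-> D' = symbij r h C') /\
       (forall D', (F \; K)%relation (C', D') <-> D' = symbij r g C')].
      by rewrite symbijV selfbijK; exact: filterI.
    rewrite support_map_alpha //; have := symbij_nbhs PP (AF (AV Ah)) n.
    apply: filterS => C' HH D; pose C0 := symbij r h^-1%g C'.
    have HK D' : K (C0, D') <-> D' = symbij r h C0 by case: HH.
    have HFK D' : (F \; K)%relation (C0, D') <-> D' = symbij r g C0 by case: HH.
    have C0E : C0 = symbij r h^-1%g C' by [].
    clearbody C0.
    have hC0 : symbij r h C0 = C' by rewrite C0E symbijV selfbijVK.
    have gC0 : symbij r g C0 = symbij r (g * h^-1)%g C' by rewrite C0E symbijM.
    rewrite -gC0 -HFK; split => [FD|[C1 /= /HK ->]]; last by rewrite hC0.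
    by exists C' => //=; apply/HK; rewrite hC0.
  - by rewrite alphaM ?(alphaV alphaM) ?selfbijME ?selfbijK //; exact: AV.
move=> [y y'] [z [h [Ah [Zy hK] /= ->]] [g [Ag [_ gF] /= ->]]].
exists (g * h)%g; split => /=; [exact: AM| |by rewrite alphaM].
split => //; rewrite support_map_alpha // in gF.
have := symbij_nbhs PP (AF Ah) gF; apply: filterS2 hK => C HK HF D.
rewrite symbijM selfbijME; split => [[C1 /= /HK -> /HF]//|->].
by exists (symbij r h C); [apply/HK|apply/HF].
Qed.

Lemma extension_inv F : PS F ->
  extension (F^-1)%relation = ((extension F)^-1)%relation.
Proof.
move=> PF; have hF : partial_homeo F by case: PF.
have half K g y : partial_homeo K -> A g -> represented g K y ->
    represented g^-1%g (K^-1)%relation (alpha g y).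
  move=> hK Ag [Zy gK]; split; first exact: Zalpha.
  rewrite support_map_alpha //.
  have n : nbhs (symbij r g^-1%g (symbij r g (q y))) [set C' |
       forall D', K (C', D') <-> D' = symbij r g C'].
    by rewrite symbijV selfbijK.
  have oD : nbhs (symbij r g (q y)) [set C | forall D, K (D, C) -> D = symbij r g^-1%g C].
    have := symbij_nbhs PP (AF (AV Ag)) n; apply: filterS => C HC D KDC.
    apply: (partial_homeo_inj hK KDC); apply/HC.
    by change (C = symbij r g (symbij r g^-1%g C)); rewrite symbijV selfbijVK.
  have := symbij_nbhs PP (AF (AV Ag)) n; apply: filterS2 oD => C HC1 HC D /=.
  split; first exact: HC1.
  move=> ->; apply/HC; by change (C = symbij r g (symbij r g^-1%g C)); rewrite symbijV selfbijVK.
apply/seteqP; split.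
  move=> [y y'] [g [Ag gF /= ->]] /=; exists g^-1%g; split => /=.
  - exact: AV.
  - have [U [V [f [f' [[oU oV] [fU fV] [fK f'K] [cf cf'] FE]]]]] := hF.
    have hFi : partial_homeo (F^-1)%relation.
      exists V, U, f', f; split => //.
      rewrite FE; apply/seteqP; split => -[a b] /=.
        by move=> [Ub ->]; split; [exact: fU|rewrite fK].
      by move=> [Va ->]; split; [exact: fV|rewrite f'K].
    exact: half hFi Ag gF.
  - by rewrite (alphaV alphaM) // selfbijK.
move=> [y y'] [g [Ag gF /= ->]] /=; exists g^-1%g; split => /=.
- exact: AV.
- exact: half.
- by rewrite (alphaV alphaM) // selfbijK.
Qed.

Lemma extension_bigcup FF : FF `<=` PS -> compatible_family FF ->
  extension (\bigcup_(F in FF) F) = \bigcup_(F in FF) extension F.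
Proof.
move=> FP FC; have near_sub F y : FF F -> F.`1 (q y) ->
    (\forall C \near q y, forall D, F (C, D) <-> (\bigcup_(K in FF) K) (C, D)).
  move=> FFF Fq; have oF : open F.`1 by apply: partial_homeo_dom_open; case: (FP _ FFF).
  apply: filterS (open_nbhs_in oF Fq) => C [D0 FCD0] D; split; first by exists F.
  move=> [K FK KCD]; have [h _] := FC _ _ FFF FK.
  by rewrite -(h _ _ _ FCD0 KCD).
apply/seteqP; split.
  move=> [y y'] [g [Ag [Zy gF] /= ->]].
  have [F FFF Fq] : (\bigcup_(F in FF) F) (q y, symbij r g (q y)) by apply/(nbhs_singleton gF).
  exists F => //; exists g; split => //=; split => //.
  have := near_sub F y FFF (ex_intro _ _ Fq); apply: filterS2 gF => C h1 h2 D.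
  by rewrite h2.
move=> [y y'] [F FFF [g [Ag [Zy gF] /= ->]]].
exists g; split => //=; split => //.
have Fq : F.`1 (q y) by exists (symbij r g (q y)); apply/(nbhs_singleton gF).
have := near_sub F y FFF Fq; apply: filterS2 gF => C h1 h2 D.
by rewrite -h2.
Qed.

Lemma extension_morphism :
  continuous_morphism setT (symmetric_groupoid r G) Z (restrict_groupoid H Z) extension.
Proof.
split.
- exact: extension_restrict.
- exact: extension_comp.
- exact: extension_inv.
- exact: extension_bigcup.
- split.
    have -> : pid [set: symX] = symmetric_action r (graph 1%g).
      by rewrite symmetric_action_graph symbij1 graph1.
    rewrite extension_graph; last exact: alt_on_one.
    rewrite (alpha1 alphaM) graph1; apply/seteqP; split => -[y y'] /=.
      by move=> [z [/= Zy ->] [_ /= ->]].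
    by move=> [/= Zy ->]; exists y.
  apply/seteqP; split => // -[y y'] [g [Ag [Zy gF] _]].
  by have := nbhs_singleton gF => /(_ (symbij r g (q y)))[_]; apply.
Qed.

End extension.

(** * Uniqueness of the extension *)

Lemma idempotent_partial_homeo (Y : topologicalType) (e : partial_map Y) :
  partial_homeo e -> (e \; e)%relation = e -> forall x y, e (x, y) -> x = y.
Proof.
move=> he ee x y exy; have : (e \; e)%relation (x, y) by rewrite ee.
move=> [z /= exz ezy]; have zy := partial_homeo_fun he exz exy; subst z.
exact: (partial_homeo_inj he exy ezy).
Qed.

Section morphism.
Variables (X Y : topologicalType) (P : set (partial_map X)).
Hypothesis XC : cantor_like X.
Hypothesis PP : pseudogroup P.
Hypothesis Pmin : dense_orbits P.
Variables (G : set (germ_type X)) (H : set (germ_type Y)).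
Hypothesis GP : pseudogroup_of G = P.
Local Notation A := (alt_on P [set: X]).
Variable alpha : selfbij X -> selfbij Y.
Variables (r : nat) (Z : set Y).
Local Notation symX := (symmetric_power X r).
Local Notation PS := (pseudogroup_of (symmetric_groupoid r G)).
Variable psi : partial_map symX -> partial_map Y.
Hypothesis psiM :
  continuous_morphism setT (symmetric_groupoid r G) Z (restrict_groupoid H Z) psi.
Hypothesis psiE : forall g, A g ->
  psi (graph (symbij r g)) = (graph (alpha g) \; pid Z)%relation.

Let PSid (W : set symX) : open W -> PS (pid W).
Proof. by move=> oW; exact: (symmetric_pseudogroup_pid PP GP oW). Qed.

Let psi_comp F K : PS F -> PS K -> psi (F \; K)%relation = (psi F \; psi K)%relation.
Proof. by case: psiM => _ + _ _ _; apply. Qed.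

Let psi_homeo F : PS F -> partial_homeo (psi F).
Proof. by case: psiM => + _ _ _ _ PF => /(_ F PF)[]. Qed.

Lemma pid_comp (T : Type) (V W : set T) : V `<=` W -> (pid W \; pid V)%relation = pid V.
Proof.
move=> VW; apply/seteqP; split => -[x y] /=.
  by move=> [z [/= Vx ->] [_ /= ->]].
by move=> [/= Vx ->]; exists x => //; split => //=; exact: VW.
Qed.

(** psi (pid W) is idempotent, hence the identity of an open subset of Z.  As W
    varies these subsets tell where psi locates the points of Z in the symmetric
    power. *)
Definition localized (W : set symX) : set Y := [set y | psi (pid W) (y, y)].

Lemma localized_eq W y y' : open W -> psi (pid W) (y, y') -> y' = y.
Proof.
move=> oW h; apply/esym; apply: idempotent_partial_homeo h.
  by apply: psi_homeo; exact: PSid.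
by rewrite -psi_comp ?pid_comp //; exact: PSid.
Qed.

Lemma psi_pid W : open W -> psi (pid W) = pid (localized W).
Proof.
move=> oW; apply/seteqP; split => -[y y'] /=; last by move=> [/= Wy ->].
by move=> h; have e := localized_eq oW h; subst y'; split.
Qed.

Lemma localizedT : localized setT = Z.
Proof.
have [_ _ _ _ [e _]] := psiM; rewrite /localized e.
by apply/seteqP; split => y; [move=> []|].
Qed.

Lemma localized_mono V W : open V -> open W -> V `<=` W -> localized V `<=` localized W.
Proof.
move=> oV oW VW y; rewrite /localized /= -(pid_comp VW) psi_comp; [|exact: PSid|exact: PSid].
rewrite psi_pid // psi_pid // => -[z [/= Vy ->] [Wy _]].
by split.
Qed.

Lemma localized_Z W : open W -> localized W `<=` Z.
Proof. by move=> oW; rewrite -localizedT; apply: localized_mono => //; exact: openT. Qed.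

Lemma localized_open W : open W -> open (localized W).
Proof.
move=> oW; have := partial_homeo_dom_open (psi_homeo (PSid oW)).
rewrite psi_pid // (_ : _.`1 = localized W) //.
by apply/seteqP; split => [y [y' []]//|y Wy]; exists y.
Qed.

(** Otherwise W would be covered by open sets V with y outside [localized V],
    against the compatibility of psi with unions. *)
Lemma localized_point W y : open W -> localized W y ->
  exists B, W B /\ forall V, open V -> V B -> localized V y.
Proof.
move=> oW Wy; apply: contrapT => nB.
have HB B : W B -> exists V, [/\ open V, V B & ~ localized V y].
  move=> WB; apply: contrapT => nV; apply: nB; exists B; split => // V oV VB.
  by apply: contrapT => Vy; apply: nV; exists V.
pose FF := [set F : partial_map symX |
  exists V, [/\ F = pid V, open V, V `<=` W & ~ localized V y]].
have [_ _ _ psiU _] := psiM.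
have : psi (pid W) = \bigcup_(F in FF) psi F.
  rewrite -psiU; last first.
  - move=> _ _ [V [-> _ _ _]] [V' [-> _ _ _]]; split.
      by move=> B C C' [_ /= ->] [_ /= ->].
    by move=> B C C' [_ /= ->] [_ /= ->].
  - by move=> _ [V [-> oV _ _]]; exact: PSid.
  congr psi; apply/seteqP; split => [[B C] [/= WB ->]|[B C] [_ [V [-> _ VW _]] [/= VB ->]]].
    have [V [oV VB nVy]] := HB B WB.
    exists (pid (V `&` W)) => //; exists (V `&` W); split => //; first exact: openI.
    by move=> h; apply: nVy; apply: localized_mono h => //; exact: openI.
  by split => //=; exact: VW.
move=> e; move: Wy; rewrite /localized /= e => -[_ [V [-> oV _ nVy]]].
exact: nVy.
Qed.

(** The restriction of g to a neighbourhood W of B is the identity, so psi maps it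
    both to the restriction of alpha g and to the identity on
    [localized W]. *)
Lemma localized_fix (B : symX) g y : A g -> (\forall C \near B, symbij r g C = C) ->
  (forall V, open V -> V B -> localized V y) ->
  \forall y' \near y, alpha g y' = y'.
Proof.
move=> Ag /nbhs_interior gB By; set W := interior _ in gB.
have oW : open W by exact: open_interior.
have Wy : localized W y by apply: By => //; exact: nbhs_singleton.
apply: filterS (open_nbhs_in (localized_open oW) Wy) => y' Wy'.
have : psi (graph (symbij r g) \; pid W)%relation = psi (pid W).
  congr psi; apply/seteqP; split => -[C D] /=.
    by move=> [E [/= WC ->]]; rewrite /graph /= => ->; split => //=; exact: (interior_subset WC).
  move=> [/= WC ->]; exists C => //; rewrite /graph /=; exact/esym/(interior_subset WC).
have gF := alt_on_fullperm PP Ag.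
rewrite psi_comp; [|exact: (symmetric_pseudogroup_graph r PP GP gF)|exact: PSid].
rewrite psiE // psi_pid // => e.
have : pid (localized W) (y', y') by split.
by rewrite -e => -[z [/= _ ->] [w [/= _ ->]]]; rewrite /graph /= => <-.
Qed.

End morphism.

Section uniqueness.
Variables (X Y : topologicalType) (P : set (partial_map X)).
Hypothesis XC : cantor_like X.
Hypothesis PP : pseudogroup P.
Hypothesis Pmin : dense_orbits P.
Variables (G : set (germ_type X)) (H : set (germ_type Y)).
Hypothesis GP : pseudogroup_of G = P.
Local Notation PH := (pseudogroup_of H).
Hypothesis HP : pseudogroup PH.
Local Notation A := (alt_on P [set: X]).
Variable alpha : selfbij X -> selfbij Y.
Hypothesis alphaM : forall g h, A g -> A h -> alpha (g * h)%g = (alpha g * alpha h)%g.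
Hypothesis alpha_full : forall g, A g -> fullperm PH (alpha g).
Local Notation Z := (action_support P alpha).
Variables (r : nat) (qs : Y -> seq X).
Hypothesis qsP : forall y, Z y ->
  [/\ uniq (qs y), size (qs y) <= r,
    forall x, x \in qs y <-> exceptional P (germ_stabilizer P alpha y) x
  & forall g, A g -> agree (qs y) g id -> germ_stabilizer P alpha y g].
Local Notation symX := (symmetric_power X r).
Variable q : Y -> symX.
Hypothesis qE : forall y, Z y -> points (q y) = [set` qs y].
Local Notation PS := (pseudogroup_of (symmetric_groupoid r G)).

Let alpha_cont g : A g -> continuous (alpha g).
Proof. by move=> /alpha_full; exact: fullperm_cont. Qed.

Section one_morphism.
Variable psi : partial_map symX -> partial_map Y.
Hypothesis psiM :
  continuous_morphism setT (symmetric_groupoid r G) Z (restrict_groupoid H Z) psi.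
Hypothesis psiE : forall g, A g ->
  psi (graph (symbij r g)) = (graph (alpha g) \; pid Z)%relation.
Local Notation localized := (localized psi).

(** Elements trivial near B fix y, thus preserve q y; elements trivial near q y
    fix y, thus preserve B, since otherwise B and its image would have disjoint
    neighbourhoods.  By fixed_sub each set contains the other. *)
Lemma localized_point_eq y (B : symX) :
  (forall V, open V -> V B -> localized V y) -> B = q y.
Proof.
move=> By; have Zy : Z y.
  by apply: (localized_Z PP GP psiM openT); apply: By => //; exact: openT.
have [uy sy Ey Ky] := qsP Zy; have [s [us BE _]] := sym_seq B.
have sub1 : {subset qs y <= s}.
  apply: (fixed_sub XC PP Pmin) => g Ag gs x xq.
  have : \forall C \near B, symbij r g C = C.
    have gs1 : agree s g (1%g : selfbij X) := gs.
    by have := agree_symbij BE gs1; apply: filterS => C ->; rewrite symbij1.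
  move=> /(localized_fix PP GP psiM psiE Ag) /(_ By) /nbhs_singleton gy.
  by rewrite -gy (exceptional_alpha PP alphaM alpha_cont qsP).
have sub2 : {subset s <= qs y}.
  apply: (fixed_sub XC PP Pmin) => g Ag gs x xs.
  have [_ /nbhs_singleton gy] := Ky g Ag gs.
  suff gB : symbij r g B = B.
    have : points (symbij r g B) (g x) by rewrite symbijE; exists x => //; rewrite BE.
    by rewrite gB BE.
  apply: contrapT => /(sym_hausdorff XC)[M [N [oM oN Mg NB MN]]].
  have gF := alt_on_fullperm PP Ag.
  pose W := N `&` symbij r g @^-1` M.
  have oW : open W.
    apply: openI => //; apply: open_comp => // C _; exact: (symbij_cont PP gF).
  have Wy : localized W y by apply: By => //; split.
  have : psi (pid W \; (graph (symbij r g) \; pid W))%relation (y, y).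
    have Pg := symmetric_pseudogroup_graph r PP GP gF.
    have PW := symmetric_pseudogroup_pid PP GP oW.
    have PgW := symmetric_pseudogroup_restr PP GP gF oW.
    have [_ psi_comp _ _ _] := psiM.
    rewrite psi_comp // psi_comp // psiE //; exists y => //; exists y => //.
    exists y => //; rewrite /graph /=; exact/esym.
  rewrite (_ : (_ \; _)%relation = set0); last first.
    apply/seteqP; split => // -[C D] [E [E' [/= [_ WC] ->]]]; rewrite /graph /= => ->.
    move=> [/= [NgC _] _]; have : (M `&` N) (symbij r g C) by [].
    by rewrite MN.
  by have [_ _ _ _ [_ ->]] := psiM.
apply: sym_inj; rewrite qE // BE; apply/seteqP; split => x; [exact: sub2|exact: sub1].
Qed.

Lemma localizedE W : open W -> localized W = [set y | Z y /\ W (q y)].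
Proof.
move=> oW; apply/seteqP; split => y.
  move=> Wy; split; first exact: (localized_Z PP GP psiM oW).
  have [B [WB By]] := localized_point PP GP psiM oW Wy.
  by rewrite -(localized_point_eq By).
move=> [Zy Wq]; have Ty : localized setT y by rewrite (localizedT psiM).
have [B [_ By]] := localized_point PP GP psiM openT Ty.
by apply: (By) => //; rewrite (localized_point_eq By).
Qed.

(** Locally F is the action of some g, so F is a union of restrictions of such
    actions to open sets W, on which psi is prescribed: the right-hand side does
    not involve psi. *)
Lemma psi_formula F : PS F -> psi F =
  \bigcup_(gW in [set gW | [/\ A gW.1, open gW.2 &
       (graph (symbij r gW.1) \; pid gW.2)%relation `<=` F]])
    ((graph (alpha gW.1) \; pid Z) \; pid [set y | Z y /\ gW.2 (q y)])%relation.
Proof.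
move=> PF; have [_ psi_comp _ psiU _] := psiM; have [hF _] := PF.
pose J := [set gW : selfbij X * set symX | [/\ A gW.1, open gW.2 &
       (graph (symbij r gW.1) \; pid gW.2)%relation `<=` F]].
pose FF := [set K | exists2 gW, J gW & K = (graph (symbij r gW.1) \; pid gW.2)%relation].
have FE : F = \bigcup_(K in FF) K.
  apply/seteqP; split => [[C D] FCD|[C D] [_ [gW [_ _ gF] ->]]]; last exact: gF.
  have [|g Ag /nbhs_interior gF] := symmetric_pseudogroup_local XC PP Pmin GP PF (B := C).
    by exists D.
  set W := interior _ in gF.
  exists (graph (symbij r g) \; pid W)%relation.
    exists (g, W) => //; split => //=; first exact: open_interior.
    by move=> [C' D'] [E [/= WC' ->]] gE; apply/(interior_subset WC').
  exists C; first by split => //=; exact: (nbhs_singleton gF).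
  by rewrite /graph /=; apply/(interior_subset (nbhs_singleton gF)).
rewrite {1}FE psiU.
- apply/seteqP; split.
    move=> p [_ [[g W] [/= Ag oW gF] ->]].
    rewrite psi_comp; [|exact: (symmetric_pseudogroup_graph r PP GP (alt_on_fullperm PP Ag))
       |exact: (symmetric_pseudogroup_pid PP GP oW)].
    rewrite psiE // (psi_pid PP GP psiM oW) localizedE // => h.
    by exists (g, W).
  move=> p [[g W] [/= Ag oW gF]] h.
  exists (graph (symbij r g) \; pid W)%relation; first by exists (g, W).
  rewrite psi_comp; [|exact: (symmetric_pseudogroup_graph r PP GP (alt_on_fullperm PP Ag))
       |exact: (symmetric_pseudogroup_pid PP GP oW)].
  by rewrite psiE // (psi_pid PP GP psiM oW) localizedE.
- move=> _ [[g W] [/= Ag oW _] ->].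
  exact (symmetric_pseudogroup_restr PP GP (alt_on_fullperm PP Ag) oW).
- move=> K L [gW [_ _ KF] ->] [gW' [_ _ LF] ->]; split.
    by move=> C D D' /KF h /LF; exact: (partial_homeo_fun hF h).
  by move=> C C' D /KF h /LF; exact: (partial_homeo_inj hF h).
Qed.

End one_morphism.
End uniqueness.

(** * The extension theorem *)

Theorem theorem1p3 (X Y : topologicalType)
    (G : set (germ_type X)) (H : set (germ_type Y))
    (rho : partial_map X -> partial_map Y)
    (X_cantor : homeomorphic X cantor_space)
    (G_groupoid : groupoid_of_germs G)
    (G_minimal : minimal_groupoid G)
    (Y_hausdorff : hausdorff_space Y)
    (Y_compact : compact [set: Y])
    (H_groupoid : groupoid_of_germs H)
    (rho_full : forall g, alternating_full_group G g -> full_group H (rho g))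
    (rho_morph : forall g h,
       alternating_full_group G g -> alternating_full_group G h ->
       rho (g \; h)%relation = (rho g \; rho h)%relation)
    (rho_nontrivial : exists2 g, alternating_full_group G g & rho g <> pid setT) :
  let Z := group_support (rho @` alternating_full_group G) in
  let injective_germs :=
    exists2 y, Z y &
      forall g h, alternating_full_group G g -> alternating_full_group G h ->
        germ (rho g) y = germ (rho h) y -> g = h in
  let extends r (phi : partial_map (symmetric_power X r) -> partial_map Y) :=
    continuous_morphism setT (symmetric_groupoid r G)
                        Z (restrict_groupoid H Z) phi /\
    forall g, alternating_full_group G g ->
      phi (symmetric_action r g) = (rho g \; pid Z)%relation in
  let uniquely_extends :=
    clopen Z /\
    exists2 r, (1 <= r)%N &
      exists2 phi, extends r phi &
        forall psi, extends r psi ->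
          forall F, pseudogroup_of (symmetric_groupoid r G) F -> psi F = phi F in
  (injective_germs \/ uniquely_extends) /\
  ~ (injective_germs /\ uniquely_extends).
Proof.
have XC := cantor_like_homeomorphic X_cantor cantor_like_cantor_space.
have x0 : X by case: (cid X_cantor) => f /cid[g _]; exact: (g point).
have GP : pseudogroup (pseudogroup_of G).
  by have [P0 PP0 ->] := G_groupoid; rewrite germs_ofK.
have HP : pseudogroup (pseudogroup_of H).
  by have [P0 PP0 ->] := H_groupoid; rewrite germs_ofK.
set P := pseudogroup_of G in GP.
have Pmin : dense_orbits P.
  move=> x V oV V0; have [y [Vy [F PF Fxy]]] := G_minimal x V V0 oV.
  by exists y, F.
have altP F := alternatingP GP F.
have /choice[alpha Halpha] : forall g : selfbij X, exists a : selfbij Y,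
    alt_on P setT g -> rho (graph g) = graph a /\ fullperm (pseudogroup_of H) a.
  move=> g; have [gg|ng] := pselect (alt_on P setT g); last by exists 1%g.
  have /rho_full/(full_groupP HP)[a aE] : alternating_full_group G (graph g).
    by apply/altP; exists g.
  by exists a.
have rhoE g : alt_on P setT g -> rho (graph g) = graph (alpha g) by move=> /Halpha[].
have alpha_full g : alt_on P setT g -> fullperm (pseudogroup_of H) (alpha g) by move=> /Halpha[].
have alphaM g h : alt_on P setT g -> alt_on P setT h -> alpha (g * h)%g = (alpha g * alpha h)%g.
  move=> Ag Ah; apply: graph_inj; rewrite -rhoE; last exact: alt_on_mul.
  rewrite !graphM rho_morph ?rhoE //; apply/altP; [by exists g|by exists h].
have alpha_cont g : alt_on P setT g -> continuous (alpha g).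
  by move=> /alpha_full; exact: fullperm_cont.
move=> Z; have ZE : Z = action_support P alpha.
  rewrite /Z /group_support /action_support; congr closure; apply/seteqP; split => y.
    move=> [_ [y' [[_ /altP[g [-> Ag]] <-]]]]; rewrite rhoE // /graph /= => -> gy.
    by exists g.
  move=> [g Ag gy]; exists (graph (alpha g)), (alpha g y); split => //.
  by exists (graph g); [apply/altP; exists g|exact: rhoE].
clearbody Z; subst Z; set Z := action_support P alpha.
move=> injective_germs extends uniquely_extends.
have germ_rho g h y : alt_on P setT g -> alt_on P setT h ->
    germ (rho (graph g)) y = germ (rho (graph h)) y <->
    \forall y' \near y, alpha g y' = alpha h y'.
  move=> Ag Ah; rewrite !rhoE //; split.
    move=> /near_germ[].
    - exact: (pseudo_homeo HP) (alpha_full _ Ag).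
    - by exists (alpha g y).
    - by move=> _; apply: filterS => y' e; apply/(e (alpha g y')).
  by move=> gh; apply: germ_near; apply: filterS gh => y' e z; rewrite /graph /= e.
split; last first.
  move=> [[y Zy inj] [_ [r _ [phi [phiM phiE] _]]]].
  have phiE' g : alt_on P setT g -> phi (graph (symbij r g)) = (graph (alpha g) \; pid Z)%relation.
    move=> Ag; rewrite -symmetric_action_graph phiE ?rhoE //.
    by apply/altP; exists g.
  have Ty : localized phi setT y by rewrite (localizedT phiM).
  have [B [_ By]] := localized_point GP erefl phiM openT Ty.
  have [s [us BE _]] := sym_seq B.
  have [x xs] := avoid_seq XC s x0.
  have oV : open (~` [set` s]).
    by apply: closed_openC; apply: (finite_closed XC); exact: finite_seq.
  have [C [g [cC CV gg gx]]] := move_off XC GP Pmin [:: x] oV (negP xs).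
  have Ag : alt_on P setT g by exact: alt_on_mono gg.
  have gs : agree s g (1%g : selfbij X).
    by move=> z zs; apply: alt_on_fix_near cC gg _ => /CV; exact.
  have fixB : \forall C' \near B, symbij r g C' = C'.
    by have := agree_symbij BE gs; apply: filterS => C' ->; rewrite symbij1.
  have := localized_fix GP erefl phiM phiE' Ag fixB By.
  have A1 : alt_on P setT 1%g by exact: alt_on_one.
  move=> near_fix; have : graph g = graph 1%g.
    apply: inj; [by apply/altP; exists g|by apply/altP; exists 1%g|].
    apply/germ_rho => //; apply: filterS near_fix => y' ->.
    by rewrite (alpha1 alphaM).
  by move=> /graph_inj g1; move: gx; rewrite g1 inE eqxx.
have [[y Zy Ky]|nKy] := pselect (exists2 y, Z y &
    forall g, germ_stabilizer P alpha y g -> g = 1%g).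
  left; exists y => // _ _ /altP[g [-> Ag]] /altP[h [-> Ah]] /(germ_rho _ _ _ Ag Ah) gh.
  have AV : alt_on P setT h^-1%g by exact: alt_on_inv.
  suff /Ky/eqP : germ_stabilizer P alpha y (h^-1 * g)%g.
    by rewrite mulg_eq1 => /eqP/invg_inj ->.
  split; first exact: alt_on_mul.
  apply: filterS gh => y' e; rewrite alphaM // (alphaV alphaM) //.
  by rewrite selfbijME e selfbijK.
right.
have nontriv y : Z y -> exists2 g, germ_stabilizer P alpha y g & g <> 1%g.
  move=> Zy; apply: contrapT => ng; apply: nKy; exists y => // g Kg.
  by apply: contrapT => g1; apply: ng; exists g.
have [r0 [qs qs0]] := exceptional_sets x0 XC GP Pmin Y_compact alphaM alpha_cont nontriv.
(* The bound is increased by one only to make it positive. *)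
pose r := r0.+1.
have qsP y : Z y -> [/\ uniq (qs y), size (qs y) <= r,
    forall x, x \in qs y <-> exceptional P (germ_stabilizer P alpha y) x
  & forall g, alt_on P setT g -> agree (qs y) g id -> germ_stabilizer P alpha y g].
  by move=> /qs0[h1 h2 h3 h4]; split => //; exact: leqW.
have Zclopen : clopen Z.
  exact: (action_support_clopen XC GP Pmin Y_hausdorff alphaM alpha_cont qsP).
(* A constant value outside Z makes the map total. *)
have /choice[q qE] : forall y, exists B : symmetric_power X r, Z y -> points B = [set` qs y].
  move=> y; have [Zy|nZy] := pselect (Z y); last first.
    by have [B _] := @sym_of_range X r (fun=> x0) ord0; exists B.
  have [x xq] := exceptional_neq0 XC GP Pmin alphaM alpha_cont qsP Zy.
  have [_ sr _ _] := qsP y Zy.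
  by have [B BE] := sym_of_seq xq sr; exists B.
split => //; exists r => //.
have extM : continuous_morphism setT (symmetric_groupoid r G) Z (restrict_groupoid H Z)
    (extension P alpha q).
  exact: (extension_morphism XC GP Pmin Y_hausdorff erefl HP alphaM alpha_full qsP qE).
have ext_graph g : alt_on P setT g ->
    extension P alpha q (graph (symbij r g)) = (graph (alpha g) \; pid Z)%relation.
  move=> Ag; rewrite -symmetric_action_graph.
  exact: (extension_graph XC GP alphaM qsP qE Ag).
exists (extension P alpha q).
  split => // _ /altP[g [-> Ag]].
  by rewrite symmetric_action_graph ext_graph // rhoE.
move=> psi [psiM psiE] F PF.
have psiE' g : alt_on P setT g -> psi (graph (symbij r g)) = (graph (alpha g) \; pid Z)%relation.
  move=> Ag; rewrite -symmetric_action_graph psiE ?rhoE //.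
  by apply/altP; exists g.
rewrite (psi_formula XC GP Pmin erefl HP alphaM alpha_full qsP qE psiM psiE' PF).
by rewrite (psi_formula XC GP Pmin erefl HP alphaM alpha_full qsP qE extM ext_graph PF).
Qed.
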